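(* Let $\tau(x)=\sum_{n\neq 0} c_n\,e(nx)$ be a periodic distribution on $\mathbb R$ of period $1$ without constant term, and let $\tau_+(x)=\sum_{n>0}c_n\,e(nx)$ and $\tau_-(x)=\sum_{n<0}c_n\,e(nx)$. 1) For $k\in\mathbb N$ and $\alpha\in\mathbb R$ with $\alpha\le k$, the following conditions are equivalent: (a) $\tau\in C^{<\alpha}(\mathbb R)$; (b) $\tau_+\in C^{<\alpha}(\mathbb R)$ and $\tau_-\in C^{<\alpha}(\mathbb R)$; (c) for every $\epsilon>0$ there exists a constant $C=C(\epsilon)$ such that $\bigl|\sum_{|n|\le N}c_n\,n^k\,e(nx)\bigr|\le C\,N^{\epsilon+k-\alpha}$ as $N\to\infty$, uniformly in $x\in\mathbb R$; (d) for every $\epsilon>0$ there exists a constant $C=C(\epsilon)$ such that both $\bigl|\sum_{n=1}^N c_n\,n^k\,e(nx)\bigr|\le C\,N^{\epsilon+k-\alpha}$ and $\bigl|\sum_{n=1}^N c_{-n}\,n^k\,e(-nx)\bigr|\le C\,N^{\epsilon+k-\alpha}$ as $N\to\infty$, uniformly in $x\in\mathbb R$. 2) For $\alpha\in\mathbb R$ and $s\in\mathbb C$, condition (b) is equivalent to (e) $\sum_{n>0}\frac{c_n}{n^s}\,e(nx)\in C^{<(\alpha+\operatorname{Re}s)}(\mathbb R)$ and $\sum_{n>0}\frac{c_{-n}}{n^s}\,e(-nx)\in C^{<(\alpha+\operatorname{Re}s)}(\mathbb R)$.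
   Context: Notation: $e(x)=e^{2\pi i x}$. $C^{-\infty}(\mathbb R)$ is the space of complex-valued distributions on $\mathbb R$. Fourier series of periodic distributions are understood as converging in the sense of distributions (equivalently, the coefficients $c_n$ grow at most polynomially in $|n|$). ''As $N\to\infty$, uniformly in $x$'' means that the bound holds for all $x\in\mathbb R$ and all but finitely many positive integers $N$. The spaces $C^\alpha(\mathbb R)\subset C^{-\infty}(\mathbb R)$, $\alpha\in\mathbb R$, are defined as follows. For $0<\alpha<1$, $C^\alpha(\mathbb R)$ is the space of functions $f$ that are Hölder continuous of index $\alpha$: $|f(x)-f(y)|<C|x-y|^\alpha$, with $C>0$ that can be chosen locally uniformly in $x,y$. $C^0(\mathbb R)$ is the space of continuous functions. The definition is extended to all real $\alpha$ so that $C^{\alpha}(\mathbb R)=\frac{d}{dx}C^{\alpha+1}(\mathbb R)$ for all $\alpha\in\mathbb R$: for $\alpha\in[0,1)$ and $k\in\mathbb Z_{>0}$, $C^{\alpha+k}(\mathbb R)$ consists of the functions whose $k$-th derivative lies in $C^\alpha(\mathbb R)$, and $C^{\alpha-k}(\mathbb R)$ consists of the distributions that are $k$-th derivatives of elements of $C^\alpha(\mathbb R)$. Finally $C^{<\alpha}(\mathbb R)=\bigcap_{\beta<\alpha}C^\beta(\mathbb R)$. *)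

(* Defs.v *)
From Stdlib Require Import Reals ZArith.
From Coquelicot Require Import Coquelicot.

Open Scope R_scope.

Definition Cexp (z : C) : C :=
  (exp (Re z) * cos (Im z), exp (Re z) * sin (Im z)).

Definition e (x : R) : C := Cexp (0, 2 * PI * x).

(** [x ^ s] for [x > 0] and a complex exponent, with the real logarithm. *)
Definition Rcpower (x : R) (s : C) : C := Cexp (RtoC (ln x) * s)%C.

Definition ex_Cderive_n (f : R -> C) (n : nat) (x : R) : Prop :=
  ex_derive_n (fun y => Re (f y)) n x /\ ex_derive_n (fun y => Im (f y)) n x.

Definition Cderive_n (f : R -> C) (n : nat) (x : R) : C :=
  (Derive_n (fun y => Re (f y)) n x, Derive_n (fun y => Im (f y)) n x).

(** Only used for continuous integrands with compact support. *)
Definition integral (f : R -> C) : C :=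
  RInt_gen (V := C_R_CompleteNormedModule) f
    (Rbar_locally m_infty) (Rbar_locally p_infty).

Definition supported_in (A : R) (phi : R -> C) : Prop :=
  forall x, A < Rabs x -> phi x = RtoC 0.

Definition test_function (phi : R -> C) : Prop :=
  (forall n x, ex_Cderive_n phi n x) /\ exists A, supported_in A phi.

(** The values of a functional on functions that are not test functions carry
    no meaning; two functionals are identified by [distr_eq]. *)
Definition functional := (R -> C) -> C.

Definition distr_eq (T U : functional) : Prop :=
  forall phi, test_function phi -> T phi = U phi.

(** In [distr_continuous], [b] is any common bound of the sup norms of the
    derivatives up to order [m], so the estimate is the usual one by the seminorm
    [max_(j <= m) sup |phi^(j)|]. *)
Record distribution := {
  distr :> functional;
  distr_plus : forall phi psi, test_function phi -> test_function psi ->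
    distr (fun x => phi x + psi x)%C = (distr phi + distr psi)%C;
  distr_scal : forall (a : C) phi, test_function phi ->
    distr (fun x => a * phi x)%C = (a * distr phi)%C;
  distr_continuous : forall A : R, exists (m : nat) (K : R),
    forall (phi : R -> C) (b : R), test_function phi -> supported_in A phi ->
      (forall j x, (j <= m)%nat -> Cmod (Cderive_n phi j x) <= b) ->
      Cmod (distr phi) <= K * b
}.

Definition distr_of_fun (f : R -> C) : functional :=
  fun phi => integral (fun x => f x * phi x)%C.

Definition distr_deriv (k : nat) (T : functional) : functional :=
  fun phi => (RtoC ((-1) ^ k) * T (Cderive_n phi k))%C.

(** Invariance under [x |-> x + p], by duality. *)
Definition periodic (p : R) (T : functional) : Prop :=
  forall phi, test_function phi -> T (fun x => phi (x - p)) = T phi.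

Definition cvg_distr (F : nat -> R -> C) (T : functional) : Prop :=
  forall phi, test_function phi ->
    filterlim (fun N => distr_of_fun (F N) phi) eventually (locally (T phi)).

(** [x <> y] is required because [Rpower 0 a = 1]. *)
Definition holder (a : R) (f : R -> C) : Prop :=
  (a = 0 /\ forall x, continuous f x) \/
  (0 < a < 1 /\
   forall A : R, exists K : R, 0 < K /\
     forall x y, Rabs x <= A -> Rabs y <= A -> x <> y ->
       Cmod (f x - f y)%C < K * Rpower (Rabs (x - y)) a).

(** Every real [alpha] is [a + k] or [a - k] with [0 <= a < 1] and [k : nat];
    the two cases agree when [k = 0]. *)
Definition C_space (alpha : R) (T : functional) : Prop :=
  exists (a : R) (k : nat) (f : R -> C), 0 <= a < 1 /\
    ((alpha = a + INR k /\
      (forall j x, (j <= k)%nat -> ex_Cderive_n f j x) /\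
      holder a (Cderive_n f k) /\
      distr_eq T (distr_of_fun f)) \/
     (alpha = a - INR k /\
      holder a f /\
      distr_eq T (distr_deriv k (distr_of_fun f)))).

Definition C_lt_space (alpha : R) (T : functional) : Prop :=
  forall beta, beta < alpha -> C_space beta T.

(** [\sum_(|n| <= N) c n * e (n x)]; the index is [n = j - N], [0 <= j <= 2N]. *)
Definition two_sided_sum (c : Z -> C) (N : nat) (x : R) : C :=
  sum_n_m (fun j => let n := (Z.of_nat j - Z.of_nat N)%Z in
                    c n * e (IZR n * x))%C 0 (2 * N).

(** [\sum_(1 <= n <= N) a n * e (n x)] and [\sum_(1 <= n <= N) a n * e (- n x)]. *)
Definition pos_sum (a : nat -> C) (N : nat) (x : R) : C :=
  sum_n_m (fun n => a n * e (INR n * x))%C 1 N.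

Definition neg_sum (a : nat -> C) (N : nat) (x : R) : C :=
  sum_n_m (fun n => a n * e (- INR n * x))%C 1 N.

(** The series with partial sums [F] converges in the sense of distributions,
    and its sum lies in C^{<alpha}(R). *)
Definition series_in_C_lt (alpha : R) (F : nat -> R -> C) : Prop :=
  exists T : distribution, cvg_distr F T /\ C_lt_space alpha T.

(* Main.v *)
Require Import Defs.
From Stdlib Require Import Reals ZArith Lra Lia FunctionalExtensionality.
From Coquelicot Require Import Coquelicot.
Open Scope R_scope.

(** Both (a) and (b) are compared with growth bounds for the one-sided partial sums.

    If [tau] is the [j]-th derivative of a Hölder function [f], the one-sided partial sum
    at [x] is, up to sign, the integral of [f] against the [j]-th derivative of
    [y |-> chi (y - x) * D (y - x)], where [D] is a one-sided Dirichlet kernel and the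
    integer translates of the smooth function [chi] sum to [1]. Since [f] is only used
    near [x], it need not be periodic. The [L^1] norm of [D] is [O(log N)], which is
    absorbed by [N ^ eps], and replacing [f] by its average over an interval of length
    [1/N] gains the Hölder exponent. Pairing the two-sided partial sums themselves with
    the same kernel shows that (c) implies (d).

    Conversely, Abel summation moves a bound for the partial sums from the weight [n ^ k]
    to any weight [n ^ r] with [r] complex: as a growth bound when the resulting exponent
    is positive, as a bound for the tails when it is negative. Tails give a uniformly
    convergent primitive or derivative of the series, and its Hölder continuity follows
    by comparing with the partial sum of order [1 / |x - y|]. The same change of weight
    is the shift by [Re s] in (e). *)

(** * Calculus of complex-valued functions of a real variable *)

(** All conditions meet in one family of bounds, [growth] with order [b] for every [b < alpha],
    never at [b = alpha] itself. The open family leaves room for logarithms and keeps changes of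
    weight away from the critical exponent zero, where Abel summation would turn a power into a
    logarithm. The hypothesis [alpha <= k] makes the exponents [eps + k - alpha] positive: in that
    regime growth bounds pass from one weight to another, and finitely many initial values of [N]
    can be absorbed into the constant.

    Projection onto positive frequencies is not bounded for the sup norm, so a bound for a two-sided
    object does not split for free. The price is the [L^1] norm of the one-sided kernel, which is
    only logarithmic and hence invisible on the open scale. This is why (a) and (b), or (c) and (d),
    agree although the corresponding statements at a single exponent need not.

    Derivatives and integrals of complex functions are taken componentwise, which reduces every
    analytic fact to its real version. *)

Definition cder (f g : R -> C) : Prop :=
  forall x, is_derive (fun y => Re (f y)) x (Re (g x)) /\
            is_derive (fun y => Im (f y)) x (Im (g x)).

Definition ccont (f : R -> C) : Prop :=
  forall x, continuous (fun y => Re (f y)) x /\ continuous (fun y => Im (f y)) x.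

Definition cint (f : R -> C) (a b : R) : C :=
  (RInt (fun x => Re (f x)) a b, RInt (fun x => Im (f x)) a b).

Lemma C_ext (z w : C) : Re z = Re w -> Im z = Im w -> z = w.
Proof. destruct z, w; simpl; congruence. Qed.

Lemma im_le_Cmod (z : C) : Rabs (Im z) <= Cmod z.
Proof. exact (Rle_trans _ _ _ (Rmax_r _ _) (Rmax_Cmod z)). Qed.

Lemma Cmod_le_sum (z : C) : Cmod z <= Rabs (Re z) + Rabs (Im z).
Proof.
  replace z with (RtoC (Re z) + Ci * RtoC (Im z))%C at 1
    by (apply C_ext; simpl; ring).
  eapply Rle_trans; [apply Cmod_triangle|].
  rewrite Cmod_mult, !Cmod_R, Cmod_Ci. lra.
Qed.

Lemma is_derive_eq (f : R -> R) (x l l' : R) :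
  is_derive f x l -> l = l' -> is_derive f x l'.
Proof. now intros H <-. Qed.

Lemma is_derive_Rplus (f g : R -> R) (x a b : R) :
  is_derive f x a -> is_derive g x b -> is_derive (fun y => f y + g y) x (a + b).
Proof. exact (is_derive_plus (V := R_NormedModule) f g x a b). Qed.

Lemma is_derive_Rminus (f g : R -> R) (x a b : R) :
  is_derive f x a -> is_derive g x b -> is_derive (fun y => f y - g y) x (a - b).
Proof. exact (is_derive_minus (V := R_NormedModule) f g x a b). Qed.

Lemma is_derive_Rmult (f g : R -> R) (x a b : R) :
  is_derive f x a -> is_derive g x b ->
  is_derive (fun y => f y * g y) x (a * g x + f x * b).
Proof. intros Hf Hg; exact (is_derive_mult f g x a b Hf Hg Rmult_comm). Qed.

Lemma cder_const (z : C) : cder (fun _ => z) (fun _ => RtoC 0).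
Proof. intros x; split; apply (is_derive_const (V := R_NormedModule)). Qed.

Lemma cder_plus (f f' g g' : R -> C) : cder f f' -> cder g g' ->
  cder (fun x => f x + g x)%C (fun x => f' x + g' x)%C.
Proof.
  intros Hf Hg x; destruct (Hf x), (Hg x).
  split; simpl; apply is_derive_Rplus; assumption.
Qed.

Lemma cder_mult (f f' g g' : R -> C) : cder f f' -> cder g g' ->
  cder (fun x => f x * g x)%C (fun x => f' x * g x + f x * g' x)%C.
Proof.
  intros Hf Hg x; destruct (Hf x) as [a b], (Hg x) as [c d]; split; simpl.
  - eapply is_derive_eq.
    + apply is_derive_Rminus; apply is_derive_Rmult; eassumption.
    + unfold Re, Im; ring.
  - eapply is_derive_eq.
    + apply is_derive_Rplus; apply is_derive_Rmult; eassumption.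
    + unfold Re, Im; ring.
Qed.

Lemma cder_scal (z : C) (f f' : R -> C) : cder f f' ->
  cder (fun x => z * f x)%C (fun x => z * f' x)%C.
Proof.
  intros Hf; generalize (cder_mult _ _ _ _ (cder_const z) Hf).
  replace (fun x => RtoC 0 * f x + z * f' x)%C with (fun x => z * f' x)%C; [easy|].
  apply functional_extensionality; intros x; ring.
Qed.

Lemma cder_comp_affine (s b : R) (f f' : R -> C) : cder f f' ->
  cder (fun x => f (s * x + b)) (fun x => RtoC s * f' (s * x + b)%R)%C.
Proof.
  intros Hf x; destruct (Hf (s * x + b)) as [H1 H2].
  assert (D : is_derive (fun x => s * x + b) x s) by (auto_derive; [easy|ring]).
  split.
  - eapply is_derive_eq; [exact (is_derive_comp _ _ _ _ _ H1 D)|].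
    unfold scal; simpl; unfold mult, Re, Im; simpl; ring.
  - eapply is_derive_eq; [exact (is_derive_comp _ _ _ _ _ H2 D)|].
    unfold scal; simpl; unfold mult, Re, Im; simpl; ring.
Qed.

Lemma cder_shift (b : R) (f f' : R -> C) : cder f f' ->
  cder (fun x => f (x + b)) (fun x => f' (x + b)).
Proof.
  intros Hf; generalize (cder_comp_affine 1 b _ _ Hf).
  replace (fun x => f (1 * x + b)) with (fun x => f (x + b))
    by (apply functional_extensionality; intros y; now rewrite Rmult_1_l).
  replace (fun x => RtoC 1 * f' (1 * x + b)%R)%C with (fun x => f' (x + b)); [easy|].
  apply functional_extensionality; intros y; now rewrite Cmult_1_l, Rmult_1_l.
Qed.

Lemma cder_e (a : R) :
  cder (fun x => e (a * x)) (fun x => (0, 2 * PI * a)%R * e (a * x))%C.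
Proof.
  intros x; unfold e, Cexp; split; simpl; auto_derive; try easy; ring.
Qed.

Lemma ccont_cder (f f' : R -> C) : cder f f' -> ccont f.
Proof.
  intros Hf x; destruct (Hf x) as [H1 H2]; split;
    apply (ex_derive_continuous (V := R_NormedModule)); eexists; eassumption.
Qed.

Lemma ccont_const (z : C) : ccont (fun _ => z).
Proof. exact (ccont_cder _ _ (cder_const z)). Qed.

Lemma ccont_plus (f g : R -> C) : ccont f -> ccont g ->
  ccont (fun x => f x + g x)%C.
Proof.
  intros Hf Hg x; destruct (Hf x), (Hg x); split; simpl;
    apply (continuous_plus (V := R_NormedModule)); assumption.
Qed.

Lemma ccont_mult (f g : R -> C) : ccont f -> ccont g ->
  ccont (fun x => f x * g x)%C.
Proof.
  intros Hf Hg x; destruct (Hf x), (Hg x); split; simpl.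
  - apply (continuous_minus (V := R_NormedModule));
      apply (continuous_mult (K := R_AbsRing)); assumption.
  - apply (continuous_plus (V := R_NormedModule));
      apply (continuous_mult (K := R_AbsRing)); assumption.
Qed.

Lemma ccont_shift (b : R) (f : R -> C) : ccont f -> ccont (fun x => f (x + b)).
Proof.
  intros Hf x; destruct (Hf (x + b)) as [H1 H2].
  assert (D : continuous (fun x => x + b) x)
    by (apply (continuous_plus (V := R_NormedModule));
        [apply continuous_id | apply continuous_const]).
  split.
  - exact (continuous_comp _ (fun y => Re (f y)) x D H1).
  - exact (continuous_comp _ (fun y => Im (f y)) x D H2).
Qed.

Lemma ccont_minus (f g : R -> C) : ccont f -> ccont g ->
  ccont (fun x => f x - g x)%C.
Proof.
  intros Hf Hg x; destruct (Hf x), (Hg x); split; simpl;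
    apply (continuous_minus (V := R_NormedModule)); assumption.
Qed.

Lemma ccont_ex_RInt (f : R -> C) (a b : R) : ccont f ->
  ex_RInt (fun x => Re (f x)) a b /\ ex_RInt (fun x => Im (f x)) a b.
Proof.
  intros Hf; split; apply (ex_RInt_continuous (V := R_CompleteNormedModule));
    intros z _; apply (Hf z).
Qed.

Lemma cint_plus (f g : R -> C) (a b : R) : ccont f -> ccont g ->
  cint (fun x => f x + g x)%C a b = (cint f a b + cint g a b)%C.
Proof.
  intros Hf Hg; destruct (ccont_ex_RInt f a b Hf), (ccont_ex_RInt g a b Hg).
  apply C_ext; simpl; apply (RInt_plus (V := R_CompleteNormedModule)); assumption.
Qed.

Lemma cint_scal (z : C) (f : R -> C) (a b : R) : ccont f ->
  cint (fun x => z * f x)%C a b = (z * cint f a b)%C.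
Proof.
  intros Hf; destruct (ccont_ex_RInt f a b Hf) as [H1 H2].
  assert (L : forall u v, RInt (fun x => u * Re (f x) + v * Im (f x)) a b =
    u * RInt (fun x => Re (f x)) a b + v * RInt (fun x => Im (f x)) a b).
  { intros u v.
    apply is_RInt_unique, (is_RInt_plus (V := R_NormedModule));
      apply (is_RInt_scal (V := R_NormedModule));
      apply (RInt_correct (V := R_CompleteNormedModule)); assumption. }
  apply C_ext; simpl.
  - transitivity (Re z * RInt (fun x => Re (f x)) a b
                  + - Im z * RInt (fun x => Im (f x)) a b).
    + rewrite <- L; f_equal; apply functional_extensionality; intros x;
      unfold Re, Im; ring.
    + unfold Re, Im; ring.
  - transitivity (Im z * RInt (fun x => Re (f x)) a b
                  + Re z * RInt (fun x => Im (f x)) a b).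
    + rewrite <- L; f_equal; apply functional_extensionality; intros x;
      unfold Re, Im; ring.
    + unfold Re, Im; ring.
Qed.

Lemma cint_minus (f g : R -> C) (a b : R) : ccont f -> ccont g ->
  cint (fun x => f x - g x)%C a b = (cint f a b - cint g a b)%C.
Proof.
  intros Hf Hg; destruct (ccont_ex_RInt f a b Hf), (ccont_ex_RInt g a b Hg).
  apply C_ext; simpl; apply (RInt_minus (V := R_CompleteNormedModule)); assumption.
Qed.

Lemma cint_ext (f g : R -> C) (a b : R) :
  a <= b -> (forall x, a < x < b -> f x = g x) -> cint f a b = cint g a b.
Proof.
  intros ab H; apply C_ext; simpl; apply RInt_ext; intros x;
    rewrite Rmin_left, Rmax_right by assumption; intros Hx; now rewrite H.
Qed.

Lemma cint_Chasles (f : R -> C) (a b c : R) : ccont f ->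
  (cint f a b + cint f b c)%C = cint f a c.
Proof.
  intros Hf; destruct (ccont_ex_RInt f a b Hf), (ccont_ex_RInt f b c Hf).
  apply C_ext; simpl; apply (RInt_Chasles (V := R_CompleteNormedModule)); assumption.
Qed.

Lemma cint_const (z : C) (a b : R) : cint (fun _ => z) a b = (RtoC (b - a) * z)%C.
Proof.
  apply C_ext; simpl; rewrite RInt_const; unfold scal; simpl;
    unfold mult, Re, Im; simpl; ring.
Qed.

Lemma cint_zero (f : R -> C) (a b : R) : a <= b ->
  (forall x, a < x < b -> f x = RtoC 0) -> cint f a b = RtoC 0.
Proof.
  intros ab H; rewrite (cint_ext f (fun _ => RtoC 0) a b ab H), cint_const; ring.
Qed.

Lemma cint_cder (f g : R -> C) (a b : R) : cder f g -> ccont g ->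
  cint g a b = (f b - f a)%C.
Proof.
  intros Hf Hg; apply C_ext; simpl; apply is_RInt_unique.
  - apply (is_RInt_derive (V := R_CompleteNormedModule) (fun x => Re (f x)));
      intros x _; [apply (Hf x) | apply (Hg x)].
  - apply (is_RInt_derive (V := R_CompleteNormedModule) (fun x => Im (f x)));
      intros x _; [apply (Hf x) | apply (Hg x)].
Qed.

Lemma cder_cint (f : R -> C) (a : R) : ccont f -> cder (fun x => cint f a x) f.
Proof.
  intros Hf x; split; simpl.
  - apply (is_derive_RInt (V := R_NormedModule) (fun t => Re (f t)) _ a);
      [|apply (Hf x)]; apply filter_forall; intros y.
    apply (RInt_correct (V := R_CompleteNormedModule)), (ccont_ex_RInt f a y Hf).
  - apply (is_derive_RInt (V := R_NormedModule) (fun t => Im (f t)) _ a);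
      [|apply (Hf x)]; apply filter_forall; intros y.
    apply (RInt_correct (V := R_CompleteNormedModule)), (ccont_ex_RInt f a y Hf).
Qed.

Lemma cint_parts (f f' g g' : R -> C) (a b : R) :
  cder f f' -> cder g g' -> ccont f' -> ccont g' ->
  g a = RtoC 0 -> g b = RtoC 0 ->
  cint (fun x => f x * g' x)%C a b = (- cint (fun x => f' x * g x)%C a b)%C.
Proof.
  intros Hf Hg Hf' Hg' ga gb.
  assert (Cf := ccont_cder _ _ Hf); assert (Cg := ccont_cder _ _ Hg).
  assert (E : cint (fun x => f' x * g x + f x * g' x)%C a b = RtoC 0).
  { rewrite (cint_cder _ _ a b (cder_mult _ _ _ _ Hf Hg));
      [rewrite ga, gb; ring | apply ccont_plus; apply ccont_mult; assumption]. }
  rewrite cint_plus in E by (apply ccont_mult; assumption).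
  replace (cint (fun x => f x * g' x)%C a b) with
    ((cint (fun x => f' x * g x)%C a b + cint (fun x => f x * g' x)%C a b)
     - cint (fun x => f' x * g x)%C a b)%C by ring.
  rewrite E; ring.
Qed.

Lemma cint_shift (f : R -> C) (b u v : R) : ccont f ->
  cint (fun x => f (x + b)) u v = cint f (u + b) (v + b).
Proof.
  intros Hf; assert (D := cder_cint f 0 Hf).
  rewrite (cint_cder _ _ u v (cder_shift b _ _ D)) by now apply ccont_shift.
  now rewrite (cint_cder _ _ (u + b) (v + b) D).
Qed.

(** The constant [2] comes from estimating the two components separately. *)
Lemma cint_le (f : R -> C) (g : R -> R) (a b I : R) : a <= b -> ccont f ->
  (forall x, a <= x <= b -> Cmod (f x) <= g x) -> is_RInt g a b I ->
  Cmod (cint f a b) <= 2 * I.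
Proof.
  intros ab Hf Hg HI; destruct (ccont_ex_RInt f a b Hf) as [H1 H2].
  assert (L : forall h : C -> R, (forall z, Rabs (h z) <= Cmod z) ->
    ex_RInt (fun x => h (f x)) a b -> Rabs (RInt (fun x => h (f x)) a b) <= I).
  { intros h Hh Hex.
    apply (norm_RInt_le (V := R_NormedModule) (fun x => h (f x)) g a b);
      try assumption.
    - intros x Hx; eapply Rle_trans; [apply Hh | now apply Hg].
    - apply (RInt_correct (V := R_CompleteNormedModule)); assumption. }
  eapply Rle_trans; [apply Cmod_le_sum|].
  assert (A1 := L Re re_le_Cmod H1). assert (A2 := L Im im_le_Cmod H2).
  simpl; simpl in A1, A2; lra.
Qed.

Lemma cint_le_const (f : R -> C) (M a b : R) : a <= b -> ccont f ->
  (forall x, a <= x <= b -> Cmod (f x) <= M) -> Cmod (cint f a b) <= 2 * ((b - a) * M).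
Proof.
  intros ab Hf HM; apply (cint_le f (fun _ => M)); try assumption.
  apply (is_RInt_const (V := R_NormedModule)).
Qed.

Lemma ccont_continuous (f : R -> C) : ccont f -> forall x, continuous f x.
Proof.
  intros Hf x; destruct (Hf x) as [H1 H2].
  apply (continuous_ext (fun y => (Re (f y), Im (f y)))).
  - intros y; now destruct (f y).
  - unfold continuous; apply filterlim_locally; intros eps.
    generalize (filter_and _ _ (proj1 (filterlim_locally _ _) H1 eps)
                               (proj1 (filterlim_locally _ _) H2 eps)).
    apply filter_imp; intros y [A B]; now split.
Qed.

Lemma continuous_ccont (f : R -> C) : (forall x, continuous f x) -> ccont f.
Proof.
  intros Hf x; split.
  - apply (continuous_comp f fst x); [apply Hf | apply continuous_fst].
  - apply (continuous_comp f snd x); [apply Hf | apply continuous_snd].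
Qed.

Lemma supported_in_le (A B : R) (f : R -> C) :
  A <= B -> supported_in A f -> supported_in B f.
Proof. intros AB H x Hx; apply H; lra. Qed.

Lemma cint_supported (f : R -> C) (A u v : R) : 0 <= A -> ccont f -> supported_in A f ->
  u <= - A -> A <= v -> cint f u v = cint f (- A) A.
Proof.
  intros A0 Hf Hs Hu Hv.
  assert (Z : forall u v, u <= v -> (A <= u \/ v <= - A) -> cint f u v = RtoC 0).
  { intros u' v' uv [H|H]; apply cint_zero; try easy; intros x Hx; apply Hs;
      [rewrite Rabs_right | rewrite Rabs_left]; lra. }
  rewrite <- (cint_Chasles f u (- A) v Hf), <- (cint_Chasles f (- A) A v Hf).
  rewrite (Z u (- A)), (Z A v) by (lra || auto with real); ring.
Qed.

(** Once both endpoints lie beyond the support the integral no longer depends on them, so the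
    improper integral is the limit of an eventually constant value. *)
Lemma integral_cint (f : R -> C) (A : R) : 0 <= A -> ccont f -> supported_in A f ->
  integral f = cint f (- A) A.
Proof.
  intros A0 Hf Hs; unfold integral.
  apply (is_RInt_gen_unique (V := C_R_CompleteNormedModule)).
  intros P HP; unfold filtermapi.
  exists (fun u => u < - A) (fun v => A < v).
  - exists (- A); intros u Hu; exact Hu.
  - exists A; intros v Hv; exact Hv.
  - intros u v Hu Hv; simpl; exists (cint f u v); split.
    + apply (is_RInt_fct_extend_pair (U := R_NormedModule) (V := R_NormedModule));
        apply (RInt_correct (V := R_CompleteNormedModule));
        apply (ccont_ex_RInt f u v Hf).
    + rewrite (cint_supported f A) by (assumption || lra); now apply locally_singleton.
Qed.

(** * Test functions and distributional derivatives *)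

(** [n]-fold differentiability, unfolded one derivative at a time from the inside,
    which makes closure under products a plain induction. *)
Fixpoint Csmooth (n : nat) (f : R -> C) : Prop :=
  match n with
  | O => True
  | S n => exists g, cder f g /\ Csmooth n g
  end.

Lemma Csmooth_pred (n : nat) (f : R -> C) : Csmooth (S n) f -> Csmooth n f.
Proof.
  revert f; induction n as [|n IH]; intros f [g [Hg H]]; [easy|].
  exists g; split; [assumption | now apply IH].
Qed.

Lemma Csmooth_plus (n : nat) (f g : R -> C) :
  Csmooth n f -> Csmooth n g -> Csmooth n (fun x => f x + g x)%C.
Proof.
  revert f g; induction n as [|n IH]; [easy|].
  intros f g [f' [Hf Sf]] [g' [Hg Sg]].
  exists (fun x => f' x + g' x)%C; split; [now apply cder_plus | now apply IH].
Qed.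

Lemma Csmooth_const (n : nat) (z : C) : Csmooth n (fun _ => z).
Proof.
  revert z; induction n as [|n IH]; [easy|].
  intros z; exists (fun _ => RtoC 0); split; [apply cder_const | apply IH].
Qed.

Lemma Csmooth_mult (n : nat) (f g : R -> C) :
  Csmooth n f -> Csmooth n g -> Csmooth n (fun x => f x * g x)%C.
Proof.
  revert f g; induction n as [|n IH]; [easy|].
  intros f g Hf Hg; assert (Hf' := Csmooth_pred _ _ Hf); assert (Hg' := Csmooth_pred _ _ Hg).
  destruct Hf as [f' [Hf Sf]], Hg as [g' [Hg Sg]].
  exists (fun x => f' x * g x + f x * g' x)%C; split; [now apply cder_mult|].
  apply Csmooth_plus; now apply IH.
Qed.

Lemma Csmooth_comp_affine (s b : R) (n : nat) (f : R -> C) :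
  Csmooth n f -> Csmooth n (fun x => f (s * x + b)).
Proof.
  revert f; induction n as [|n IH]; [easy|].
  intros f [g [Hg Sg]]; eexists; split; [apply cder_comp_affine, Hg|].
  apply Csmooth_mult; [apply Csmooth_const | now apply IH].
Qed.

Lemma Csmooth_shift (b : R) (n : nat) (f : R -> C) :
  Csmooth n f -> Csmooth n (fun x => f (x + b)).
Proof.
  intros H; replace (fun x => f (x + b)) with (fun x => f (1 * x + b));
    [now apply Csmooth_comp_affine|].
  apply functional_extensionality; intros x; now rewrite Rmult_1_l.
Qed.

(** [Derive_n] adds derivatives on the outside, while [Csmooth] peels them off from the inside; this
    is the exchange between the two conventions. *)
Lemma Cderive_n_S (f g : R -> C) (n : nat) : cder f g ->
  Cderive_n f (S n) = Cderive_n g n.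
Proof.
  intros H; assert (A : Derive (fun y => Re (f y)) = (fun y => Re (g y)) /\
                        Derive (fun y => Im (f y)) = (fun y => Im (g y))).
  { split; apply functional_extensionality; intros x; apply is_derive_unique, (H x). }
  destruct A as [A B].
  induction n as [|n IH]; apply functional_extensionality; intros x; unfold Cderive_n.
  - simpl; change (Derive (fun y => Re (f y)) x) with ((Derive (fun y => Re (f y))) x).
    rewrite A, B; now destruct (g x).
  - assert (IR : Derive_n (fun y => Re (f y)) (S n) = Derive_n (fun y => Re (g y)) n).
    { apply functional_extensionality; intros y.
      exact (f_equal (fun h : R -> C => Re (h y)) IH). }
    assert (II : Derive_n (fun y => Im (f y)) (S n) = Derive_n (fun y => Im (g y)) n).
    { apply functional_extensionality; intros y.
      exact (f_equal (fun h : R -> C => Im (h y)) IH). }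
    change (Derive_n (fun y => Re (f y)) (S (S n)) x) with
      (Derive (Derive_n (fun y => Re (f y)) (S n)) x).
    change (Derive_n (fun y => Im (f y)) (S (S n)) x) with
      (Derive (Derive_n (fun y => Im (f y)) (S n)) x).
    now rewrite IR, II.
Qed.

Lemma ex_Cderive_n_S (f g : R -> C) (n : nat) (x : R) : cder f g ->
  ex_Cderive_n g n x -> ex_Cderive_n f (S n) x.
Proof.
  intros H [H1 H2]; destruct n as [|n].
  - split; simpl; eexists; apply (H x).
  - assert (E := Cderive_n_S f g n H).
    split.
    + change (ex_derive (Derive_n (fun y => Re (f y)) (S n)) x).
      replace (Derive_n (fun y => Re (f y)) (S n)) with (Derive_n (fun y => Re (g y)) n);
        [exact H1|].
      apply functional_extensionality; intros y.
      symmetry; exact (f_equal (fun h : R -> C => Re (h y)) E).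
    + change (ex_derive (Derive_n (fun y => Im (f y)) (S n)) x).
      replace (Derive_n (fun y => Im (f y)) (S n)) with (Derive_n (fun y => Im (g y)) n);
        [exact H2|].
      apply functional_extensionality; intros y.
      symmetry; exact (f_equal (fun h : R -> C => Im (h y)) E).
Qed.

Lemma Csmooth_ex_Cderive_n (n : nat) (f : R -> C) (x : R) : Csmooth n f -> ex_Cderive_n f n x.
Proof.
  revert f; induction n as [|n IH]; [easy|].
  intros f [g [Hg Sg]]; apply (ex_Cderive_n_S f g); [assumption | now apply IH].
Qed.

Lemma Cderive_n_0 (f : R -> C) : Cderive_n f 0 = f.
Proof.
  apply functional_extensionality; intros x; unfold Cderive_n; simpl; now destruct (f x).
Qed.

Lemma cder_Cderive_n (f : R -> C) (n : nat) :
  (forall x, ex_Cderive_n f (S n) x) -> cder (Cderive_n f n) (Cderive_n f (S n)).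
Proof. intros H x; destruct (H x); split; now apply Derive_correct. Qed.

Lemma Csmooth_all (f : R -> C) : (forall n x, ex_Cderive_n f n x) -> forall n, Csmooth n f.
Proof.
  intros H n; rewrite <- (Cderive_n_0 f).
  (* The induction needs the claim for every iterate [Cderive_n f m], not only for [f]. *)
  generalize 0%nat; induction n as [|n IH]; [easy|]; intros m.
  exists (Cderive_n f (S m)); split; [now apply cder_Cderive_n | apply IH].
Qed.

(** The region [A < Rabs x] is open, so the function vanishes in a neighbourhood of each of its
    points and its derivative vanishes there as well. *)
Lemma supported_in_cder (A : R) (f g : R -> C) : cder f g ->
  supported_in A f -> supported_in A g.
Proof.
  intros H Hs x Hx.
  assert (L : locally x (fun y => f y = RtoC 0)).
  { assert (d0 : 0 < Rabs x - A) by lra.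
    assert (N : forall y : R, Rabs (y - x) < Rabs x - A -> f y = RtoC 0).
    { intros y Hy; apply Hs.
      assert (T := Rabs_triang y (x - y)); replace (y + (x - y)) with x in T by ring.
      rewrite Rabs_minus_sym in Hy; lra. }
    exists (mkposreal _ d0); exact N. }
  destruct (H x) as [H1 H2]; apply C_ext.
  - rewrite <- (is_derive_unique _ _ _ H1).
    rewrite (Derive_ext_loc _ (fun _ => 0) x); [apply Derive_const|].
    revert L; apply filter_imp; intros y ->; reflexivity.
  - rewrite <- (is_derive_unique _ _ _ H2).
    rewrite (Derive_ext_loc _ (fun _ => 0) x); [apply Derive_const|].
    revert L; apply filter_imp; intros y ->; reflexivity.
Qed.

Lemma test_function_Csmooth (f : R -> C) (A : R) :
  (forall n, Csmooth n f) -> supported_in A f -> test_function f.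
Proof.
  intros H Hs; split; [|now exists A]; intros n x; now apply Csmooth_ex_Cderive_n.
Qed.

Lemma test_cder (phi : R -> C) (n : nat) : test_function phi ->
  cder (Cderive_n phi n) (Cderive_n phi (S n)).
Proof. intros [H _]; now apply cder_Cderive_n. Qed.

Lemma test_ccont (phi : R -> C) (n : nat) : test_function phi -> ccont (Cderive_n phi n).
Proof. intros H; exact (ccont_cder _ _ (test_cder phi n H)). Qed.

Lemma test_supported (phi : R -> C) (A : R) (n : nat) : test_function phi ->
  supported_in A phi -> supported_in A (Cderive_n phi n).
Proof.
  intros Ht Hs; induction n as [|n IH]; [now rewrite Cderive_n_0|].
  exact (supported_in_cder A _ _ (test_cder phi n Ht) IH).
Qed.

Lemma test_deriv (phi : R -> C) (n : nat) : test_function phi ->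
  test_function (Cderive_n phi n).
Proof.
  intros Ht; destruct (proj2 Ht) as [A HA].
  apply test_function_Csmooth with A; [|now apply test_supported].
  intros m; generalize n; induction m as [|m IH]; [easy|]; intros k.
  exists (Cderive_n phi (S k)); split; [now apply test_cder | apply IH].
Qed.

Lemma Cderive_n_add (phi : R -> C) (m n : nat) : test_function phi ->
  Cderive_n (Cderive_n phi m) n = Cderive_n phi (m + n).
Proof.
  intros Ht; revert m; induction n as [|n IH]; intros m.
  - now rewrite Cderive_n_0, Nat.add_0_r.
  - rewrite (Cderive_n_S _ _ n (test_cder phi m Ht)), IH; f_equal; lia.
Qed.

Lemma Cderive_n_plus (n : nat) (f g : R -> C) : Csmooth n f -> Csmooth n g ->
  Cderive_n (fun x => f x + g x)%C n = (fun x => Cderive_n f n x + Cderive_n g n x)%C.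
Proof.
  revert f g; induction n as [|n IH]; intros f g.
  - now rewrite !Cderive_n_0.
  - intros [f' [Hf Sf]] [g' [Hg Sg]].
    rewrite (Cderive_n_S _ _ n Hf), (Cderive_n_S _ _ n Hg).
    rewrite (Cderive_n_S _ _ n (cder_plus _ _ _ _ Hf Hg)); now apply IH.
Qed.

Lemma Cderive_n_scal (n : nat) (z : C) (f : R -> C) : Csmooth n f ->
  Cderive_n (fun x => z * f x)%C n = (fun x => z * Cderive_n f n x)%C.
Proof.
  revert f; induction n as [|n IH]; intros f.
  - now rewrite !Cderive_n_0.
  - intros [f' [Hf Sf]].
    rewrite (Cderive_n_S _ _ n Hf), (Cderive_n_S _ _ n (cder_scal z _ _ Hf)).
    now apply IH.
Qed.

Lemma Cderive_n_shift (n : nat) (b : R) (f : R -> C) : Csmooth n f ->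
  Cderive_n (fun x => f (x + b)) n = (fun x => Cderive_n f n (x + b)).
Proof.
  revert f; induction n as [|n IH]; intros f.
  - now rewrite !Cderive_n_0.
  - intros [f' [Hf Sf]].
    rewrite (Cderive_n_S _ _ n Hf), (Cderive_n_S _ _ n (cder_shift b _ _ Hf)).
    now apply IH.
Qed.

Lemma test_plus (phi psi : R -> C) : test_function phi -> test_function psi ->
  test_function (fun x => phi x + psi x)%C.
Proof.
  intros [H1 [A HA]] [H2 [B HB]]; apply test_function_Csmooth with (Rmax A B).
  - intros n; apply Csmooth_plus; now apply Csmooth_all.
  - intros x Hx; rewrite HA, HB; [ring| |].
    + eapply Rle_lt_trans; [apply Rmax_r | exact Hx].
    + eapply Rle_lt_trans; [apply Rmax_l | exact Hx].
Qed.

Lemma test_scal (z : C) (phi : R -> C) : test_function phi ->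
  test_function (fun x => z * phi x)%C.
Proof.
  intros [H1 [A HA]]; apply test_function_Csmooth with A.
  - intros n; apply Csmooth_mult; [apply Csmooth_const | now apply Csmooth_all].
  - intros x Hx; rewrite HA by assumption; ring.
Qed.

Lemma test_radius (phi : R -> C) : test_function phi ->
  exists A, 0 <= A /\ supported_in A phi.
Proof.
  intros [_ [A HA]]; exists (Rmax A 0); split; [apply Rmax_r|].
  exact (supported_in_le A _ _ (Rmax_l _ _) HA).
Qed.

Lemma distr_of_fun_cint (f phi : R -> C) (A : R) : 0 <= A -> ccont f -> ccont phi ->
  supported_in A phi -> distr_of_fun f phi = cint (fun x => f x * phi x)%C (- A) A.
Proof.
  intros A0 Hf Hphi Hs; apply integral_cint; [assumption|now apply ccont_mult|].
  intros x Hx; rewrite Hs by assumption; ring.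
Qed.

Lemma distr_of_fun_deriv (f f' phi : R -> C) : cder f f' -> ccont f' ->
  test_function phi ->
  distr_of_fun f' phi = (- distr_of_fun f (Cderive_n phi 1))%C.
Proof.
  intros Hf Hf' Ht; destruct (test_radius phi Ht) as [A [A0 HA]].
  (* [supported_in A] says nothing at [Rabs x = A]; the larger radius makes the boundary terms of
     the integration by parts vanish. *)
  assert (HB : supported_in (A + 1) phi) by (apply (supported_in_le A); lra || assumption).
  assert (Cphi := test_ccont phi 0 Ht); rewrite Cderive_n_0 in Cphi.
  assert (D := test_cder phi 0 Ht); rewrite Cderive_n_0 in D.
  assert (C1 := test_ccont phi 1 Ht).
  rewrite (distr_of_fun_cint f' phi (A + 1)) by (assumption || lra).
  rewrite (distr_of_fun_cint f (Cderive_n phi 1) (A + 1));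
    try assumption; [| lra | exact (ccont_cder _ _ Hf) | now apply test_supported].
  rewrite (cint_parts f f' phi (Cderive_n phi 1)); try assumption.
  - ring.
  - apply HA; rewrite Rabs_left; lra.
  - apply HA; rewrite Rabs_right; lra.
Qed.

(** [F] is an arbitrary chain of successive derivatives, so that one statement serves both the
    iterates [Cderive_n f] and trigonometric sums, whose derivatives are again trigonometric sums
    with explicit coefficients. *)
Lemma distr_of_fun_deriv_n (F : nat -> R -> C) (n : nat) (phi : R -> C) :
  (forall i, (i < n)%nat -> cder (F i) (F (S i))) -> ccont (F n) -> test_function phi ->
  distr_of_fun (F n) phi = (RtoC ((-1) ^ n) * distr_of_fun (F 0%nat) (Cderive_n phi n))%C.
Proof.
  revert F phi; induction n as [|n IH]; intros F phi HF Hc Ht.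
  - rewrite Cderive_n_0; simpl; ring.
  - rewrite (distr_of_fun_deriv (F n)); try assumption; [|apply HF; lia].
    rewrite IH; [| | |now apply test_deriv].
    + rewrite Cderive_n_add by assumption; simpl.
      rewrite RtoC_mult; replace (RtoC (-1)) with (- RtoC 1)%C
        by (apply C_ext; simpl; ring); ring.
    + intros i Hi; apply HF; lia.
    + apply (ccont_cder _ (F (S n))), HF; lia.
Qed.

(** * A smooth partition of unity *)

(** A single term of the exponential series is at most [exp t]. With [t = 1/h] this gives the
    flatness of [exp (-1/h)] at the origin. *)
Lemma pow_exp_le (m : nat) (t : R) : 0 <= t -> t ^ m * exp (- t) <= INR (fact m).
Proof.
  intros t0; assert (F := INR_fact_lt_0 m).
  assert (T : t ^ m / INR (fact m) <= exp t).
  { eapply Rle_trans; [|exact (exp_ge_taylor t m t0)].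
    destruct m as [|m]; [apply Rle_refl|]; rewrite tech5.
    assert (P : 0 <= sum_f_R0 (fun k => t ^ k / INR (fact k)) m).
    { apply cond_pos_sum; intros k; apply Rmult_le_pos; [now apply pow_le|].
      apply Rlt_le, Rinv_0_lt_compat, INR_fact_lt_0. }
    lra. }
  rewrite exp_Ropp; assert (E := exp_pos t).
  apply (Rmult_le_reg_r (exp t)); [assumption|].
  replace (t ^ m * / exp t * exp t) with (INR (fact m) * (t ^ m / INR (fact m)))
    by (field; split; lra).
  apply Rmult_le_compat_l; lra.
Qed.

(** The factors [x ^ (-k)] are included because the derivative of each member of the family is a
    combination of other members; smoothness of all orders is then one induction. *)
Definition flat (k : nat) (x : R) : R :=
  if Rlt_dec 0 x then (/ x) ^ k * exp (- / x) else 0.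

Lemma flat_derive (k : nat) (x : R) :
  is_derive (flat k) x (- INR k * flat (S k) x + flat (S (S k)) x).
Proof.
  destruct (Rtotal_order x 0) as [Hx|[->|Hx]].
  - apply (is_derive_ext_loc (fun _ => 0)).
    + assert (d : 0 < - x) by lra; exists (mkposreal _ d); intros y Hy.
      change (Rabs (y - x) < - x) in Hy; apply Rabs_lt_between in Hy.
      unfold flat; destruct (Rlt_dec 0 y); [lra|easy].
    + unfold flat; destruct (Rlt_dec 0 x); [lra|].
      replace (- INR k * 0 + 0) with 0 by ring.
      apply (is_derive_const (V := R_NormedModule)).
  - unfold flat at 2 3; destruct (Rlt_dec 0 0); [lra|].
    replace (- INR k * 0 + 0) with 0 by ring.
    apply is_derive_Reals; intros eps Heps.
    (* A quadratic bound forces the difference quotient at [0] to vanish in the limit; the two spare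
       powers come from [pow_exp_le] with exponent [k + 2] at [1/h]. *)
    assert (Q : forall h, Rabs (flat k h) <= INR (fact (k + 2)) * h ^ 2).
    { intros h; unfold flat; destruct (Rlt_dec 0 h) as [h0|h0].
      - assert (i0 : 0 < / h) by now apply Rinv_0_lt_compat.
        rewrite Rabs_right.
        2: { apply Rle_ge, Rmult_le_pos; [apply pow_le; lra | apply Rlt_le, exp_pos]. }
        assert (P := pow_exp_le (k + 2) (/ h) (Rlt_le _ _ i0)); rewrite pow_add in P.
        replace ((/ h) ^ k * exp (- / h)) with
          ((/ h) ^ k * (/ h) ^ 2 * exp (- / h) * h ^ 2) by (simpl; field; lra).
        apply Rmult_le_compat_r; [apply pow2_ge_0 | exact P].
      - rewrite Rabs_R0; apply Rmult_le_pos; [apply pos_INR | apply pow2_ge_0]. }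
    set (M := INR (fact (k + 2))) in *.
    assert (M0 : 0 < M) by apply INR_fact_lt_0.
    assert (d0 : 0 < eps / M) by now apply Rdiv_lt_0_compat.
    exists (mkposreal _ d0); intros h h0 Hh; simpl in Hh.
    rewrite Rplus_0_l; unfold flat at 2; destruct (Rlt_dec 0 0); [lra|].
    rewrite !Rminus_0_r; unfold Rdiv; rewrite Rabs_mult, Rabs_inv.
    assert (a0 : 0 < Rabs h) by now apply Rabs_pos_lt.
    apply (Rmult_lt_reg_r (Rabs h)); [assumption|].
    rewrite Rmult_assoc, Rinv_l, Rmult_1_r by lra.
    eapply Rle_lt_trans; [apply Q|].
    rewrite <- (Rabs_right (h ^ 2)) by apply Rle_ge, pow2_ge_0.
    simpl; rewrite Rmult_1_r, Rabs_mult, <- Rmult_assoc.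
    apply Rmult_lt_compat_r; [assumption|].
    apply (Rmult_lt_reg_r (/ M)); [now apply Rinv_0_lt_compat|].
    replace (M * Rabs h * / M) with (Rabs h) by (field; lra); exact Hh.
  - apply (is_derive_ext_loc (fun y => (/ y) ^ k * exp (- / y))).
    + exists (mkposreal _ Hx); intros y Hy.
      change (Rabs (y - x) < x) in Hy; apply Rabs_lt_between in Hy.
      unfold flat; destruct (Rlt_dec 0 y); [easy|lra].
    + unfold flat; destruct (Rlt_dec 0 x); [|lra].
      auto_derive; [repeat split; lra|].
      destruct k as [|k]; simpl pred; [simpl; field; lra|].
      rewrite <- !tech_pow_Rmult; field; lra.
Qed.

Lemma Csmooth_flat (n k : nat) : Csmooth n (fun x => RtoC (flat k x)).
Proof.
  revert k; induction n as [|n IH]; [easy|]; intros k.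
  exists (fun x => RtoC (- INR k) * RtoC (flat (S k) x) + RtoC (flat (S (S k)) x))%C.
  split.
  - intros x; split; simpl.
    + eapply is_derive_eq; [apply flat_derive|]; ring.
    + eapply is_derive_eq; [apply (is_derive_const (V := R_NormedModule))|].
      unfold zero; simpl; ring.
  - apply Csmooth_plus; [apply Csmooth_mult; [apply Csmooth_const|]|]; apply IH.
Qed.

(** The radius [1/10] is chosen so that [window] is supported in radius [1/2 + 1/10 = 3/5], safely
    below the distance [1] to the next zero of [e u - 1]. *)
Definition bump (x : R) : R := flat 0 (x + 1/10) * flat 0 (1/10 - x).

Lemma bump_nonneg (x : R) : 0 <= bump x.
Proof.
  assert (P : forall y, 0 <= flat 0 y).
  { intros y; unfold flat; destruct (Rlt_dec 0 y); [|lra].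
    rewrite Rmult_1_l; apply Rlt_le, exp_pos. }
  now apply Rmult_le_pos.
Qed.

Lemma bump_pos (x : R) : - (1/10) < x < 1/10 -> 0 < bump x.
Proof.
  intros Hx; assert (P : forall y, 0 < y -> 0 < flat 0 y).
  { intros y Hy; unfold flat; destruct (Rlt_dec 0 y); [|lra].
    rewrite Rmult_1_l; apply exp_pos. }
  apply Rmult_lt_0_compat; apply P; lra.
Qed.

Lemma bump_outside (x : R) : 1/10 <= Rabs x -> bump x = 0.
Proof.
  intros Hx; unfold bump, flat.
  destruct (Rlt_dec 0 (x + 1/10)), (Rlt_dec 0 (1/10 - x)); try ring.
  exfalso; revert Hx; apply Rlt_not_le, Rabs_def1; lra.
Qed.

Lemma Csmooth_bump (n : nat) : Csmooth n (fun x => RtoC (bump x)).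
Proof.
  replace (fun x => RtoC (bump x)) with
    (fun x => RtoC (flat 0 (1 * x + 1/10)) * RtoC (flat 0 (-1 * x + 1/10)))%C.
  - apply Csmooth_mult; [apply (Csmooth_comp_affine 1 (1/10) n (fun x => RtoC (flat 0 x)))
                   |apply (Csmooth_comp_affine (-1) (1/10) n (fun x => RtoC (flat 0 x)))];
      apply Csmooth_flat.
  - apply functional_extensionality; intros x; unfold bump; rewrite RtoC_mult.
    f_equal; f_equal; f_equal; ring.
Qed.

Lemma ccont_Csmooth (f : R -> C) : (forall n, Csmooth n f) -> ccont f.
Proof. intros H; destruct (H 1%nat) as [g [Hg _]]; exact (ccont_cder _ _ Hg). Qed.

Lemma neq_0_of_Re (z : C) : Re z <> 0 -> z <> RtoC 0.
Proof. intros H E; apply H; now rewrite E. Qed.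

Definition bump_mass : C := cint (fun x => RtoC (bump x)) (-1) 1.

Lemma bump_mass_neq_0 : bump_mass <> RtoC 0.
Proof.
  assert (Hc := ccont_Csmooth _ Csmooth_bump).
  apply neq_0_of_Re; apply Rgt_not_eq; simpl.
  assert (EX : forall u v, ex_RInt bump u v)
    by (intros u v; apply (ccont_ex_RInt _ u v Hc)).
  assert (A := RInt_Chasles (V := R_CompleteNormedModule) bump (-1) (-(1/20)) 1
                 (EX _ _) (EX _ _)).
  assert (B := RInt_Chasles (V := R_CompleteNormedModule) bump (-(1/20)) (1/20) 1
                 (EX _ _) (EX _ _)).
  unfold plus in A, B; simpl in A, B.
  assert (P1 : 0 <= RInt bump (-1) (-(1/20)))
    by (apply RInt_ge_0; [lra|apply EX|intros; apply bump_nonneg]).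
  assert (P2 : 0 <= RInt bump (1/20) 1)
    by (apply RInt_ge_0; [lra|apply EX|intros; apply bump_nonneg]).
  assert (P3 : 0 < RInt bump (-(1/20)) (1/20)).
  { apply RInt_gt_0; [lra|intros x Hx; apply bump_pos; lra|].
    intros x _; apply (Hc x). }
  change (0 < RInt bump (-1) 1); lra.
Qed.

(** A smooth Heaviside function: it rises from [0] to [1] across the support of [bump]. *)
Definition step (x : R) : C := (cint (fun y => RtoC (bump y)) (-1) x / bump_mass)%C.

Lemma cder_step : cder step (fun x => / bump_mass * RtoC (bump x))%C.
Proof.
  replace step with (fun x => / bump_mass * cint (fun y => RtoC (bump y)) (-1) x)%C
    by (apply functional_extensionality; intros x; apply Cmult_comm).
  apply cder_scal, cder_cint, ccont_Csmooth, Csmooth_bump.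
Qed.

Lemma Csmooth_step (n : nat) : Csmooth n step.
Proof.
  apply Csmooth_pred; exists (fun x => / bump_mass * RtoC (bump x))%C; split;
    [exact cder_step|].
  apply Csmooth_mult; [apply Csmooth_const | apply Csmooth_bump].
Qed.

Lemma step_left (x : R) : x <= - (1/10) -> step x = RtoC 0.
Proof.
  intros Hx; unfold step.
  assert (Hc := ccont_Csmooth _ Csmooth_bump).
  assert (Z : forall u v, u <= v -> v <= - (1/10) ->
    cint (fun y => RtoC (bump y)) u v = RtoC 0).
  { intros u v uv Hv; apply cint_zero; [assumption|]; intros y Hy.
    rewrite bump_outside; [easy|]; rewrite Rabs_left; lra. }
  (* [x] may lie to the left of the base point [-1], so the integral is routed through the smaller
     of the two. *)
  rewrite <- (cint_Chasles _ (-1) (Rmin (-1) x) x Hc).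
  rewrite (Z (Rmin (-1) x) x); [|apply Rmin_r|assumption].
  assert (E := cint_Chasles _ (Rmin (-1) x) (-1) (Rmin (-1) x) Hc).
  rewrite (Z (Rmin (-1) x) (-1)), (Z (Rmin (-1) x) (Rmin (-1) x)) in E;
    try lra; try apply Rmin_l.
  2: { generalize (Rmin_l (-1) x); lra. }
  rewrite Cplus_0_l in E; rewrite E; unfold Cdiv; ring.
Qed.

Lemma step_right (x : R) : 1/10 <= x -> step x = RtoC 1.
Proof.
  intros Hx; unfold step.
  assert (Hc := ccont_Csmooth _ Csmooth_bump).
  assert (Z : forall u v, u <= v -> 1/10 <= u ->
    cint (fun y => RtoC (bump y)) u v = RtoC 0).
  { intros u v uv Hv; apply cint_zero; [assumption|]; intros y Hy.
    rewrite bump_outside; [easy|]; rewrite Rabs_right; lra. }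
  rewrite <- (cint_Chasles _ (-1) (1/10) x Hc), (Z (1/10) x) by lra.
  assert (E := cint_Chasles _ (-1) (1/10) 1 Hc); rewrite (Z (1/10) 1) in E by lra.
  rewrite E; apply Cinv_r, bump_mass_neq_0.
Qed.

(** The integer translates of [window] sum to [1], because it is a difference of two
    translates of [step]. *)
Definition window (x : R) : C := (step (x + 1/2)%R - step (x + - (1/2))%R)%C.

Lemma Csmooth_window (n : nat) : Csmooth n window.
Proof.
  replace window with
    (fun x => step (x + 1/2)%R + RtoC (-1) * step (x + - (1/2))%R)%C.
  - apply Csmooth_plus; [apply Csmooth_shift, Csmooth_step|].
    apply Csmooth_mult; [apply Csmooth_const|apply Csmooth_shift, Csmooth_step].
  - apply functional_extensionality; intros x; unfold window.
    apply C_ext; simpl; ring.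
Qed.

Lemma supported_window : supported_in (3/5) window.
Proof.
  intros x Hx; unfold window; destruct (Rle_dec 0 x).
  - rewrite Rabs_right in Hx by lra; rewrite !step_right by lra; ring.
  - rewrite Rabs_left in Hx by lra; rewrite !step_left by lra; ring.
Qed.

(** * Characters of the circle and their orthogonality *)

Lemma e_plus (x y : R) : e (x + y) = (e x * e y)%C.
Proof.
  unfold e, Cexp; simpl; rewrite exp_0.
  replace (2 * PI * (x + y)) with (2 * PI * x + 2 * PI * y) by ring.
  rewrite cos_plus, sin_plus; apply C_ext; simpl; ring.
Qed.

Lemma e_0 : e 0 = RtoC 1.
Proof.
  unfold e, Cexp; simpl; rewrite Rmult_0_r, exp_0, cos_0, sin_0.
  apply C_ext; simpl; ring.
Qed.

Lemma e_INR (n : nat) : e (INR n) = RtoC 1.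
Proof.
  unfold e, Cexp; simpl; rewrite exp_0.
  replace (2 * PI * INR n) with (0 + 2 * INR n * PI) by ring.
  rewrite cos_period, sin_period, cos_0, sin_0; apply C_ext; simpl; ring.
Qed.

Lemma Cmod_e (x : R) : Cmod (e x) = 1.
Proof.
  unfold e, Cexp, Cmod; simpl; rewrite exp_0; transitivity (sqrt 1); [f_equal | exact sqrt_1].
  transitivity (Rsqr (sin (2 * PI * x)) + Rsqr (cos (2 * PI * x)));
    [unfold Rsqr; ring | apply sin2_cos2].
Qed.

Lemma e_IZR (n : Z) : e (IZR n) = RtoC 1.
Proof.
  destruct (Z.abs_or_opp_abs n) as [H|H].
  - rewrite H, <- (Z2Nat.id (Z.abs n)) by apply Z.abs_nonneg.
    rewrite <- INR_IZR_INZ; apply e_INR.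
  - assert (E : (e (IZR n) * e (IZR (Z.abs n)))%C = RtoC 1).
    { rewrite <- e_plus, <- plus_IZR; replace (n + Z.abs n)%Z with 0%Z by lia.
      apply e_0. }
    rewrite <- E, <- (Z2Nat.id (Z.abs n)) by apply Z.abs_nonneg.
    rewrite <- INR_IZR_INZ, e_INR; ring.
Qed.

Lemma ccont_e (a : R) : ccont (fun x => e (a * x)).
Proof. exact (ccont_cder _ _ (cder_e a)). Qed.

Lemma cint_e (n : Z) : cint (fun x => e (IZR n * x)) 0 1 = if Z.eqb n 0 then RtoC 1 else RtoC 0.
Proof.
  destruct (Z.eqb_spec n 0) as [->|Hn].
  - rewrite (cint_ext _ (fun _ => RtoC 1) 0 1) by
      (try lra; intros x _; rewrite Rmult_0_l; apply e_0).
    rewrite cint_const; apply C_ext; simpl; ring.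
  - set (w := (0, 2 * PI * IZR n) : C).
    assert (w0 : w <> RtoC 0).
    { intros E; apply (f_equal snd) in E; simpl in E.
      apply Rmult_integral in E; destruct E as [E|E]; [generalize PI_RGT_0; lra|].
      now apply eq_IZR in E. }
    (* After multiplication by [w] the integrand is the derivative of [e (n x)], which takes the
       same value at [0] and [1]. *)
    assert (E : (w * cint (fun x => e (IZR n * x)) 0 1)%C = RtoC 0).
    { rewrite <- cint_scal by apply ccont_e.
      transitivity (e (IZR n * 1) - e (IZR n * 0))%C.
      - exact (cint_cder _ _ 0 1 (cder_e (IZR n))
                 (ccont_mult _ _ (ccont_const w) (ccont_e (IZR n)))).
      - rewrite Rmult_1_r, Rmult_0_r, e_IZR, e_0; ring. }
    rewrite <- (Cmult_1_l (cint _ _ _)), <- (Cinv_l w w0), <- Cmult_assoc, E; ring.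
Qed.

(** With [P] a primitive of [step (x + 1/2) e(n x)], periodicity of [e(n x)] makes
    [P x - P (x - 1)] a primitive of the integrand. *)
Lemma cint_window_e (n : Z) :
  cint (fun x => window x * e (IZR n * x))%C (-1) 1 = if Z.eqb n 0 then RtoC 1 else RtoC 0.
Proof.
  set (p := fun x => (step (x + 1/2)%R * e (IZR n * x)%R)%C).
  assert (Hp : ccont p)
    by (apply ccont_mult; [apply ccont_shift, ccont_Csmooth, Csmooth_step | apply ccont_e]).
  assert (E : (fun x => window x * e (IZR n * x))%C = (fun x => p x - p (x + -1)%R)%C).
  { apply functional_extensionality; intros x; unfold p, window.
    replace (x + -1 + 1/2) with (x + - (1/2)) by lra.
    replace (IZR n * (x + -1)) with (IZR n * x + IZR (- n)) by (rewrite opp_IZR; ring).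
    rewrite e_plus, e_IZR; ring. }
  rewrite E, cint_minus, cint_shift; try assumption; [|now apply ccont_shift].
  replace (-1 + -1) with (-2) by lra; replace (1 + -1) with 0 by lra.
  assert (C1 := cint_Chasles p (-2) (-1) 0 Hp).
  assert (C2 := cint_Chasles p (-1) 0 1 Hp).
  rewrite <- C1, <- C2, (cint_zero p (-2) (-1)); [|lra|].
  2: { intros x Hx; unfold p; rewrite step_left by lra; ring. }
  rewrite <- cint_e, <- (cint_ext p (fun x => e (IZR n * x)) 0 1); [ring|lra|].
  intros x Hx; unfold p; rewrite step_right by lra; ring.
Qed.

(** * Abel summation against complex powers *)

Fixpoint csum (f : nat -> C) (N : nat) : C :=
  match N with
  | O => RtoC 0
  | S N => (csum f N + f (S N))%C
  end.

Lemma sum_n_m_csum (f : nat -> C) (N : nat) : sum_n_m f 1 N = csum f N.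
Proof.
  induction N as [|N IH].
  - exact (sum_n_m_zero (G := C_AbelianMonoid) f 1 0 (le_n 1)).
  - rewrite sum_n_Sm by lia; now rewrite IH.
Qed.

Lemma csum_ext (f g : nat -> C) (N : nat) :
  (forall n, (1 <= n <= N)%nat -> f n = g n) -> csum f N = csum g N.
Proof.
  induction N as [|N IH]; intros H; [easy|]; simpl.
  rewrite IH by (intros; apply H; lia); rewrite H by lia; easy.
Qed.

Lemma csum_scal (z : C) (f : nat -> C) (N : nat) :
  csum (fun n => z * f n)%C N = (z * csum f N)%C.
Proof. induction N as [|N IH]; simpl; [|rewrite IH]; ring. Qed.

Lemma csum_zero (f : nat -> C) (N : nat) :
  (forall n, (1 <= n <= N)%nat -> f n = RtoC 0) -> csum f N = RtoC 0.
Proof.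
  intros H; rewrite (csum_ext f (fun _ => RtoC 0 * RtoC 0)%C N).
  - rewrite csum_scal; ring.
  - intros n Hn; rewrite H by assumption; ring.
Qed.

Lemma Cmod_csum_le (f : nat -> C) (B : R) (N : nat) :
  (forall n, (1 <= n <= N)%nat -> Cmod (f n) <= B) -> Cmod (csum f N) <= INR N * B.
Proof.
  induction N as [|N IH]; intros H; simpl csum.
  - rewrite Cmod_0; simpl; lra.
  - rewrite S_INR; eapply Rle_trans; [apply Cmod_triangle|].
    assert (A := H (S N) ltac:(lia)).
    assert (B1 := IH (fun n Hn => H n ltac:(lia))); lra.
Qed.

Lemma Cmod_minus_le (z w : C) : Cmod (z - w)%C <= Cmod z + Cmod w.
Proof. unfold Cminus; eapply Rle_trans; [apply Cmod_triangle|]; rewrite Cmod_opp; lra. Qed.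

(** With [A_n] for the partial sums of [a], the quantity [sum a w - A_N w_N] changes by exactly
    [A_N (w_N - w_(N+1))] from [N] to [N + 1]. The function [Phi] is a discrete primitive of a
    majorant of these increments, so the estimate telescopes and no further sum has to be
    evaluated. *)
Lemma abel_summation (a w : nat -> C) (Phi : nat -> R) (M N : nat) :
  (forall n, (M <= n < N)%nat ->
     Cmod (csum a n) * Cmod (w n - w (S n))%C <= Phi (S n) - Phi n) ->
  (M <= N)%nat ->
  Cmod ((csum (fun n => a n * w n)%C N - csum a N * w N)
        - (csum (fun n => a n * w n)%C M - csum a M * w M))%C <= Phi N - Phi M.
Proof.
  intros H MN; induction N as [|N IH].
  - replace M with 0%nat by lia; unfold Cminus; rewrite Cplus_opp_r, Cmod_0; lra.
  - destruct (Nat.eq_dec M (S N)) as [->|NE].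
    { unfold Cminus; rewrite Cplus_opp_r, Cmod_0; lra. }
    assert (A := IH (fun n Hn => H n ltac:(lia)) ltac:(lia)).
    assert (B := H N ltac:(lia)); rewrite <- Cmod_mult in B.
    replace (Phi (S N) - Phi M) with ((Phi N - Phi M) + (Phi (S N) - Phi N)) by ring.
    eapply Rle_trans; [|apply Rplus_le_compat; [exact A | exact B]].
    eapply Rle_trans; [|apply Cmod_triangle]; apply Req_le; f_equal; simpl; ring.
Qed.

(** * Complex powers and their increments *)

Lemma Rcpower_eq (x : R) (s : C) : Rcpower x s =
  (exp (Re s * ln x) * cos (Im s * ln x), exp (Re s * ln x) * sin (Im s * ln x)).
Proof.
  unfold Rcpower, Cexp, RtoC, Cmult; simpl; unfold Re, Im.
  replace (ln x * fst s - 0 * snd s) with (fst s * ln x) by ring.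
  now replace (ln x * snd s + 0 * fst s) with (snd s * ln x) by ring.
Qed.

Lemma Cmod_Rcpower (x : R) (s : C) : Cmod (Rcpower x s) = Rpower x (Re s).
Proof.
  rewrite Rcpower_eq; unfold Cmod, Rpower; simpl.
  set (E := exp (Re s * ln x)); set (t := Im s * ln x).
  transitivity (sqrt (Rsqr E)); [f_equal | apply sqrt_Rsqr, Rlt_le, exp_pos].
  transitivity (Rsqr E * (Rsqr (sin t) + Rsqr (cos t))); [unfold Rsqr; ring|].
  rewrite sin2_cos2; ring.
Qed.

Lemma Rcpower_plus (x : R) (s t : C) : Rcpower x (s + t) = (Rcpower x s * Rcpower x t)%C.
Proof.
  rewrite !Rcpower_eq; simpl; unfold Re, Im.
  replace ((fst s + fst t) * ln x) with (fst s * ln x + fst t * ln x) by ring.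
  replace ((snd s + snd t) * ln x) with (snd s * ln x + snd t * ln x) by ring.
  rewrite exp_plus, cos_plus, sin_plus; apply C_ext; simpl; ring.
Qed.

Lemma Rcpower_real (x r : R) : Rcpower x (RtoC r) = RtoC (Rpower x r).
Proof.
  rewrite Rcpower_eq; unfold Rpower; simpl.
  rewrite Rmult_0_l, cos_0, sin_0; apply C_ext; simpl; ring.
Qed.

Lemma Rcpower_INR (x : R) (k : nat) : 0 < x -> Rcpower x (RtoC (INR k)) = RtoC (x ^ k).
Proof. intros Hx; now rewrite Rcpower_real, Rpower_pow. Qed.

Definition npow (g : R) (n : nat) : R := Rpower (INR n) g.

Lemma exp_mono (x y : R) : x <= y -> exp x <= exp y.
Proof. intros [H| ->]; [now apply Rlt_le, exp_increasing | apply Rle_refl]. Qed.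

Lemma npow_pos (g : R) (n : nat) : 0 < npow g n.
Proof. apply exp_pos. Qed.

Lemma npow_plus (g h : R) (n : nat) : npow (g + h) n = npow g n * npow h n.
Proof. apply Rpower_plus. Qed.

Lemma INR_ge_1 (n : nat) : (1 <= n)%nat -> 1 <= INR n.
Proof. exact (le_INR 1 n). Qed.

Lemma npow_1 (g : R) : npow g 1 = 1.
Proof. unfold npow, Rpower; simpl; now rewrite ln_1, Rmult_0_r, exp_0. Qed.

Lemma npow_le (g h : R) (n : nat) : (1 <= n)%nat -> g <= h -> npow g n <= npow h n.
Proof.
  intros Hn gh; assert (A := INR_ge_1 n Hn); unfold npow, Rpower.
  apply exp_mono, Rmult_le_compat_r; [|assumption].
  rewrite <- ln_1; apply ln_le; lra.
Qed.

Lemma npow_INR (k n : nat) : (1 <= n)%nat -> npow (INR k) n = INR n ^ k.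
Proof. intros Hn; assert (A := INR_ge_1 n Hn); apply Rpower_pow; lra. Qed.

Lemma Rpower_near (g x y : R) : 0 < x -> x <= y <= 2 * x ->
  Rpower 2 (- Rabs g) * Rpower x g <= Rpower y g <= Rpower 2 (Rabs g) * Rpower x g.
Proof.
  intros Hx Hy; unfold Rpower; rewrite <- !exp_plus.
  assert (L1 : ln x <= ln y) by (apply ln_le; lra).
  assert (L2 : ln y <= ln 2 + ln x) by (rewrite <- ln_mult by lra; apply ln_le; lra).
  assert (D : Rabs (g * (ln y - ln x)) <= Rabs g * ln 2).
  { rewrite Rabs_mult; apply Rmult_le_compat_l; [apply Rabs_pos|].
    rewrite Rabs_right; lra. }
  apply Rabs_le_between in D.
  split; apply exp_mono; lra.
Qed.

(** By the mean value theorem; [n + 1 <= 2 n] keeps the intermediate point comparable to [n].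
    Dividing by [d] makes [npow d n / d] increasing for either sign of [d], so it can serve as the
    potential in Abel summation both for growth and for decay. *)
Lemma npow_increment (d : R) : d <> 0 -> exists c, 0 < c /\
  forall n, (1 <= n)%nat -> c * npow (d - 1) n <= (npow d (S n) - npow d n) / d.
Proof.
  intros Hd; exists (Rpower 2 (- Rabs (d - 1))); split; [apply exp_pos|].
  intros n Hn; assert (A := INR_ge_1 n Hn); unfold npow; rewrite S_INR.
  destruct (MVT_cor2 (fun x => Rpower x d) (fun x => d * Rpower x (d - 1))
              (INR n) (INR n + 1)) as [y [E Hy]]; [lra| |].
  - intros y Hy; apply derivable_pt_lim_power; lra.
  - rewrite E; replace (INR n + 1 - INR n) with 1 by ring.
    replace (d * Rpower y (d - 1) * 1 / d) with (Rpower y (d - 1)) by now field.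
    apply Rpower_near; lra.
Qed.

(** The mean value theorem is applied to each component of [x ^ s]; the derivative of either one is
    [x ^ (Re s - 1)] times a trigonometric factor bounded by [L], the sum of the absolute values of
    the two parts of [s]. *)
Lemma Rcpower_increment (s : C) : exists B, 0 <= B /\
  forall n, (1 <= n)%nat ->
  Cmod (Rcpower (INR n) s - Rcpower (INR (S n)) s)%C <= B * npow (Re s - 1) n.
Proof.
  set (sg := Re s); set (ta := Im s).
  set (L := Rabs sg + Rabs ta).
  assert (L0 : 0 <= L) by (unfold L; generalize (Rabs_pos sg) (Rabs_pos ta); lra).
  exists (2 * (L * Rpower 2 (Rabs (sg - 1)))); split.
  { apply Rmult_le_pos; [lra|]; apply Rmult_le_pos; [assumption|apply Rlt_le, exp_pos]. }
  intros n Hn; assert (A := INR_ge_1 n Hn).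
  assert (M : forall f g : R -> R,
    (forall x, 0 < x -> is_derive f x (Rpower x (sg - 1) * g x)) ->
    (forall x, Rabs (g x) <= L) ->
    Rabs (f (INR n) - f (INR (S n))) <= L * Rpower 2 (Rabs (sg - 1)) * npow (sg - 1) n).
  { intros f g Hf Hg; rewrite Rabs_minus_sym, S_INR.
    destruct (MVT_cor2 f (fun x => Rpower x (sg - 1) * g x) (INR n) (INR n + 1))
      as [y [E Hy]]; [lra| |].
    - intros y Hy; apply is_derive_Reals, Hf; lra.
    - rewrite E; replace (INR n + 1 - INR n) with 1 by ring.
      rewrite Rmult_1_r, Rabs_mult, (Rabs_right (Rpower y _)) by apply Rle_ge, Rlt_le, exp_pos.
      rewrite Rmult_comm, Rmult_assoc; unfold npow.
      apply Rmult_le_compat; [apply Rabs_pos | apply Rlt_le, exp_pos | apply Hg |].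
      apply Rpower_near; lra. }
  assert (P : forall x, 0 < x -> Rpower x (sg - 1) = exp (sg * ln x) * / x).
  { intros x Hx; unfold Rminus; rewrite Rpower_plus, Rpower_Ropp, Rpower_1; easy. }
  assert (TR : forall t, Rabs (cos t) <= 1 /\ Rabs (sin t) <= 1).
  { intros t; split; apply Rabs_le; [apply COS_bound | apply SIN_bound]. }
  assert (TB : forall u v t w, Rabs u <= 1 -> Rabs v <= 1 -> Rabs t = Rabs ta ->
    w = sg * u + t * v -> Rabs w <= L).
  { intros u v t w Hu Hv Ht ->; eapply Rle_trans; [apply Rabs_triang|].
    rewrite !Rabs_mult, Ht; unfold L; apply Rplus_le_compat.
    - rewrite <- (Rmult_1_r (Rabs sg)) at 2; apply Rmult_le_compat_l; [apply Rabs_pos|easy].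
    - rewrite <- (Rmult_1_r (Rabs ta)) at 2; apply Rmult_le_compat_l; [apply Rabs_pos|easy]. }
  rewrite !Rcpower_eq; fold sg ta.
  eapply Rle_trans; [apply Cmod_le_sum|]; simpl.
  assert (R1 := M (fun x => exp (sg * ln x) * cos (ta * ln x))
                  (fun x => sg * cos (ta * ln x) + - ta * sin (ta * ln x))).
  assert (R2 := M (fun x => exp (sg * ln x) * sin (ta * ln x))
                  (fun x => sg * sin (ta * ln x) + ta * cos (ta * ln x))).
  cbv beta in R1, R2; unfold Rminus in R1, R2.
  replace (2 * (L * Rpower 2 (Rabs (sg - 1))) * npow (sg - 1) n) with
    (L * Rpower 2 (Rabs (sg - 1)) * npow (sg - 1) n
     + L * Rpower 2 (Rabs (sg - 1)) * npow (sg - 1) n) by ring.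
  apply Rplus_le_compat; [apply R1|apply R2].
  - intros x Hx; fold (sg - 1); rewrite P by assumption; auto_derive; [easy|]; field; lra.
  - intros x; apply (TB (cos (ta * ln x)) (sin (ta * ln x)) (- ta));
      [apply TR | apply TR | apply Rabs_Ropp | easy].
  - intros x Hx; fold (sg - 1); rewrite P by assumption; auto_derive; [easy|]; field; lra.
  - intros x; apply (TB (sin (ta * ln x)) (cos (ta * ln x)) ta);
      [apply TR | apply TR | easy | easy].
Qed.

(** The sign [s] selects the positive or the negative frequencies. *)
Definition osum (s : Z) (a : nat -> C) (N : nat) (x : R) : C :=
  csum (fun n => a n * e (IZR s * INR n * x))%C N.

Definition weighted (a : nat -> C) (r : C) (n : nat) : C := (a n * Rcpower (INR n) r)%C.

(** The increments in Abel summation are of size [n ^ (d - 1)] with [d = g + Re r], and [n ^ d / d]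
    is a discrete primitive up to a constant. For [d = 0] that primitive would be a logarithm. *)
Lemma abel_power (s : Z) (a : nat -> C) (r : C) (K g : R) : g + Re r <> 0 ->
  (forall N x, (1 <= N)%nat -> Cmod (osum s a N x) <= K * npow g N) ->
  exists B, 0 <= B /\ forall M N x, (1 <= M <= N)%nat ->
    Cmod ((osum s (weighted a r) N x - osum s a N x * Rcpower (INR N) r)
          - (osum s (weighted a r) M x - osum s a M x * Rcpower (INR M) r))%C
    <= B * (npow (g + Re r) N / (g + Re r) - npow (g + Re r) M / (g + Re r)).
Proof.
  intros Hd HK; set (d := g + Re r) in *.
  destruct (npow_increment d Hd) as [c [c0 Hc]].
  destruct (Rcpower_increment r) as [B [B0 HB]].
  assert (K0 : 0 <= K).
  { generalize (HK 1%nat 0 (le_n _)); rewrite npow_1, Rmult_1_r.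
    generalize (Cmod_ge_0 (osum s a 1 0)); lra. }
  exists (K * B / c); split.
  { apply Rmult_le_pos; [now apply Rmult_le_pos|].
    now apply Rlt_le, Rinv_0_lt_compat. }
  intros M N x MN.
  assert (E : forall n, osum s (weighted a r) n x =
    csum (fun n => (a n * e (IZR s * INR n * x)) * Rcpower (INR n) r)%C n).
  { intros n; apply csum_ext; intros j _; unfold weighted; ring. }
  rewrite !E; unfold osum.
  replace (K * B / c * (npow d N / d - npow d M / d)) with
    (K * B / c * (npow d N / d) - K * B / c * (npow d M / d)) by ring.
  apply (abel_summation _ (fun n => Rcpower (INR n) r)
           (fun n => K * B / c * (npow d n / d))); [|lia].
  intros n Hn; assert (n1 : (1 <= n)%nat) by lia.
  eapply Rle_trans.
  { apply Rmult_le_compat; [apply Cmod_ge_0 | apply Cmod_ge_0 | apply (HK n x n1) |].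
    exact (HB n n1). }
  replace (K * npow g n * (B * npow (Re r - 1) n)) with (K * B / c * (c * npow (d - 1) n)).
  - replace (K * B / c * (npow d (S n) / d) - K * B / c * (npow d n / d)) with
      (K * B / c * ((npow d (S n) - npow d n) / d)) by (field; lra).
    apply Rmult_le_compat_l; [|now apply Hc].
    apply Rmult_le_pos; [now apply Rmult_le_pos | now apply Rlt_le, Rinv_0_lt_compat].
  - replace (d - 1) with (g + (Re r - 1)) by (unfold d; ring).
    rewrite npow_plus; field; lra.
Qed.

Lemma Cmod_weight_le (s : Z) (a : nat -> C) (r : C) (K g : R) (N : nat) (x : R) :
  Cmod (osum s a N x) <= K * npow g N ->
  Cmod (osum s a N x * Rcpower (INR N) r)%C <= K * npow (g + Re r) N.
Proof.
  intros H; rewrite Cmod_mult, Cmod_Rcpower, npow_plus, <- Rmult_assoc.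
  apply Rmult_le_compat_r; [apply Rlt_le, npow_pos | exact H].
Qed.

Lemma abel_growth (s : Z) (a : nat -> C) (r : C) (K g : R) : 0 < g + Re r ->
  (forall N x, (1 <= N)%nat -> Cmod (osum s a N x) <= K * npow g N) ->
  exists K', forall N x, (1 <= N)%nat ->
    Cmod (osum s (weighted a r) N x) <= K' * npow (g + Re r) N.
Proof.
  intros Hd HK; destruct (abel_power s a r K g) as [B [B0 HB]]; [lra|exact HK|].
  set (d := g + Re r) in *.
  exists (K + B / d); intros N x HN.
  assert (P := HB 1%nat N x ltac:(lia)).
  assert (Q := Cmod_weight_le s a r K g N x (HK N x HN)); fold d in Q.
  (* At [M = 1] both terms consist of the same single summand and cancel. *)
  replace (osum s (weighted a r) 1 x - osum s a 1 x * Rcpower (INR 1) r)%C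
    with (RtoC 0) in P by (unfold osum, weighted; simpl; ring).
  replace (osum s (weighted a r) N x) with
    ((osum s (weighted a r) N x - osum s a N x * Rcpower (INR N) r - RtoC 0)
     + osum s a N x * Rcpower (INR N) r)%C by ring.
  eapply Rle_trans; [apply Cmod_triangle|].
  assert (S0 : 0 <= B * (npow d 1 / d)).
  { apply Rmult_le_pos; [assumption|].
    apply Rlt_le, Rdiv_lt_0_compat; [apply npow_pos | assumption]. }
  replace ((K + B / d) * npow d N) with (B * (npow d N / d) + K * npow d N) by (field; lra).
  lra.
Qed.

(** For [d < 0] the potential [n ^ d / d] increases towards [0], so its variation over [[M, N]] is
    bounded by its size at [M], whatever [N] is. The two boundary terms are also largest at [M]. *)
Lemma abel_tail (s : Z) (a : nat -> C) (r : C) (K g : R) : g + Re r < 0 ->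
  (forall N x, (1 <= N)%nat -> Cmod (osum s a N x) <= K * npow g N) ->
  exists K', forall M N x, (1 <= M <= N)%nat ->
    Cmod (osum s (weighted a r) N x - osum s (weighted a r) M x)%C
      <= K' * npow (g + Re r) M.
Proof.
  intros Hd HK; destruct (abel_power s a r K g) as [B [B0 HB]]; [lra|exact HK|].
  assert (K0 : 0 <= K).
  { generalize (HK 1%nat 0 (le_n _)); rewrite npow_1, Rmult_1_r.
    generalize (Cmod_ge_0 (osum s a 1 0)); lra. }
  set (d := g + Re r) in *.
  exists (2 * K + B / - d); intros M N x MN.
  assert (P := HB M N x MN).
  assert (Q1 := Cmod_weight_le s a r K g N x (HK N x ltac:(lia))); fold d in Q1.
  assert (Q2 := Cmod_weight_le s a r K g M x (HK M x ltac:(lia))); fold d in Q2.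
  assert (D : npow d N <= npow d M).
  { unfold npow; rewrite <- (Ropp_involutive d), !(Rpower_Ropp _ (- d)).
    apply Rinv_le_contravar; [apply exp_pos|].
    assert (A := INR_ge_1 M ltac:(lia)).
    apply Rle_Rpower_l; [lra|]; split; [lra|]; apply le_INR; lia. }
  replace (osum s (weighted a r) N x - osum s (weighted a r) M x)%C with
    (((osum s (weighted a r) N x - osum s a N x * Rcpower (INR N) r)
      - (osum s (weighted a r) M x - osum s a M x * Rcpower (INR M) r))
     + (osum s a N x * Rcpower (INR N) r - osum s a M x * Rcpower (INR M) r))%C by ring.
  eapply Rle_trans; [apply Cmod_triangle|].
  assert (Q3 := Cmod_minus_le (osum s a N x * Rcpower (INR N) r)
                              (osum s a M x * Rcpower (INR M) r)).
  assert (S0 : B * (npow d N / d) <= 0).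
  { replace (B * (npow d N / d)) with (- (B * (npow d N / - d))) by (field; lra).
    apply Ropp_le_cancel; rewrite Ropp_involutive, Ropp_0.
    apply Rmult_le_pos; [assumption|].
    apply Rlt_le, Rdiv_lt_0_compat; [apply npow_pos|lra]. }
  replace ((2 * K + B / - d) * npow d M) with
    (- (B * (npow d M / d)) + (K * npow d M + K * npow d M)) by (field; lra).
  assert (K * npow d N <= K * npow d M) by now apply Rmult_le_compat_l.
  lra.
Qed.

(** * The localized Dirichlet kernel *)

Definition is_sign (s : Z) : Prop := (s = 1 \/ s = -1)%Z.

Lemma is_sign_opp (s : Z) : is_sign s -> is_sign (- s).
Proof. unfold is_sign; lia. Qed.

Lemma Rabs_sign (s : Z) (u : R) : is_sign s -> Rabs (IZR s * u) = Rabs u.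
Proof.
  intros [-> | ->]; [now rewrite Rmult_1_l|].
  replace (-1 * u) with (- u) by ring; apply Rabs_Ropp.
Qed.

Lemma cder_csum (f f' : nat -> R -> C) (N : nat) :
  (forall n, (1 <= n)%nat -> cder (f n) (f' n)) ->
  cder (fun x => csum (fun n => f n x) N) (fun x => csum (fun n => f' n x) N).
Proof.
  intros H; induction N as [|N IH]; [exact (cder_const (RtoC 0))|].
  exact (cder_plus _ _ _ _ IH (H (S N) ltac:(lia))).
Qed.

Lemma ccont_csum (f : nat -> R -> C) (N : nat) :
  (forall n, ccont (f n)) -> ccont (fun x => csum (fun n => f n x) N).
Proof.
  intros H; induction N as [|N IH]; [exact (ccont_const (RtoC 0))|].
  exact (ccont_plus _ _ IH (H (S N))).
Qed.

Lemma cint_csum (f : nat -> R -> C) (N : nat) (a b : R) : (forall n, ccont (f n)) ->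
  cint (fun x => csum (fun n => f n x) N) a b = csum (fun n => cint (f n) a b) N.
Proof.
  intros H; induction N as [|N IH]; simpl; [rewrite cint_const; ring|].
  rewrite <- IH; apply cint_plus; [now apply ccont_csum | apply H].
Qed.

Lemma cder_osum (s : Z) (a : nat -> C) (N : nat) :
  cder (osum s a N) (osum s (fun n => (0, 2 * PI * (IZR s * INR n))%R * a n)%C N).
Proof.
  assert (H := cder_csum (fun n x => a n * e (IZR s * INR n * x))%C
    (fun n x => a n * ((0, 2 * PI * (IZR s * INR n))%R * e (IZR s * INR n * x)))%C N
    (fun n _ => cder_scal (a n) _ _ (cder_e (IZR s * INR n)))).
  replace (osum s (fun n => (0, 2 * PI * (IZR s * INR n))%R * a n)%C N) with
    (fun x => csum (fun n =>
       a n * ((0, 2 * PI * (IZR s * INR n))%R * e (IZR s * INR n * x)))%C N);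
    [exact H|].
  apply functional_extensionality; intros x; apply csum_ext; intros n _; ring.
Qed.

Lemma ccont_osum (s : Z) (a : nat -> C) (N : nat) : ccont (osum s a N).
Proof. exact (ccont_cder _ _ (cder_osum s a N)). Qed.

Definition dirichlet_deriv (s : Z) (i N : nat) : R -> C :=
  osum s (fun n => (0, 2 * PI * (IZR s * INR n))%R ^ i)%C N.

Lemma cder_dirichlet_deriv (s : Z) (i N : nat) :
  cder (dirichlet_deriv s i N) (dirichlet_deriv s (S i) N).
Proof. exact (cder_osum s _ N). Qed.

Lemma Csmooth_dirichlet_deriv (s : Z) (i N n : nat) : Csmooth n (dirichlet_deriv s i N).
Proof.
  revert i; induction n as [|n IH]; [easy|]; intros i.
  exists (dirichlet_deriv s (S i) N); split; [apply cder_dirichlet_deriv | apply IH].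
Qed.

(** The left-hand modulus is twice that of [sin (PI * u)], which vanishes again at [u = 1], so a
    linear lower bound needs a range that stops short of [1]; [3/5] is the radius of [window]. *)
Lemma Cmod_e_minus_1 (u : R) : Rabs u <= 3/5 -> Rabs u <= Cmod (e u - RtoC 1)%C.
Proof.
  assert (P : forall u, 0 <= u <= 3/5 -> u <= Cmod (e u - RtoC 1)%C).
  { intros v Hv.
    assert (E : (e v - RtoC 1)%C = (e (v / 2) * (e (v / 2) - e (- (v / 2))%R))%C).
    { rewrite <- e_0, <- (Rplus_opp_r (v / 2)), e_plus.
      replace (e v) with (e (v / 2) * e (v / 2))%C; [ring|].
      rewrite <- e_plus; f_equal; lra. }
    rewrite E, Cmod_mult, Cmod_e, Rmult_1_l.
    eapply Rle_trans; [|apply im_le_Cmod].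
    unfold e, Cexp; simpl; rewrite exp_0, !Rmult_1_l.
    replace (2 * PI * - (v / 2)) with (- (2 * PI * (v / 2))) by ring.
    rewrite sin_neg.
    (* The quantity to bound is [2 sin (2 t) = 4 sin t cos t]. Since [t <= PI / 3], the cosine is at
       least [1/2] and the sine at least [t / 2], which leaves [t], and [t >= v]. *)
    set (t := PI * v / 2).
    replace (2 * PI * (v / 2)) with (2 * t) by (unfold t; field).
    rewrite sin_2a.
    assert (p := PI2_1); assert (PI0 := PI_RGT_0).
    assert (t0 : 0 <= t <= PI / 3) by (unfold t; split; nra).
    assert (c0 : forall y, 0 <= y <= PI / 3 -> 1 / 2 <= cos y).
    { intros y Hy; rewrite <- cos_PI3; apply cos_decr_1; lra. }
    assert (s0 : t / 2 <= sin t).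
    { destruct (Req_dec t 0) as [->|tn]; [rewrite sin_0; lra|].
      destruct (MVT_cor2 sin cos 0 t) as [y [Ey Hy]]; [lra| |].
      - intros y _; apply derivable_pt_lim_sin.
      - rewrite sin_0, Rminus_0_r, Rminus_0_r in Ey.
        assert (C1 := c0 y ltac:(lra)); nra. }
    assert (C1 := c0 t t0).
    eapply Rle_trans; [|apply Rle_abs].
    assert (V : v <= t) by (unfold t; nra).
    assert (Q : t / 4 <= sin t * cos t).
    { replace (t / 4) with (t / 2 * (1 / 2)) by field; apply Rmult_le_compat; lra. }
    lra. }
  intros Hu; destruct (Rle_dec 0 u) as [H|H].
  - rewrite Rabs_right in * by lra; now apply P.
  - rewrite Rabs_left in * by lra.
    replace (e u - RtoC 1)%C with (- (e u * (e (- u)%R - RtoC 1)))%C.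
    + rewrite Cmod_opp, Cmod_mult, Cmod_e, Rmult_1_l; apply P; lra.
    + assert (E : (e u * e (- u)%R)%C = RtoC 1) by (rewrite <- e_plus, Rplus_opp_r; apply e_0).
      transitivity (e u - e u * e (- u)%R)%C; [ring | now rewrite E].
Qed.

(** Summation of the geometric progression. The product form covers [u = 0] as well. *)
Lemma Dirichlet_bound (s : Z) (N : nat) (u : R) : is_sign s -> Rabs u <= 3/5 ->
  Rabs u * Cmod (csum (fun n => e (IZR s * INR n * u)) N) <= 2.
Proof.
  intros Hs Hu; set (v := IZR s * u).
  assert (Ev : Rabs v = Rabs u) by now apply Rabs_sign.
  rewrite <- Ev in Hu |- *.
  rewrite (csum_ext _ (fun n => e (INR n * v)) N)
    by (intros n _; f_equal; unfold v; ring).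
  assert (G : ((e v - RtoC 1) * csum (fun n => e (INR n * v)) N)%C
              = (e (INR (S N) * v) - e v)%C).
  { induction N as [|N IH]; cbn [csum].
    - simpl INR; rewrite Rmult_1_l; ring.
    - rewrite Cmult_plus_distr_l, IH.
      replace (INR (S (S N)) * v) with (INR (S N) * v + v) by (rewrite (S_INR (S N)); ring).
      rewrite e_plus; ring. }
  eapply Rle_trans.
  { apply Rmult_le_compat_r; [apply Cmod_ge_0 | apply (Cmod_e_minus_1 v Hu)]. }
  rewrite <- Cmod_mult, G; eapply Rle_trans; [apply Cmod_minus_le|].
  rewrite !Cmod_e; lra.
Qed.

(** A continuous substitute for [min (N, 1 / |u|)] with an explicit primitive. *)
Definition kernel_majorant (N : nat) (u : R) : R := INR N / (1 + INR N * Rabs u).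

Lemma kernel_majorant_pos (N : nat) (u : R) : 0 <= kernel_majorant N u.
Proof.
  assert (A := pos_INR N); assert (B := Rabs_pos u); unfold kernel_majorant, Rdiv.
  apply Rmult_le_pos; [assumption|]; apply Rlt_le, Rinv_0_lt_compat; nra.
Qed.

Lemma Cmod_imag (t : R) : Cmod (0, t) = Rabs t.
Proof.
  replace ((0, t) : C) with (Ci * RtoC t)%C by (apply C_ext; simpl; ring).
  rewrite Cmod_mult, Cmod_Ci, Cmod_R; ring.
Qed.

(** Two bounds are combined: the trivial one, [N] terms of size at most [P N ^ i], and one of order
    [N ^ i / |u|] from Abel summation of the geometric sums against [n ^ i], whose monotonicity
    makes its total variation telescope. *)
Lemma dirichlet_deriv_bound (s : Z) (i : nat) : is_sign s -> exists B, 0 <= B /\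
  forall N u, (1 <= N)%nat -> Rabs u <= 3/5 ->
    Cmod (dirichlet_deriv s i N u) <= B * INR N ^ i * kernel_majorant N u.
Proof.
  intros Hs; set (P := (2 * PI) ^ i).
  assert (P0 : 0 <= P) by (apply pow_le; generalize PI_RGT_0; lra).
  (* [5 = 1 + 4]: the trivial bound, plus [N] times the bound [4 * P * N ^ i] for the kernel
     multiplied by [Rabs u]. *)
  exists (5 * P); split; [lra|]; intros N u HN Hu.
  assert (N1 := INR_ge_1 N HN); assert (u0 := Rabs_pos u).
  assert (Ni : 0 <= INR N ^ i) by (apply pow_le; lra).
  set (w := fun n => ((0, 2 * PI * (IZR s * INR n))%R ^ i)%C).
  assert (Ew : forall n, w n = ((0, 2 * PI * IZR s)%R ^ i * RtoC (INR n ^ i))%C).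
  { intros n; unfold w; rewrite RtoC_pow, <- Cpow_mult_l; f_equal.
    apply C_ext; simpl; ring. }
  assert (Es : Cmod ((0, 2 * PI * IZR s)%R ^ i)%C = P).
  { rewrite Cmod_pow, Cmod_imag; unfold P; f_equal.
    rewrite Rmult_comm, Rabs_sign by assumption; apply Rabs_right.
    generalize PI_RGT_0; lra. }
  assert (Mw : forall n, Cmod (w n) = P * INR n ^ i).
  { intros n; rewrite Ew, Cmod_mult, Es, Cmod_R, Rabs_right; [easy|].
    apply Rle_ge, pow_le, pos_INR. }
  assert (B1 : Cmod (dirichlet_deriv s i N u) <= INR N * (P * INR N ^ i)).
  { apply Cmod_csum_le; intros n Hn; rewrite Cmod_mult, Cmod_e, Rmult_1_r.
    change (Cmod (w n) <= P * INR N ^ i); rewrite Mw.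
    apply Rmult_le_compat_l; [assumption|]; apply pow_incr; split; [apply pos_INR|].
    apply le_INR; lia. }
  assert (B2 : Rabs u * Cmod (dirichlet_deriv s i N u) <= 4 * P * INR N ^ i).
  { set (a := fun n => e (IZR s * INR n * u)).
    assert (D := fun n => Dirichlet_bound s n u Hs Hu); fold a in D.
    assert (Ek : dirichlet_deriv s i N u = csum (fun n => a n * w n)%C N)
      by (apply csum_ext; intros n _; apply Cmult_comm).
    destruct (Req_dec u 0) as [->|un].
    { rewrite Rabs_R0, Rmult_0_l; nra. }
    assert (up : 0 < Rabs u) by now apply Rabs_pos_lt.
    assert (D' : forall n, Cmod (csum a n) <= 2 / Rabs u).
    { intros n; apply (Rmult_le_reg_l (Rabs u)); [assumption|].
      replace (Rabs u * (2 / Rabs u)) with 2 by (field; lra); apply D. }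
    assert (A := abel_summation a w (fun n => 2 / Rabs u * (P * INR n ^ i)) 0 N).
    assert (d0 : 0 <= 2 / Rabs u) by (apply Rlt_le, Rdiv_lt_0_compat; lra).
    assert (A' : Cmod (dirichlet_deriv s i N u - csum a N * w N)%C
                 <= 2 / Rabs u * (P * INR N ^ i)).
    { rewrite Ek.
      replace (csum (fun n => a n * w n)%C N - csum a N * w N)%C with
        ((csum (fun n => a n * w n)%C N - csum a N * w N)
         - (RtoC 0 - RtoC 0 * w 0%nat))%C by ring.
      eapply Rle_trans; [apply A; [|lia]|].
      - intros n Hn.
        replace (2 / Rabs u * (P * INR (S n) ^ i) - 2 / Rabs u * (P * INR n ^ i)) with
          (2 / Rabs u * (P * (INR (S n) ^ i - INR n ^ i))) by ring.
        apply Rmult_le_compat; try apply Cmod_ge_0; [apply D'|].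
        rewrite !Ew.
        replace ((0, 2 * PI * IZR s)%R ^ i * RtoC (INR n ^ i)
                 - (0, 2 * PI * IZR s)%R ^ i * RtoC (INR (S n) ^ i))%C
          with ((0, 2 * PI * IZR s)%R ^ i * RtoC (INR n ^ i - INR (S n) ^ i)%R)%C
          by (rewrite RtoC_minus; ring).
        rewrite Cmod_mult, Es, Cmod_R, Rabs_minus_sym, Rabs_right; [lra|].
        assert (INR n ^ i <= INR (S n) ^ i); [|lra].
        apply pow_incr; split; [apply pos_INR | apply le_INR; lia].
      - assert (0 <= 2 / Rabs u * (P * INR 0 ^ i)); [|lra].
        apply Rmult_le_pos; [assumption|]; apply Rmult_le_pos; [assumption|].
        apply pow_le, pos_INR. }
    assert (A2 : Cmod (csum a N * w N)%C <= 2 / Rabs u * (P * INR N ^ i)).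
    { rewrite Cmod_mult, Mw; apply Rmult_le_compat_r; [nra | apply D']. }
    replace (dirichlet_deriv s i N u) with
      ((dirichlet_deriv s i N u - csum a N * w N) + csum a N * w N)%C by ring.
    assert (T := Cmod_triangle (dirichlet_deriv s i N u - csum a N * w N)%C (csum a N * w N)%C).
    eapply Rle_trans; [apply Rmult_le_compat_l; [lra|exact T]|].
    replace (4 * P * INR N ^ i) with
      (Rabs u * (2 / Rabs u * (P * INR N ^ i) + 2 / Rabs u * (P * INR N ^ i)))
      by (field; lra).
    apply Rmult_le_compat_l; lra. }
  unfold kernel_majorant; set (d := 1 + INR N * Rabs u).
  assert (d0 : 0 < d) by (unfold d; nra).
  apply (Rmult_le_reg_r d); [assumption|].
  replace (5 * P * INR N ^ i * (INR N / d) * d) with (5 * P * INR N ^ i * INR N)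
    by (field; lra).
  unfold d; nra.
Qed.

Lemma ccont_bounded (f : R -> C) (a b : R) : a <= b -> ccont f ->
  exists M, 0 <= M /\ forall x, a <= x <= b -> Cmod (f x) <= M.
Proof.
  intros ab Hf.
  assert (B : forall g : R -> R, (forall x, continuous g x) ->
    exists M, forall x, a <= x <= b -> Rabs (g x) <= M).
  { intros g Hg; destruct (continuity_ab_maj (fun x => Rabs (g x)) a b ab) as [m [Hm _]].
    - intros x _; apply continuity_pt_filterlim, (continuous_comp g Rabs x (Hg x)).
      apply continuous_Rabs.
    - now exists (Rabs (g m)). }
  destruct (B _ (fun x => proj1 (Hf x))) as [M1 H1].
  destruct (B _ (fun x => proj2 (Hf x))) as [M2 H2].
  exists (M1 + M2); split.
  - assert (A1 := H1 a ltac:(lra)); assert (A2 := H2 a ltac:(lra)).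
    generalize (Rabs_pos (Re (f a))) (Rabs_pos (Im (f a))); lra.
  - intros x Hx; eapply Rle_trans; [apply Cmod_le_sum|].
    apply Rplus_le_compat; auto.
Qed.

Lemma supported_bounded (f : R -> C) (A : R) : 0 <= A -> ccont f -> supported_in A f ->
  exists M, 0 <= M /\ forall x, Cmod (f x) <= M.
Proof.
  intros A0 Hf Hs; destruct (ccont_bounded f (- A) A ltac:(lra) Hf) as [M [M0 HM]].
  exists M; split; [assumption|]; intros x; destruct (Rle_dec (Rabs x) A) as [H|H].
  - apply HM; now apply Rabs_le_between.
  - rewrite Hs by lra; now rewrite Cmod_0.
Qed.

(** The product rule sends a derivative either to [chi] or to the kernel, so the induction runs over
    all cutoffs and all [i] at once. Only the second alternative costs a factor [N]. *)
Lemma localized_dirichlet_deriv_bound (s : Z) (j i : nat) (chi : R -> C) : is_sign s ->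
  (forall n, Csmooth n chi) -> supported_in (3/5) chi ->
  exists B, 0 <= B /\ forall N u, (1 <= N)%nat ->
    Cmod (Cderive_n (fun u => chi u * dirichlet_deriv s i N u)%C j u)
      <= B * INR N ^ (i + j) * kernel_majorant N u.
Proof.
  intros Hs; revert i chi; induction j as [|j IH]; intros i chi Hchi Hsup.
  - destruct (supported_bounded chi (3/5) ltac:(lra) (ccont_Csmooth _ Hchi) Hsup)
      as [M [M0 HM]].
    destruct (dirichlet_deriv_bound s i Hs) as [B [B0 HB]].
    exists (M * B); split; [now apply Rmult_le_pos|]; intros N u HN.
    rewrite Cderive_n_0, Nat.add_0_r.
    destruct (Rle_dec (Rabs u) (3/5)) as [Hu|Hu].
    + rewrite Cmod_mult, !Rmult_assoc, <- (Rmult_assoc B).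
      apply Rmult_le_compat; try apply Cmod_ge_0; auto.
    + rewrite Hsup, Cmult_0_l, Cmod_0 by lra.
      apply Rmult_le_pos; [|apply kernel_majorant_pos].
      apply Rmult_le_pos; [now apply Rmult_le_pos | apply pow_le, pos_INR].
  - assert (Hchi' : exists chi', cder chi chi' /\ forall n, Csmooth n chi').
    { assert (T := test_function_Csmooth chi _ Hchi Hsup).
      exists (Cderive_n chi 1); split.
      - rewrite <- (Cderive_n_0 chi) at 1; now apply test_cder.
      - exact (Csmooth_all _ (proj1 (test_deriv chi 1 T))). }
    destruct Hchi' as [chi' [Hd Hs']].
    destruct (IH i chi' Hs' (supported_in_cder _ _ _ Hd Hsup)) as [B1 [B10 HB1]].
    destruct (IH (S i) chi Hchi Hsup) as [B2 [B20 HB2]].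
    exists (B1 + B2); split; [lra|]; intros N u HN.
    rewrite (Cderive_n_S _ _ j (cder_mult _ _ _ _ Hd (cder_dirichlet_deriv s i N))).
    rewrite Cderive_n_plus by (apply Csmooth_mult; auto; apply Csmooth_dirichlet_deriv).
    eapply Rle_trans; [apply Cmod_triangle|].
    assert (K := kernel_majorant_pos N u); assert (N1 := INR_ge_1 N HN).
    assert (A1 := HB1 N u HN); assert (A2 := HB2 N u HN).
    replace (S i + j)%nat with (i + S j)%nat in A2 by lia.
    assert (A3 : B1 * INR N ^ (i + j) * kernel_majorant N u
                 <= B1 * INR N ^ (i + S j) * kernel_majorant N u).
    { apply Rmult_le_compat_r; [assumption|]; apply Rmult_le_compat_l; [assumption|].
      apply Rle_pow; [assumption|lia]. }
    replace ((B1 + B2) * INR N ^ (i + S j) * kernel_majorant N u) with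
      (B1 * INR N ^ (i + S j) * kernel_majorant N u
       + B2 * INR N ^ (i + S j) * kernel_majorant N u) by ring.
    lra.
Qed.

Lemma is_RInt_kernel_majorant (N : nat) (x : R) : -2 <= x <= 2 ->
  is_RInt (fun y => kernel_majorant N (y - x)) (-2) 2
    (ln (1 + INR N * (x + 2)) + ln (1 + INR N * (2 - x))).
Proof.
  intros Hx; assert (N0 := pos_INR N).
  assert (H1 : is_RInt (fun y => INR N / (1 + INR N * (x - y))) (-2) x
                 (ln (1 + INR N * (x + 2)))).
  { replace (ln (1 + INR N * (x + 2))) with
      (minus (- ln (1 + INR N * (x - x))) (- ln (1 + INR N * (x - -2)))).
    - apply (is_RInt_derive (V := R_CompleteNormedModule)
               (fun y => - ln (1 + INR N * (x - y)))); intros y;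
        rewrite Rmin_left, Rmax_right by lra; intros Hy;
        assert (0 < 1 + INR N * (x - y)) by nra.
      + eapply is_derive_eq; [auto_derive; [assumption | reflexivity]|].
        field; lra.
      + apply (ex_derive_continuous (V := R_NormedModule)); auto_derive; lra.
    - unfold minus, plus, opp; simpl.
      rewrite Rminus_diag, Rmult_0_r, Rplus_0_r, ln_1.
      replace (x - -2) with (x + 2) by ring; ring. }
  assert (H2 : is_RInt (fun y => INR N / (1 + INR N * (y - x))) x 2
                 (ln (1 + INR N * (2 - x)))).
  { replace (ln (1 + INR N * (2 - x))) with
      (minus (ln (1 + INR N * (2 - x))) (ln (1 + INR N * (x - x)))).
    - apply (is_RInt_derive (V := R_CompleteNormedModule)
               (fun y => ln (1 + INR N * (y - x)))); intros y;
        rewrite Rmin_left, Rmax_right by lra; intros Hy;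
        assert (0 < 1 + INR N * (y - x)) by nra.
      + eapply is_derive_eq; [auto_derive; [assumption | reflexivity]|].
        field; lra.
      + apply (ex_derive_continuous (V := R_NormedModule)); auto_derive; lra.
    - unfold minus, plus, opp; simpl.
      rewrite Rminus_diag, Rmult_0_r, Rplus_0_r, ln_1; ring. }
  apply (is_RInt_Chasles (V := R_NormedModule) _ (-2) x 2).
  - apply (is_RInt_ext (fun y => INR N / (1 + INR N * (x - y)))); [|exact H1].
    rewrite Rmin_left, Rmax_right by lra; intros y Hy; unfold kernel_majorant.
    rewrite Rabs_left by lra; do 3 f_equal; ring.
  - apply (is_RInt_ext (fun y => INR N / (1 + INR N * (y - x)))); [|exact H2].
    rewrite Rmin_left, Rmax_right by lra; intros y Hy; unfold kernel_majorant.
    rewrite Rabs_right by lra; easy.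
Qed.

Lemma kernel_majorant_integral_bound (eps : R) : 0 < eps -> exists B, 0 <= B /\
  forall N x, (1 <= N)%nat -> 0 <= x <= 1 ->
  exists I, is_RInt (fun y => kernel_majorant N (y - x)) (-2) 2 I /\ I <= B * npow eps N.
Proof.
  intros He; exists (2 * (Rpower 4 eps / eps)); split.
  { assert (0 < Rpower 4 eps / eps) by (apply Rdiv_lt_0_compat; [apply exp_pos|lra]); lra. }
  intros N x HN Hx; eexists; split; [apply is_RInt_kernel_majorant; lra|].
  assert (N1 := INR_ge_1 N HN).
  (* This is [eps * ln z <= exp (eps * ln z)], with [4 N] an upper bound for both arguments of the
     logarithm when [x] lies in [[0, 1]]. *)
  assert (L : forall z, 0 < z <= 4 * INR N -> ln z <= Rpower 4 eps / eps * npow eps N).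
  { intros z Hz; apply Rle_trans with (ln (4 * INR N)); [apply ln_le; lra|].
    apply (Rmult_le_reg_l eps); [assumption|].
    replace (eps * (Rpower 4 eps / eps * npow eps N)) with (Rpower 4 eps * npow eps N)
      by (field; lra).
    unfold npow; rewrite Rpower_mult_distr by lra.
    unfold Rpower; generalize (exp_ineq1_le (eps * ln (4 * INR N))); lra. }
  assert (A1 := L (1 + INR N * (x + 2)) ltac:(nra)).
  assert (A2 := L (1 + INR N * (2 - x)) ltac:(nra)); lra.
Qed.

(** * Pairing with the localized kernel *)

Definition side (s : Z) (c : Z -> C) (n : nat) : C := c (s * Z.of_nat n)%Z.

Lemma osum_S (s : Z) (a : nat -> C) (N : nat) (x : R) :
  osum s a (S N) x = (osum s a N x + a (S N) * e (IZR s * INR (S N) * x))%C.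
Proof. easy. Qed.

Lemma two_sided_osum (c : Z -> C) (N : nat) (x : R) :
  two_sided_sum c N x =
  (c 0%Z + (osum 1 (side 1 c) N x + osum (-1) (side (-1) c) N x))%C.
Proof.
  induction N as [|N IH].
  - unfold two_sided_sum, osum; simpl; rewrite sum_n_n; simpl.
    rewrite Rmult_0_l, e_0; ring.
  - rewrite !osum_S.
    transitivity (two_sided_sum c N x + (side 1 c (S N) * e (1 * INR (S N) * x)
       + side (-1) c (S N) * e (-1 * INR (S N) * x)))%C; [|rewrite IH; ring].
    unfold two_sided_sum; cbv zeta.
    (* Raising [N] shifts the origin of the index by one, so the new sum is the old one with one
       term added at each end. *)
    replace (2 * S N)%nat with (S (S (2 * N))) by lia.
    rewrite sum_Sn_m by lia; rewrite sum_n_Sm by lia; rewrite <- sum_n_m_S.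
    set (Mid := sum_n_m _ 0 (2 * N)); set (Mid' := sum_n_m _ 0 (2 * N)).
    assert (E : Mid = Mid').
    { apply sum_n_m_ext; intros n.
      now replace (Z.of_nat (S n) - Z.of_nat (S N))%Z with (Z.of_nat n - Z.of_nat N)%Z by lia. }
    rewrite E; change (@plus C_AbelianMonoid) with Cplus; unfold side.
    replace (Z.of_nat 0 - Z.of_nat (S N))%Z with (- Z.of_nat (S N))%Z by lia.
    replace (Z.of_nat (S (S (2 * N))) - Z.of_nat (S N))%Z with (Z.of_nat (S N)) by lia.
    replace (1 * Z.of_nat (S N))%Z with (Z.of_nat (S N)) by lia.
    replace (-1 * Z.of_nat (S N))%Z with (- Z.of_nat (S N))%Z by lia.
    rewrite opp_IZR, <- INR_IZR_INZ.
    replace (1 * INR (S N) * x) with (INR (S N) * x) by ring.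
    replace (-1 * INR (S N) * x) with (- INR (S N) * x) by ring.
    ring.
Qed.

Lemma ccont_ext (f g : R -> C) : (forall x, f x = g x) -> ccont f -> ccont g.
Proof. intros H; now rewrite (functional_extensionality _ _ H). Qed.

Lemma ccont_two_sided (c : Z -> C) (N : nat) : ccont (two_sided_sum c N).
Proof.
  eapply ccont_ext; [intros x; symmetry; apply two_sided_osum|].
  apply ccont_plus; [apply ccont_const | apply ccont_plus; apply ccont_osum].
Qed.

(** The kernel carries the frequencies opposite to [s], so that integrating it against [e (z u)]
    leaves a zero frequency exactly when [z = s n]. *)
Definition local_dirichlet (s : Z) (N : nat) (u : R) : C :=
  (window u * dirichlet_deriv (- s) 0 N u)%C.

Lemma Csmooth_local_dirichlet (s : Z) (N n : nat) : Csmooth n (local_dirichlet s N).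
Proof. apply Csmooth_mult; [apply Csmooth_window | apply Csmooth_dirichlet_deriv]. Qed.

Lemma supported_local_dirichlet (s : Z) (N : nat) : supported_in (3/5) (local_dirichlet s N).
Proof. intros u Hu; unfold local_dirichlet; rewrite supported_window by assumption; ring. Qed.

(** Pairing with [probe s N x] extracts the [N]-th one-sided partial sum at [x]. *)
Definition probe (s : Z) (N : nat) (x y : R) : C := local_dirichlet s N (y + - x).

Lemma Csmooth_probe (s : Z) (N n : nat) (x : R) : Csmooth n (probe s N x).
Proof. apply Csmooth_shift, Csmooth_local_dirichlet. Qed.

(** [8/5 = 1 + 3/5]. With [x] confined to one period every probe lives inside [[-2, 2]], which fixes
    the interval of integration in all the pairings. *)
Lemma supported_probe (s : Z) (N : nat) (x : R) : 0 <= x <= 1 ->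
  supported_in (8/5) (probe s N x).
Proof.
  intros Hx y Hy; apply supported_local_dirichlet.
  destruct (Rle_dec 0 y).
  - rewrite Rabs_right in Hy by lra; rewrite Rabs_right; lra.
  - rewrite Rabs_left in Hy by lra; rewrite Rabs_left; lra.
Qed.

Lemma test_probe (s : Z) (N : nat) (x : R) : 0 <= x <= 1 -> test_function (probe s N x).
Proof.
  intros Hx; apply test_function_Csmooth with (8/5); [|now apply supported_probe].
  intros n; apply Csmooth_probe.
Qed.

Lemma probe_bound (s : Z) (j : nat) : is_sign s -> exists B, 0 <= B /\
  forall N x y, (1 <= N)%nat ->
    Cmod (Cderive_n (probe s N x) j y) <= B * INR N ^ j * kernel_majorant N (y - x).
Proof.
  intros Hs.
  destruct (localized_dirichlet_deriv_bound (- s) j 0 window (is_sign_opp s Hs) Csmooth_window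
              supported_window) as [B [B0 HB]].
  exists B; split; [assumption|]; intros N x y HN.
  assert (E := Cderive_n_shift j (- x) _ (Csmooth_local_dirichlet s N j)).
  unfold probe; rewrite E; exact (HB N (y - x) HN).
Qed.

(** The translates of [window] sum to [1], so integrating over the line acts as integrating a
    periodic function over one period, and orthogonality applies. The last factor counts the
    [n <= N] with [s n = z]. *)
Lemma cint_e_probe (s z : Z) (N : nat) (x : R) : 0 <= x <= 1 ->
  cint (fun y => e (IZR z * y) * probe s N x y)%C (-2) 2 =
  (e (IZR z * x) *
   csum (fun n => if Z.eqb z (s * Z.of_nat n) then RtoC 1 else RtoC 0) N)%C.
Proof.
  intros Hx.
  assert (Hl : ccont (local_dirichlet s N)) by apply ccont_Csmooth, Csmooth_local_dirichlet.
  set (h := fun u => (e (IZR z * u)%R * local_dirichlet s N u)%C).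
  assert (Hh : ccont h) by (apply ccont_mult; [apply ccont_e | exact Hl]).
  assert (Sh : supported_in 1 h).
  { intros u Hu; unfold h; rewrite supported_local_dirichlet by lra; ring. }
  assert (E1 : (fun y => e (IZR z * y)%R * probe s N x y)%C =
               (fun y => e (IZR z * x)%R * h (y + - x)%R)%C).
  { apply functional_extensionality; intros y; unfold h, probe.
    rewrite Cmult_assoc, <- e_plus; do 2 f_equal; ring. }
  rewrite E1, cint_scal by now apply ccont_shift.
  f_equal; rewrite cint_shift, (cint_supported h 1) by (assumption || lra).
  set (f := fun (n : nat) u => (window u * e (IZR (z - s * Z.of_nat n) * u)%R)%C).
  assert (E2 : h = fun u => csum (fun n => f n u) N).
  { apply functional_extensionality; intros u; unfold h, local_dirichlet, dirichlet_deriv, osum.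
    rewrite Cmult_assoc, <- csum_scal; apply csum_ext; intros n _; unfold f.
    rewrite minus_IZR, mult_IZR, <- INR_IZR_INZ, opp_IZR.
    replace ((IZR z - IZR s * INR n) * u) with (IZR z * u + - IZR s * INR n * u) by ring.
    rewrite e_plus; simpl; ring. }
  rewrite E2, cint_csum.
  2: { intros n; apply ccont_mult; [apply ccont_Csmooth, Csmooth_window | apply ccont_e]. }
  apply csum_ext; intros n _; unfold f; rewrite cint_window_e.
  destruct (Z.eqb_spec (z - s * Z.of_nat n) 0), (Z.eqb_spec z (s * Z.of_nat n)); lia || easy.
Qed.

Lemma count_same (s : Z) (m N : nat) : is_sign s -> (1 <= m)%nat ->
  csum (fun n => if Z.eqb (s * Z.of_nat m) (s * Z.of_nat n) then RtoC 1 else RtoC 0) N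
  = if Nat.leb m N then RtoC 1 else RtoC 0.
Proof.
  intros Hs Hm; induction N as [|N IH].
  - destruct (Nat.leb_spec m 0); [lia|easy].
  - cbn [csum]; rewrite IH.
    destruct (Nat.eq_dec m (S N)) as [->|ne].
    + rewrite Z.eqb_refl, Nat.leb_refl; destruct (Nat.leb_spec (S N) N); [lia | ring].
    + rewrite (proj2 (Z.eqb_neq _ _)) by (destruct Hs; subst s; lia).
      destruct (Nat.leb_spec m N), (Nat.leb_spec m (S N)); lia || ring.
Qed.

Lemma count_opp (s : Z) (m N : nat) : is_sign s -> (1 <= m)%nat ->
  csum (fun n => if Z.eqb (- s * Z.of_nat m) (s * Z.of_nat n) then RtoC 1 else RtoC 0) N
  = RtoC 0.
Proof.
  intros Hs Hm; apply csum_zero; intros n Hn.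
  destruct (Z.eqb_spec (- s * Z.of_nat m) (s * Z.of_nat n)); [|easy].
  destruct Hs; subst s; lia.
Qed.

Lemma cint_osum_probe (t s : Z) (a : nat -> C) (M N : nat) (x : R) : 0 <= x <= 1 ->
  cint (fun y => osum t a M y * probe s N x y)%C (-2) 2 =
  csum (fun m => a m * e (IZR t * INR m * x) *
     csum (fun n => if Z.eqb (t * Z.of_nat m) (s * Z.of_nat n) then RtoC 1 else RtoC 0) N)%C M.
Proof.
  intros Hx.
  assert (Hp : ccont (probe s N x))
    by (apply ccont_Csmooth; intros n; apply Csmooth_probe).
  assert (E : (fun y => osum t a M y * probe s N x y)%C =
    (fun y => csum (fun m => a m * (e (IZR (t * Z.of_nat m) * y) * probe s N x y))%C M)).
  { apply functional_extensionality; intros y; unfold osum.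
    rewrite Cmult_comm, <- csum_scal; apply csum_ext; intros m _.
    rewrite mult_IZR, <- INR_IZR_INZ; ring. }
  assert (Hm : forall m, ccont (fun y => e (IZR (t * Z.of_nat m) * y) * probe s N x y)%C)
    by (intros m; apply ccont_mult; [apply ccont_e | exact Hp]).
  rewrite E, cint_csum; [|intros m; apply ccont_mult; [apply ccont_const | apply Hm]].
  apply csum_ext; intros m _.
  rewrite cint_scal, cint_e_probe by (assumption || apply Hm).
  rewrite mult_IZR, <- INR_IZR_INZ; ring.
Qed.

Lemma csum_truncate (f : nat -> C) (M N : nat) : (N <= M)%nat ->
  csum (fun m => f m * if Nat.leb m N then RtoC 1 else RtoC 0)%C M = csum f N.
Proof.
  intros H; induction H as [|M H IH].
  - apply csum_ext; intros m Hm; destruct (Nat.leb_spec m N); [ring|lia].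
  - cbn [csum]; rewrite IH; destruct (Nat.leb_spec (S M) N); [lia|ring].
Qed.

Lemma cint_two_sided_probe (s : Z) (c : Z -> C) (M N : nat) (x : R) :
  is_sign s -> c 0%Z = RtoC 0 -> (N <= M)%nat -> 0 <= x <= 1 ->
  cint (fun y => two_sided_sum c M y * probe s N x y)%C (-2) 2 = osum s (side s c) N x.
Proof.
  intros Hs c0 MN Hx.
  assert (Hp : ccont (probe s N x)) by (apply ccont_Csmooth; intros n; apply Csmooth_probe).
  assert (Same : forall a, cint (fun y => osum s a M y * probe s N x y)%C (-2) 2
                           = osum s a N x).
  { intros a; rewrite cint_osum_probe by assumption.
    unfold osum; rewrite <- (csum_truncate _ M N MN); apply csum_ext; intros m Hm.
    now rewrite count_same by (assumption || lia). }
  assert (Opp : forall a, cint (fun y => osum (- s) a M y * probe s N x y)%C (-2) 2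
                          = RtoC 0).
  { intros a; rewrite cint_osum_probe by assumption.
    apply csum_zero; intros m Hm; rewrite count_opp by (assumption || lia); ring. }
  assert (E : (fun y => two_sided_sum c M y * probe s N x y)%C =
    (fun y => osum s (side s c) M y * probe s N x y
              + osum (- s) (side (- s) c) M y * probe s N x y)%C).
  { apply functional_extensionality; intros y; rewrite two_sided_osum, c0.
    destruct Hs; subst s; simpl; ring. }
  rewrite E, cint_plus, Same, Opp by (apply ccont_mult; [apply ccont_osum | exact Hp]).
  ring.
Qed.

Lemma cint_conv (f g : R -> C) (a b : R) : f = g -> cint f a b = cint g a b.
Proof. now intros ->. Qed.

(** Splitting [f] into its Steklov average over [h = 1/N] and a remainder of size
    [h^a]: the remainder absorbs all the derivatives of the probe, while for the average
    one integration by parts trades a factor [N] against [h^(a-1)]. *)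
Lemma holder_probe_bound (s : Z) (f : R -> C) (a H eps : R) (j : nat) :
  is_sign s -> ccont f -> 0 < eps -> 0 <= H ->
  (forall x y, Rabs x <= 3 -> Rabs y <= 3 -> x <> y ->
     Cmod (f x - f y)%C <= H * Rpower (Rabs (x - y)) a) -> 0 <= a ->
  exists B, forall N x, (1 <= N)%nat -> 0 <= x <= 1 ->
    Cmod (cint (fun y => f y * Cderive_n (probe s N x) (S j) y)%C (-2) 2)
      <= B * npow (INR (S j) - a + eps) N.
Proof.
  intros Hs Hf He H0 Hh a0.
  destruct (probe_bound s (S j) Hs) as [B1 [B10 HB1]].
  destruct (probe_bound s j Hs) as [B2 [B20 HB2]].
  destruct (kernel_majorant_integral_bound eps He) as [B3 [B30 HB3]].
  exists (2 * (2 * H * B1 * B3) + 2 * (H * B2 * B3)); intros N x HN Hx.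
  destruct (HB3 N x HN Hx) as [I [HI IB]].
  assert (N1 := INR_ge_1 N HN).
  set (h := / INR N).
  assert (h0 : 0 < h) by (apply Rinv_0_lt_compat; lra).
  assert (h1 : h <= 1) by (unfold h; rewrite <- Rinv_1; apply Rinv_le_contravar; lra).
  assert (hN : INR N * h = 1) by (unfold h; field; lra).
  assert (ha : Rpower h a = npow (- a) N).
  { unfold h, npow; rewrite Rpower_Ropp, <- (Rpower_1 (INR N)) at 1 by lra.
    rewrite <- Rpower_Ropp, Rpower_mult, <- Rpower_Ropp; f_equal; ring. }
  (* Both points stay in [[-2, 3]], since [h <= 1]; this is the origin of the radius [3] in the
     hypothesis on [f]. *)
  assert (Near : forall y t, -2 <= y <= 2 -> y <= t <= y + h ->
    Cmod (f y - f t)%C <= H * npow (- a) N).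
  { intros y t Hy Ht; rewrite <- ha.
    assert (P : 0 < Rpower h a) by apply exp_pos.
    destruct (Req_dec y t) as [->|yt].
    - replace (f t - f t)%C with (RtoC 0) by ring; rewrite Cmod_0; nra.
    - eapply Rle_trans; [apply Hh; try assumption; apply Rabs_le; lra|].
      apply Rmult_le_compat_l; [assumption|].
      rewrite Rabs_minus_sym, Rabs_right by lra.
      apply Rle_Rpower_l; lra. }
  set (p := fun y => cint f 0 y).
  assert (Dp : cder p f) by now apply cder_cint.
  set (F := fun y => (RtoC (INR N) * (p (y + h)%R + RtoC (-1) * p y))%C).
  set (F' := fun y => (RtoC (INR N) * (f (y + h)%R + RtoC (-1) * f y))%C).
  assert (DF : cder F F').
  { apply cder_scal, cder_plus; [now apply cder_shift | now apply cder_scal]. }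
  assert (CF' : ccont F').
  { apply ccont_mult; [apply ccont_const|]; apply ccont_plus; [now apply ccont_shift|].
    apply ccont_mult; [apply ccont_const | assumption]. }
  assert (CF := ccont_cder _ _ DF).
  assert (Tp := test_probe s N x Hx).
  assert (D := test_cder _ j Tp).
  assert (C0 := test_ccont _ j Tp); assert (C1 := test_ccont _ (S j) Tp).
  assert (Sp := test_supported _ _ j Tp (supported_probe s N x Hx)).
  set (G := Cderive_n (probe s N x) j) in *.
  set (G' := Cderive_n (probe s N x) (S j)) in *.
  assert (E : cint (fun y => f y * G' y)%C (-2) 2 =
    (cint (fun y => (f y - F y) * G' y)%C (-2) 2
     - cint (fun y => F' y * G y)%C (-2) 2)%C).
  { rewrite (cint_conv (fun y => f y * G' y)%C
               (fun y => (f y - F y) * G' y + F y * G' y)%C)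
      by (apply functional_extensionality; intros y; ring).
    rewrite (cint_plus _ _ (-2) 2 (ccont_mult _ _ (ccont_minus _ _ Hf CF) C1)
               (ccont_mult _ _ CF C1)).
    rewrite (cint_parts F F' G G'); try assumption; [ring| |];
      apply Sp; [rewrite Rabs_left | rewrite Rabs_right]; lra. }
  assert (fF : forall y, -2 <= y <= 2 -> Cmod (f y - F y)%C <= 2 * H * npow (- a) N).
  { intros y Hy.
    assert (EF : (f y - F y)%C = (RtoC (INR N) * cint (fun t => f y - f t)%C y (y + h))%C).
    { rewrite cint_minus, cint_const by (assumption || apply ccont_const).
      rewrite <- (Cmult_1_l (f y)) at 1; rewrite <- hN, RtoC_mult.
      replace (cint f y (y + h)) with (p (y + h)%R - p y)%C.
      2: { symmetry; exact (cint_cder p f y (y + h) Dp Hf). }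
      unfold F; replace (y + h - y) with h by ring.
      replace (RtoC (-1)) with (- RtoC 1)%C by (apply C_ext; simpl; ring); ring. }
    rewrite EF, Cmod_mult, Cmod_R, Rabs_right by lra.
    assert (Q := cint_le_const (fun t => f y - f t)%C (H * npow (- a) N) y (y + h)
      ltac:(lra) ltac:(apply ccont_minus; [apply ccont_const | assumption])
      (fun t Ht => Near y t Hy Ht)).
    replace (y + h - y) with h in Q by ring.
    replace (2 * H * npow (- a) N) with (INR N * (2 * (h * (H * npow (- a) N)))).
    - apply Rmult_le_compat_l; lra.
    - replace (INR N * (2 * (h * (H * npow (- a) N)))) with
        ((INR N * h) * (2 * H * npow (- a) N)) by ring.
      rewrite hN; ring. }
  assert (F'b : forall y, -2 <= y <= 2 -> Cmod (F' y) <= INR N * (H * npow (- a) N)).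
  { intros y Hy; unfold F'; rewrite Cmod_mult, Cmod_R, Rabs_right by lra.
    apply Rmult_le_compat_l; [lra|].
    replace (f (y + h)%R + RtoC (-1) * f y)%C with (- (f y - f (y + h)%R))%C
      by (replace (RtoC (-1)) with (- RtoC 1)%C by (apply C_ext; simpl; ring); ring).
    rewrite Cmod_opp; apply Near; lra. }
  assert (na := npow_pos (- a) N).
  assert (NS : 0 <= INR N ^ S j) by (apply pow_le; lra).
  assert (Nj : 0 <= INR N ^ j) by (apply pow_le; lra).
  assert (I0 : 0 <= I).
  { apply (is_RInt_ge_0 (fun y => kernel_majorant N (y - x)) (-2) 2); [lra | exact HI|].
    intros y _; apply kernel_majorant_pos. }
  assert (T1 : Cmod (cint (fun y => (f y - F y) * G' y)%C (-2) 2) <=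
    2 * (2 * H * npow (- a) N * (B1 * INR N ^ S j) * I)).
  { apply (cint_le _ (fun y =>
      (2 * H * npow (- a) N * (B1 * INR N ^ S j)) * kernel_majorant N (y - x)));
      [lra | exact (ccont_mult _ _ (ccont_minus _ _ Hf CF) C1) | |].
    - intros y Hy; rewrite Cmod_mult, Rmult_assoc.
      apply Rmult_le_compat; try apply Cmod_ge_0; [now apply fF | now apply HB1].
    - now apply (is_RInt_scal (V := R_NormedModule)). }
  assert (T2 : Cmod (cint (fun y => F' y * G y)%C (-2) 2) <=
    2 * (INR N * (H * npow (- a) N) * (B2 * INR N ^ j) * I)).
  { apply (cint_le _ (fun y =>
      (INR N * (H * npow (- a) N) * (B2 * INR N ^ j)) * kernel_majorant N (y - x)));
      [lra | exact (ccont_mult _ _ CF' C0) | |].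
    - intros y Hy; rewrite Cmod_mult, Rmult_assoc.
      apply Rmult_le_compat; try apply Cmod_ge_0; [now apply F'b | now apply HB2].
    - now apply (is_RInt_scal (V := R_NormedModule)). }
  rewrite E; eapply Rle_trans; [apply Cmod_minus_le|].
  assert (EN : npow (INR (S j) - a + eps) N = INR N ^ S j * npow (- a) N * npow eps N).
  { rewrite <- npow_INR by assumption; now rewrite <- !npow_plus. }
  rewrite EN.
  replace ((2 * (2 * H * B1 * B3) + 2 * (H * B2 * B3)) *
           (INR N ^ S j * npow (- a) N * npow eps N)) with
    (2 * (2 * H * npow (- a) N * (B1 * INR N ^ S j) * (B3 * npow eps N))
     + 2 * (INR N * (H * npow (- a) N) * (B2 * INR N ^ j) * (B3 * npow eps N)))
    by (simpl; ring).
  assert (U1 : 0 <= 2 * H * npow (- a) N * (B1 * INR N ^ S j)).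
  { apply Rmult_le_pos; [|now apply Rmult_le_pos]; apply Rmult_le_pos; lra. }
  assert (U2 : 0 <= INR N * (H * npow (- a) N) * (B2 * INR N ^ j)).
  { apply Rmult_le_pos; [|now apply Rmult_le_pos].
    apply Rmult_le_pos; [lra|]; apply Rmult_le_pos; lra. }
  assert (V1 := Rmult_le_compat_l _ _ _ U1 IB).
  assert (V2 := Rmult_le_compat_l _ _ _ U2 IB).
  lra.
Qed.

(** * From Hölder regularity to partial sums *)

Definition obound (s : Z) (a : nat -> C) (g : R) : Prop :=
  exists K, forall N x, (1 <= N)%nat -> Cmod (osum s a N x) <= K * npow g N.

Lemma osum_periodic (s : Z) (a : nat -> C) (N : nat) (x : R) (z : Z) :
  osum s a N (x + IZR z) = osum s a N x.
Proof.
  apply csum_ext; intros n _.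
  replace (IZR s * INR n * (x + IZR z)) with (IZR s * INR n * x + IZR (s * Z.of_nat n * z))
    by (rewrite !mult_IZR, <- INR_IZR_INZ; ring).
  rewrite e_plus, e_IZR; ring.
Qed.

Lemma obound_unit_interval (s : Z) (a : nat -> C) (g K : R) :
  (forall N x, (1 <= N)%nat -> 0 <= x <= 1 -> Cmod (osum s a N x) <= K * npow g N) ->
  obound s a g.
Proof.
  intros H; exists K; intros N x HN.
  destruct (base_fp x) as [F1 F2]; unfold frac_part in F1, F2.
  replace x with ((x - IZR (Int_part x)) + IZR (Int_part x)) by ring.
  rewrite osum_periodic; apply H; [assumption|lra].
Qed.

Lemma osum_scal (s : Z) (z : C) (a : nat -> C) (N : nat) (x : R) :
  osum s (fun n => z * a n)%C N x = (z * osum s a N x)%C.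
Proof. unfold osum; rewrite <- csum_scal; apply csum_ext; intros n _; ring. Qed.

Lemma osum_ext (s : Z) (a b : nat -> C) (N : nat) (x : R) :
  (forall n, (1 <= n)%nat -> a n = b n) -> osum s a N x = osum s b N x.
Proof. intros H; apply csum_ext; intros n Hn; now rewrite H by lia. Qed.

Lemma obound_scal (s : Z) (z : C) (a b : nat -> C) (g : R) :
  (forall n, (1 <= n)%nat -> b n = z * a n)%C -> obound s a g -> obound s b g.
Proof.
  intros E [K HK]; exists (Cmod z * K); intros N x HN.
  rewrite (osum_ext s b _ N x E), osum_scal, Cmod_mult, Rmult_assoc.
  apply Rmult_le_compat_l; [apply Cmod_ge_0 | now apply HK].
Qed.

Lemma obound_weighted (s : Z) (a : nat -> C) (g : R) (r : C) : 0 < g + Re r ->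
  obound s a g -> obound s (weighted a r) (g + Re r).
Proof. intros Hd [K HK]; exact (abel_growth s a r K g Hd HK). Qed.

Definition dcoef (p : nat) (c : Z -> C) (n : Z) : C := ((0, 2 * PI * IZR n)%R ^ p * c n)%C.

Lemma dcoef_0 (c : Z -> C) : dcoef 0 c = c.
Proof. apply functional_extensionality; intros n; unfold dcoef; simpl; ring. Qed.

Lemma dcoef_zero (p : nat) (c : Z -> C) : c 0%Z = RtoC 0 -> dcoef p c 0%Z = RtoC 0.
Proof. intros H; unfold dcoef; rewrite H; ring. Qed.

Lemma cder_two_sided (c : Z -> C) (p N : nat) :
  cder (two_sided_sum (dcoef p c) N) (two_sided_sum (dcoef (S p) c) N).
Proof.
  rewrite (functional_extensionality _ _ (two_sided_osum (dcoef p c) N)).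
  rewrite (functional_extensionality _ _ (two_sided_osum (dcoef (S p) c) N)).
  replace (dcoef (S p) c 0%Z) with (RtoC 0).
  2: { unfold dcoef; replace ((0, 2 * PI * IZR 0) : C) with (RtoC 0)
         by (apply C_ext; simpl; ring). rewrite Cpow_S; ring. }
  assert (S1 : forall s, side s (dcoef (S p) c) =
    (fun n => (0, 2 * PI * (IZR s * INR n))%R * side s (dcoef p c) n)%C).
  { intros s; apply functional_extensionality; intros n; unfold side, dcoef.
    rewrite Cpow_S, mult_IZR, <- INR_IZR_INZ; ring. }
  rewrite !S1.
  exact (cder_plus _ _ _ _ (cder_const _)
           (cder_plus _ _ _ _ (cder_osum 1 _ N) (cder_osum (-1) _ N))).
Qed.

Lemma distr_two_sided_deriv (c : Z -> C) (p M : nat) (phi : R -> C) : test_function phi ->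
  distr_of_fun (two_sided_sum (dcoef p c) M) phi =
  (RtoC ((-1) ^ p) * distr_of_fun (two_sided_sum c M) (Cderive_n phi p))%C.
Proof.
  intros Ht; rewrite (distr_of_fun_deriv_n (fun i => two_sided_sum (dcoef i c) M)).
  - now rewrite dcoef_0.
  - intros i _; apply cder_two_sided.
  - apply ccont_two_sided.
  - assumption.
Qed.

Lemma filterlim_Cmult (z l : C) (u : nat -> C) :
  filterlim u eventually (locally l) ->
  filterlim (fun n => z * u n)%C eventually (locally (z * l)%C).
Proof.
  intros H; eapply filterlim_comp; [exact H|].
  exact (filterlim_scal_r (V := C_NormedModule) z l).
Qed.

Lemma filterlim_const_eq (u : nat -> C) (N : nat) (l L : C) :
  (forall M, (N <= M)%nat -> u M = l) -> filterlim u eventually (locally L) -> L = l.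
Proof.
  intros Hu HL.
  apply (filterlim_locally_unique (K := C_AbsRing) (V := C_NormedModule)
           (F := eventually) u); [exact HL|].
  apply (filterlim_ext_loc (fun _ => l)); [|apply filterlim_const].
  exists N; intros M HM; symmetry; now apply Hu.
Qed.

Lemma cvg_deriv (c : Z -> C) (T : functional) (p : nat) : cvg_distr (two_sided_sum c) T ->
  cvg_distr (two_sided_sum (dcoef p c)) (distr_deriv p T).
Proof.
  intros H phi Ht.
  apply (filterlim_ext
    (fun M => RtoC ((-1) ^ p) * distr_of_fun (two_sided_sum c M) (Cderive_n phi p))%C).
  - intros M; symmetry; now apply distr_two_sided_deriv.
  - apply filterlim_Cmult, H; now apply test_deriv.
Qed.

(** The probe contains only finitely many frequencies, so its pairing with the [M]-th partial sum is
    constant for [M >= N], and the limit is an exact value. *)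
Lemma cvg_distr_probe (s : Z) (c : Z -> C) (T : functional) (N : nat) (x : R) :
  is_sign s -> c 0%Z = RtoC 0 -> cvg_distr (two_sided_sum c) T -> 0 <= x <= 1 ->
  T (probe s N x) = osum s (side s c) N x.
Proof.
  intros Hs c0 H Hx; assert (Tp := test_probe s N x Hx).
  apply (filterlim_const_eq (fun M => distr_of_fun (two_sided_sum c M) (probe s N x)) N);
    [|now apply H].
  intros M HM.
  rewrite (distr_of_fun_cint _ _ 2); [now apply cint_two_sided_probe | lra | | |].
  - apply ccont_two_sided.
  - apply ccont_Csmooth; intros n; apply Csmooth_probe.
  - apply (supported_in_le (8/5)); [lra | now apply supported_probe].
Qed.

Lemma ccont_holder (a : R) (f : R -> C) : holder a f -> ccont f.
Proof.
  intros [[_ H]|[Ha H]]; [now apply continuous_ccont|].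
  assert (L : forall h : C -> R,
    (forall z w, Rabs (h z - h w) <= Cmod (z - w)%C) ->
    forall x, continuous (fun y => h (f y)) x).
  { intros h Hh x; apply continuity_pt_filterlim; intros eps Heps.
    destruct (H (Rabs x + 1)) as [K [K0 HK]].
    set (d := Rpower (eps / K) (/ a)).
    assert (ek : 0 < eps / K) by (apply Rdiv_lt_0_compat; lra).
    assert (d0 : 0 < d) by apply exp_pos.
    exists (Rmin 1 d); split; [apply Rmin_glb_lt; lra|].
    intros y [[_ xy] Hy]; simpl in Hy |- *; unfold R_dist in Hy |- *.
    assert (Hy1 := Rlt_le_trans _ _ _ Hy (Rmin_l _ _)).
    assert (Hy2 := Rlt_le_trans _ _ _ Hy (Rmin_r _ _)).
    assert (yx : y <> x) by congruence.
    assert (By : Rabs y <= Rabs x + 1).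
    { replace y with (x + (y - x)) by ring.
      eapply Rle_trans; [apply Rabs_triang|]; lra. }
    eapply Rle_lt_trans; [apply Hh|].
    eapply Rlt_trans; [apply HK; try assumption; lra|].
    assert (P : Rpower (Rabs (y - x)) a < eps / K).
    { replace (eps / K) with (Rpower d a).
      - apply Rlt_Rpower_l; [lra|]; split; [apply Rabs_pos_lt; lra | assumption].
      - unfold d; rewrite Rpower_mult, Rinv_l, Rpower_1; lra. }
    apply (Rmult_lt_compat_l K) in P; [|assumption].
    replace (K * (eps / K)) with eps in P by (field; lra); exact P. }
  intros x; split; [apply (L Re) | apply (L Im)]; intros z w.
  - exact (re_le_Cmod (z - w)%C).
  - exact (im_le_Cmod (z - w)%C).
Qed.

(** For [a = 0] the power equals [1] at distinct points and twice a local bound of [f] serves as the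
    constant. Continuous functions thereby become the case of exponent [0]. *)
Lemma holder_local (a : R) (f : R -> C) : holder a f -> exists H, 0 <= H /\
  forall x y, Rabs x <= 3 -> Rabs y <= 3 -> x <> y ->
    Cmod (f x - f y)%C <= H * Rpower (Rabs (x - y)) a.
Proof.
  intros Hf; assert (Cf := ccont_holder a f Hf); destruct Hf as [[-> _]|[_ H]].
  - destruct (ccont_bounded f (-3) 3 ltac:(lra) Cf) as [M [M0 HM]].
    exists (2 * M); split; [lra|]; intros x y Hx Hy xy.
    rewrite Rpower_O by (apply Rabs_pos_lt; lra).
    apply Rabs_le_between in Hx; apply Rabs_le_between in Hy.
    assert (A := HM x ltac:(lra)); assert (B := HM y ltac:(lra)).
    assert (D := Cmod_minus_le (f x) (f y)); lra.
  - destruct (H 3) as [K [K0 HK]]; exists K; split; [lra|]; intros x y Hx Hy xy.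
    now apply Rlt_le, HK.
Qed.

Lemma obound_distr_deriv (s : Z) (c : Z -> C) (T : functional) (f : R -> C)
  (a eps : R) (j : nat) : is_sign s -> c 0%Z = RtoC 0 -> 0 <= a -> 0 < eps ->
  cvg_distr (two_sided_sum c) T -> holder a f ->
  distr_eq T (distr_deriv (S j) (distr_of_fun f)) ->
  obound s (side s c) (INR (S j) - a + eps).
Proof.
  intros Hs c0 a0 He HT Hf E.
  assert (Cf := ccont_holder a f Hf).
  destruct (holder_local a f Hf) as [H [H0 HH]].
  destruct (holder_probe_bound s f a H eps j Hs Cf He H0 HH a0) as [B HB].
  apply (obound_unit_interval s _ _ B); intros N x HN Hx.
  assert (Tp := test_probe s N x Hx).
  rewrite <- (cvg_distr_probe s c T N x Hs c0 HT Hx), (E _ Tp); unfold distr_deriv.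
  rewrite Cmod_mult, Cmod_R, pow_1_abs, Rmult_1_l.
  rewrite (distr_of_fun_cint f _ 2);
    [now apply HB | lra | exact Cf | exact (test_ccont _ (S j) Tp)|].
  apply test_supported; [exact Tp|].
  apply (supported_in_le (8/5)); [lra | now apply supported_probe].
Qed.

(** The probe bound needs at least one derivative, so a space of order [a + k] is first
    brought to order [a - 1] by differentiating [k + 1] times. *)
Lemma obound_C_space (s : Z) (c : Z -> C) (T : functional) (beta eps : R) :
  is_sign s -> c 0%Z = RtoC 0 -> 0 < eps ->
  cvg_distr (two_sided_sum c) T -> C_space beta T ->
  exists p, obound s (side s (dcoef p c)) (INR p - beta + eps).
Proof.
  intros Hs c0 He HT [a [k [f [Ha Hf]]]].
  assert (Pos : forall k f, beta = a + INR k ->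
    (forall j x, (j <= k)%nat -> ex_Cderive_n f j x) ->
    holder a (Cderive_n f k) -> distr_eq T (distr_of_fun f) ->
    exists p, obound s (side s (dcoef p c)) (INR p - beta + eps)).
  { clear k f Hf; intros k f Eb Hd Hh E; exists (S k).
    replace (INR (S k) - beta + eps) with (INR 1 - a + eps)
      by (rewrite Eb, (S_INR k); change (INR 1) with 1; ring).
    apply (obound_distr_deriv s _ (distr_deriv (S k) T) (Cderive_n f k));
      try easy; [now apply dcoef_zero | now apply cvg_deriv|].
    intros phi Ht; unfold distr_deriv.
    assert (T1 := test_deriv phi 1 Ht).
    rewrite E by now apply test_deriv.
    rewrite (distr_of_fun_deriv_n (Cderive_n f) k _); [| | |exact T1].
    - rewrite Cderive_n_0, Cderive_n_add by assumption; simpl (1 + k)%nat.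
      rewrite Cmult_assoc, <- RtoC_mult; f_equal; f_equal; simpl; ring.
    - intros i Hi; apply cder_Cderive_n; intros x; apply Hd; lia.
    - exact (ccont_holder a _ Hh). }
  destruct Hf as [[Eb [Hd [Hh E]]]|[Eb [Hh E]]]; [now apply (Pos k f)|].
  (* With [k = 0] no derivative is available for the probe, so this case is passed to the
     nonnegative one. *)
  destruct k as [|k].
  - apply (Pos 0%nat f).
    + rewrite Eb; simpl; ring.
    + intros j x Hj; replace j with 0%nat by lia; easy.
    + now rewrite Cderive_n_0.
    + intros phi Ht; rewrite (E phi Ht); unfold distr_deriv.
      rewrite Cderive_n_0; simpl; ring.
  - exists 0%nat; rewrite dcoef_0.
    replace (INR 0 - beta + eps) with (INR (S k) - a + eps)
      by (rewrite Eb; simpl INR at 2; ring).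
    now apply (obound_distr_deriv s c T f).
Qed.

Lemma imag_neq_0 (t : R) : t <> 0 -> ((0, t) : C) <> RtoC 0.
Proof. intros Ht E; apply Ht; exact (f_equal snd E). Qed.

Lemma sign_freq_neq_0 (s : Z) : is_sign s -> ((0, 2 * PI * IZR s) : C) <> RtoC 0.
Proof.
  intros Hs; apply imag_neq_0; generalize PI_RGT_0; intros P; destruct Hs; subst s; lra.
Qed.

Lemma side_dcoef (s : Z) (p : nat) (c : Z -> C) (n : nat) :
  side s (dcoef p c) n = ((0, 2 * PI * IZR s)%R ^ p * (side s c n * RtoC (INR n ^ p)))%C.
Proof.
  unfold side, dcoef; rewrite RtoC_pow.
  replace ((0, 2 * PI * IZR (s * Z.of_nat n)) : C) with
    ((0, 2 * PI * IZR s)%R * RtoC (INR n))%C.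
  - rewrite Cpow_mult_l; ring.
  - rewrite mult_IZR, <- INR_IZR_INZ; apply C_ext; simpl; ring.
Qed.

Lemma INR_pow_Rcpower (n k : nat) : (1 <= n)%nat ->
  RtoC (INR n ^ k) = Rcpower (INR n) (RtoC (INR k)).
Proof. intros Hn; assert (A := INR_ge_1 n Hn); rewrite Rcpower_INR by lra; easy. Qed.

(** Half of [eps] is spent on choosing an order strictly below [alpha], the other half on the [L^1]
    norm of the kernel. The number [p] of derivatives taken is then exchanged for the prescribed [k]
    by Abel summation with the real weight [n ^ (k - p)]; the resulting exponent is positive because
    [alpha <= k]. *)
Lemma analysis (s : Z) (c : Z -> C) (T : functional) (alpha eps : R) (k : nat) :
  is_sign s -> c 0%Z = RtoC 0 -> 0 < eps -> alpha <= INR k ->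
  cvg_distr (two_sided_sum c) T -> C_lt_space alpha T ->
  obound s (fun n => side s c n * RtoC (INR n ^ k))%C (eps + INR k - alpha).
Proof.
  intros Hs c0 He Hk HT HC.
  destruct (obound_C_space s c T (alpha - eps / 2) (eps / 2) Hs c0 ltac:(lra) HT
              (HC (alpha - eps / 2) ltac:(lra))) as [p Hp].
  assert (z0 := sign_freq_neq_0 s Hs); set (z := ((0, 2 * PI * IZR s)%R ^ p)%C).
  assert (z1 : z <> RtoC 0) by now apply Cpow_nz.
  apply (obound_scal s (/ z)%C _ (fun n => side s c n * RtoC (INR n ^ p))%C) in Hp.
  2: { intros n _; rewrite side_dcoef; fold z; field; exact z1. }
  apply (obound_weighted s _ _ (RtoC (INR k - INR p))) in Hp; [|simpl; lra].
  replace (eps + INR k - alpha) with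
    (INR p - (alpha - eps / 2) + eps / 2 + Re (RtoC (INR k - INR p))) by (simpl; field).
  apply (obound_scal s (RtoC 1) _ _ _) with (2 := Hp); intros n Hn; unfold weighted.
  rewrite !INR_pow_Rcpower by assumption.
  rewrite Cmult_1_l, <- Cmult_assoc, <- Rcpower_plus; do 2 f_equal.
  apply C_ext; simpl; ring.
Qed.

(** * Uniform limits *)

Definition uniform_cvg (F : nat -> R -> C) (f : R -> C) : Prop :=
  forall eps, 0 < eps -> exists N, forall n x, (N <= n)%nat -> Cmod (F n x - f x)%C < eps.

Lemma npow_tends_0 (d eps : R) : d < 0 -> 0 < eps ->
  exists N, (1 <= N)%nat /\ forall n, (N <= n)%nat -> npow d n < eps.
Proof.
  intros Hd He; destruct (INR_unbounded (Rpower eps (/ d))) as [N HN].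
  assert (P : 0 < Rpower eps (/ d)) by apply exp_pos.
  assert (N1 : (1 <= N)%nat) by (apply INR_lt; simpl; lra).
  exists N; split; [assumption|]; intros n Hn.
  assert (A : INR N <= INR n) by now apply le_INR.
  replace eps with (Rpower (Rpower eps (/ d)) d)
    by (rewrite Rpower_mult, Rinv_l, Rpower_1; lra).
  unfold npow; rewrite <- (Ropp_involutive d), !(Rpower_Ropp _ (- d)), Ropp_involutive.
  apply Rinv_lt_contravar; [apply Rmult_lt_0_compat; apply exp_pos|].
  apply Rlt_Rpower_l; lra.
Qed.

Lemma uniform_cvg_rate (F : nat -> R -> C) (f : R -> C) (K d : R) : d < 0 ->
  (forall M x, (1 <= M)%nat -> Cmod (f x - F M x)%C <= K * npow d M) -> uniform_cvg F f.
Proof.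
  intros Hd H eps He.
  assert (K0 : 0 < Rabs K + 1) by (generalize (Rabs_pos K); lra).
  destruct (npow_tends_0 d (eps / (Rabs K + 1)) Hd) as [N [N1 HN]];
    [now apply Rdiv_lt_0_compat|].
  exists N; intros n x Hn.
  replace (F n x - f x)%C with (- (f x - F n x))%C by ring; rewrite Cmod_opp.
  eapply Rle_lt_trans; [apply H; lia|].
  assert (A := HN n Hn); assert (P := npow_pos d n); assert (B := Rle_abs K).
  apply (Rmult_lt_compat_l (Rabs K + 1)) in A; [|assumption].
  replace ((Rabs K + 1) * (eps / (Rabs K + 1))) with eps in A by (field; lra); nra.
Qed.

Lemma cauchy_limit_R (u : nat -> R) (K d : R) : d < 0 ->
  (forall M N, (1 <= M <= N)%nat -> Rabs (u N - u M) <= K * npow d M) ->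
  forall M, (1 <= M)%nat -> Rabs (real (Lim_seq u) - u M) <= K * npow d M.
Proof.
  intros Hd H M HM.
  assert (EX : ex_finite_lim_seq u).
  { apply ex_lim_seq_cauchy_corr; intros eps.
    assert (K0 : 0 < Rabs K + 1) by (generalize (Rabs_pos K); lra).
    destruct (npow_tends_0 d (eps / 2 / (Rabs K + 1)) Hd) as [N [N1 HN]].
    { apply Rdiv_lt_0_compat; [destruct eps; simpl; lra | assumption]. }
    exists N; intros n m Hn Hm.
    assert (A := HN N (le_n _)); assert (P := npow_pos d N); assert (B := Rle_abs K).
    apply (Rmult_lt_compat_l (Rabs K + 1)) in A; [|assumption].
    replace ((Rabs K + 1) * (eps / 2 / (Rabs K + 1))) with (eps / 2) in A by (field; lra).
    assert (Q1 := H N n ltac:(lia)); assert (Q2 := H N m ltac:(lia)).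
    replace (u n - u m) with ((u n - u N) - (u m - u N)) by ring.
    assert (T := Rabs_triang (u n - u N) (- (u m - u N))); rewrite Rabs_Ropp in T.
    unfold Rminus at 1; nra. }
  apply Lim_seq_correct' in EX; rewrite Rabs_minus_sym.
  assert (L := is_lim_seq_abs _ _ (is_lim_seq_minus' _ _ _ _
                 (is_lim_seq_const (u M)) EX)).
  assert (W : eventually (fun n => Rabs (u M - u n) <= K * npow d M)).
  { exists M; intros n Hn; rewrite Rabs_minus_sym; apply H; lia. }
  exact (is_lim_seq_le_loc (fun n => Rabs (u M - u n)) (fun _ => K * npow d M)
           (Finite (Rabs (u M - Lim_seq u))) (Finite (K * npow d M)) W L (is_lim_seq_const _)).
Qed.

(** The limit is written down pointwise with the total function [Lim_seq], so it needs no choice.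
    The factor [2] comes from adding the two components. *)
Lemma cauchy_limit (F : nat -> R -> C) (K d : R) : d < 0 ->
  (forall M N x, (1 <= M <= N)%nat -> Cmod (F N x - F M x)%C <= K * npow d M) ->
  exists f, forall M x, (1 <= M)%nat -> Cmod (f x - F M x)%C <= 2 * K * npow d M.
Proof.
  intros Hd H.
  exists (fun x => (real (Lim_seq (fun n => Re (F n x))),
                    real (Lim_seq (fun n => Im (F n x))))).
  intros M x HM.
  assert (A := cauchy_limit_R (fun n => Re (F n x)) K d Hd (fun M N MN =>
     Rle_trans _ _ _ (re_le_Cmod (F N x - F M x)%C) (H M N x MN)) M HM).
  assert (B := cauchy_limit_R (fun n => Im (F n x)) K d Hd (fun M N MN =>
     Rle_trans _ _ _ (im_le_Cmod (F N x - F M x)%C) (H M N x MN)) M HM).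
  eapply Rle_trans; [apply Cmod_le_sum|].
  cbv beta in A, B; simpl; unfold Rminus in A, B; unfold Re, Im in *; simpl; lra.
Qed.

Lemma uniform_cvg_ccont (F : nat -> R -> C) (f : R -> C) : (forall n, ccont (F n)) ->
  uniform_cvg F f -> ccont f.
Proof.
  intros HF Hu.
  assert (L : forall h : C -> R, (forall z w, Rabs (h z - h w) <= Cmod (z - w)%C) ->
    (forall n x, continuous (fun y => h (F n y)) x) ->
    forall x, continuous (fun y => h (f y)) x).
  { intros h Hh Hc x; apply continuity_pt_filterlim.
    apply (CVU_continuity (fun n y => h (F n y)) (fun y => h (f y)) x (mkposreal 1 Rlt_0_1)).
    - intros eps He; destruct (Hu eps He) as [N HN]; exists N; intros n y Hn _.
      rewrite Rabs_minus_sym; eapply Rle_lt_trans; [apply Hh | now apply HN].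
    - intros n y _; apply continuity_pt_filterlim, Hc.
    - apply Boule_center. }
  intros x; split; [apply (L Re) | apply (L Im)].
  - intros z w; exact (re_le_Cmod (z - w)%C).
  - intros n y; apply (HF n y).
  - intros z w; exact (im_le_Cmod (z - w)%C).
  - intros n y; apply (HF n y).
Qed.

(** The real theorem on differentiating a limit is applied to [h] composed with the sequence, for
    the contractions [h = Re] and [h = Im]. *)
Lemma uniform_cvg_cder (F G : nat -> R -> C) (f g : R -> C) : (forall n, cder (F n) (G n)) ->
  (forall n, ccont (G n)) -> uniform_cvg F f -> uniform_cvg G g -> cder f g.
Proof.
  intros HF HG Hf Hg; assert (Cg := uniform_cvg_ccont G g HG Hg).
  assert (L : forall h : C -> R, (forall z w, Rabs (h z - h w) <= Cmod (z - w)%C) ->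
    (forall n x, is_derive (fun y => h (F n y)) x (h (G n x))) ->
    (forall x, continuous (fun y => h (g y)) x) ->
    forall x, is_derive (fun y => h (f y)) x (h (g x))).
  { intros h Hh Hd Hc x; apply is_derive_Reals.
    apply (Ranalysis5.derivable_pt_lim_CVU (fun n y => h (F n y)) (fun n y => h (G n y))
             (fun y => h (f y)) (fun y => h (g y)) x x (mkposreal 1 Rlt_0_1)).
    - apply Boule_center.
    - intros y n _; apply is_derive_Reals, Hd.
    - intros y _ eps He; destruct (Hf eps He) as [N HN]; exists N; intros n Hn.
      unfold R_dist; eapply Rle_lt_trans; [apply Hh | now apply HN].
    - intros eps He; destruct (Hg eps He) as [N HN]; exists N; intros n y Hn _.
      rewrite Rabs_minus_sym; eapply Rle_lt_trans; [apply Hh | now apply HN].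
    - intros y _; apply continuity_pt_filterlim, Hc. }
  intros x; split; [apply (L Re) | apply (L Im)].
  - intros z w; exact (re_le_Cmod (z - w)%C).
  - intros n y; apply (HF n y).
  - intros y; apply (Cg y).
  - intros z w; exact (im_le_Cmod (z - w)%C).
  - intros n y; apply (HF n y).
  - intros y; apply (Cg y).
Qed.

Lemma filterlim_Cmod (u : nat -> C) (l : C) :
  (forall eps, 0 < eps -> exists N, forall n, (N <= n)%nat -> Cmod (u n - l)%C < eps) ->
  filterlim u eventually (locally l).
Proof.
  intros H; apply filterlim_locally; intros [eps He].
  destruct (H eps He) as [N HN]; exists N; intros n Hn; assert (A := HN n Hn).
  split.
  - exact (Rle_lt_trans _ _ _ (re_le_Cmod (u n - l)%C) A).
  - exact (Rle_lt_trans _ _ _ (im_le_Cmod (u n - l)%C) A).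
Qed.

Lemma uniform_cvg_cvg_distr (F : nat -> R -> C) (f : R -> C) : (forall n, ccont (F n)) ->
  uniform_cvg F f -> cvg_distr F (distr_of_fun f).
Proof.
  intros HF Hu phi Ht; assert (Cf := uniform_cvg_ccont F f HF Hu).
  destruct (test_radius phi Ht) as [A [A0 HA]].
  assert (Cp := test_ccont phi 0 Ht); rewrite Cderive_n_0 in Cp.
  destruct (supported_bounded phi A A0 Cp HA) as [M [M0 HM]].
  apply filterlim_Cmod; intros eps He.
  (* A uniform error [dl] changes the pairing by at most [4 * A * M * dl]: length [2 * A], bound [M]
     for [phi], and [2] from the components. The added ones exclude a zero denominator and give
     strictness. *)
  assert (D0 : 0 < 4 * (A + 1) * (M + 1)) by nra.
  destruct (Hu (eps / (4 * (A + 1) * (M + 1)))) as [N HN];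
    [now apply Rdiv_lt_0_compat|].
  exists N; intros n Hn.
  rewrite (distr_of_fun_cint (F n) phi A), (distr_of_fun_cint f phi A) by auto.
  rewrite <- cint_minus by (apply ccont_mult; auto).
  set (dl := eps / (4 * (A + 1) * (M + 1))) in *.
  assert (dl0 : 0 < dl) by now apply Rdiv_lt_0_compat.
  eapply Rle_lt_trans.
  - apply (cint_le_const _ (dl * M)); [lra | apply ccont_minus; apply ccont_mult; auto|].
    intros x _; replace (F n x * phi x - f x * phi x)%C with ((F n x - f x) * phi x)%C by ring.
    rewrite Cmod_mult; apply Rmult_le_compat; try apply Cmod_ge_0; [|apply HM].
    now apply Rlt_le, HN.
  - replace eps with (4 * (A + 1) * (M + 1) * dl) by (unfold dl; field; lra).
    assert (0 <= A * M) by nra; nra.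
Qed.

(** Comparison of [f] with its approximant of order [N], where [N] is about
    [1 / |x - y|]. *)
Lemma holder_limit (F F' : nat -> R -> C) (f : R -> C) (b K1 K2 : R) : 0 < b < 1 ->
  0 <= K1 -> 0 <= K2 ->
  (forall M, cder (F M) (F' M)) -> (forall M, ccont (F' M)) ->
  (forall M x, (1 <= M)%nat -> Cmod (f x - F M x)%C <= K1 * npow (- b) M) ->
  (forall M x, (1 <= M)%nat -> Cmod (F' M x) <= K2 * npow (1 - b) M) ->
  forall x y, x <> y -> Rabs (x - y) <= 1 ->
    Cmod (f x - f y)%C <= (4 * K1 + 2 * K2) * Rpower (Rabs (x - y)) b.
Proof.
  intros Hb K10 K20 HF HC H1 H2 x y xy Hd; set (d := Rabs (x - y)) in *.
  assert (d0 : 0 < d) by (apply Rabs_pos_lt; lra).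
  (* [N] is the integer part of [1/d]; [d <= 1] makes it at least [1], whence
     [1/d < N + 1 <= 2 N]. *)
  assert (EN : exists N, (1 <= N)%nat /\ INR N * d <= 1 < 2 * (INR N * d)).
  { assert (i1 : 1 <= / d) by (rewrite <- Rinv_1; apply Rinv_le_contravar; lra).
    assert (id : / d * d = 1) by (field; lra).
    destruct (nfloor_ex (/ d)) as [N [Ha Hb']]; [lra|].
    assert (N0 : (1 <= N)%nat).
    { destruct N; [simpl in Hb'; lra | lia]. }
    assert (N1 := INR_ge_1 N N0); exists N; split; [assumption|]; split; nra. }
  destruct EN as [N [N1 [Nd dN]]].
  assert (NR := INR_ge_1 N N1).
  assert (B1 : npow (- b) N <= 2 * Rpower d b).
  { unfold npow; rewrite Rpower_Ropp.
    assert (P : Rpower (/ (2 * d)) b <= Rpower (INR N) b).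
    { apply Rle_Rpower_l; [lra|]; split; [apply Rinv_0_lt_compat; lra|].
      apply (Rmult_le_reg_r (2 * d)); [lra|]; rewrite Rinv_l by lra; lra. }
    apply Rle_trans with (/ Rpower (/ (2 * d)) b).
    - apply Rinv_le_contravar; [apply exp_pos | exact P].
    - assert (I : Rpower (/ (2 * d)) b = / Rpower (2 * d) b).
      { rewrite <- (Rpower_1 (2 * d)) at 1 by lra.
        rewrite <- Rpower_Ropp, Rpower_mult, <- Rpower_Ropp; f_equal; ring. }
      rewrite I, Rinv_inv, <- Rpower_mult_distr by lra.
      apply Rmult_le_compat_r; [apply Rlt_le, exp_pos|].
      rewrite <- (Rpower_1 2) at 2 by lra; apply Rle_Rpower; lra. }
  (* Here [d * N ^ (1 - b) = d ^ b * (N d) ^ (1 - b)] and [N d <= 1]. *)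
  assert (B2 : d * npow (1 - b) N <= Rpower d b).
  { assert (P : npow (1 - b) N * Rpower d (1 - b) <= 1).
    { unfold npow; rewrite Rpower_mult_distr by lra.
      apply Rle_trans with (Rpower 1 (1 - b)).
      - apply Rle_Rpower_l; [lra|]; split; [nra | lra].
      - unfold Rpower; rewrite ln_1, Rmult_0_r, exp_0; lra. }
    rewrite <- (Rpower_1 d) at 1 by lra; replace 1 with (b + (1 - b)) at 1 by ring.
    rewrite Rpower_plus; assert (Q : 0 < Rpower d b) by apply exp_pos; nra. }
  assert (MV : forall u v, u <= v -> Cmod (F N v - F N u)%C <=
     2 * ((v - u) * (K2 * npow (1 - b) N))).
  { intros u v uv; rewrite <- (cint_cder _ _ u v (HF N) (HC N)).
    apply cint_le_const; [assumption | apply HC|]; intros t _; now apply H2. }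
  assert (MV' : Cmod (F N x - F N y)%C <= 2 * (d * (K2 * npow (1 - b) N))).
  { unfold d; destruct (Rle_dec x y) as [l|l].
    - replace (F N x - F N y)%C with (- (F N y - F N x))%C by ring; rewrite Cmod_opp.
      replace (Rabs (x - y)) with (y - x) by (rewrite Rabs_left1; lra); now apply MV.
    - replace (Rabs (x - y)) with (x - y) by (rewrite Rabs_right; lra); apply MV; lra. }
  replace (f x - f y)%C with (((f x - F N x) - (f y - F N y)) + (F N x - F N y))%C by ring.
  eapply Rle_trans; [apply Cmod_triangle|].
  assert (T := Cmod_minus_le (f x - F N x)%C (f y - F N y)%C).
  assert (A1 := H1 N x N1); assert (A2 := H1 N y N1).
  assert (D1 : K1 * npow (- b) N <= K1 * (2 * Rpower d b)) by now apply Rmult_le_compat_l.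
  assert (D2 : K2 * (d * npow (1 - b) N) <= K2 * Rpower d b) by now apply Rmult_le_compat_l.
  lra.
Qed.

Lemma holder_of_exponent (a b K : R) (f : R -> C) : 0 <= a < b -> b < 1 -> ccont f ->
  (forall x y, x <> y -> Rabs (x - y) <= 1 ->
    Cmod (f x - f y)%C <= K * Rpower (Rabs (x - y)) b) -> holder a f.
Proof.
  intros Hab Hb Cf H; destruct (Req_dec a 0) as [->|an].
  - left; split; [easy|]; now apply ccont_continuous.
  - right; split; [lra|]; intros A.
    destruct (ccont_bounded f (- Rabs A) (Rabs A)) as [M [M0 HM]];
      [generalize (Rabs_pos A); lra | assumption|].
    assert (K0 := Rabs_pos K).
    (* [Rabs K] covers points at distance at most [1], [2 * M] covers the others, and the final [1]
       yields the strict inequality in [holder]. *)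
    exists (Rabs K + 2 * M + 1); split; [lra|]; intros x y Hx Hy xy.
    assert (d0 : 0 < Rabs (x - y)) by (apply Rabs_pos_lt; lra).
    set (d := Rabs (x - y)) in *; assert (Q : 0 < Rpower d a) by apply exp_pos.
    destruct (Rle_dec d 1) as [d1|d1].
    + assert (P : Rpower d b <= Rpower d a).
      { unfold Rpower; apply exp_mono.
        assert (ln d <= 0) by (rewrite <- ln_1; apply ln_le; lra); nra. }
      assert (E := H x y xy d1); fold d in E.
      assert (W : 0 < Rpower d b) by apply exp_pos.
      assert (B := Rle_abs K); nra.
    + assert (P : 1 <= Rpower d a).
      { unfold Rpower; rewrite <- exp_0; apply exp_mono.
        assert (0 <= ln d) by (rewrite <- ln_1; apply ln_le; lra); nra. }
      assert (RA := Rle_abs A).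
      assert (E1 := HM x ltac:(apply Rabs_le_between; lra)).
      assert (E2 := HM y ltac:(apply Rabs_le_between; lra)).
      assert (D := Cmod_minus_le (f x) (f y)); nra.
Qed.

(** * From partial sums to Hölder regularity *)

Lemma weighted_weighted (a : nat -> C) (r t : C) (n : nat) :
  weighted (weighted a r) t n = weighted a (r + t)%C n.
Proof. unfold weighted; rewrite Rcpower_plus; ring. Qed.

(** Up to a constant on each half-line, [d n = c n * |n| ^ r]. *)
Definition scaled (c d : Z -> C) (r : R) : Prop :=
  d 0%Z = RtoC 0 /\
  forall s, is_sign s -> exists z, forall n, (1 <= n)%nat ->
    side s d n = (z * weighted (side s c) (RtoC r) n)%C.

Lemma scaled_refl (c : Z -> C) : c 0%Z = RtoC 0 -> scaled c c 0.
Proof.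
  intros H; split; [assumption|]; intros s _; exists (RtoC 1); intros n Hn.
  unfold weighted; rewrite Rcpower_real, Rpower_O; [ring|].
  assert (A := INR_ge_1 n Hn); lra.
Qed.

Lemma scaled_dcoef (c d : Z -> C) (r : R) (p : nat) :
  scaled c d r -> scaled c (dcoef p d) (r + INR p).
Proof.
  intros [H0 H]; split; [now apply dcoef_zero|]; intros s Hs.
  destruct (H s Hs) as [z Hz].
  exists ((0, 2 * PI * IZR s)%R ^ p * z)%C; intros n Hn.
  rewrite side_dcoef, Hz, INR_pow_Rcpower by assumption.
  unfold weighted; rewrite RtoC_plus, Rcpower_plus; ring.
Qed.

(** Coefficients of a [p]-fold primitive. At [n = 0] with [p > 0] the divisor is zero, and the
    quotient is still [0] when [c 0] is. *)
Definition icoef (p : nat) (c : Z -> C) (n : Z) : C := (c n / (0, 2 * PI * IZR n)%R ^ p)%C.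

Lemma dcoef_icoef (p : nat) (c : Z -> C) : c 0%Z = RtoC 0 -> dcoef p (icoef p c) = c.
Proof.
  intros H; apply functional_extensionality; intros n; unfold dcoef, icoef.
  destruct (Z.eq_dec n 0) as [->|Hn]; [rewrite H; unfold Cdiv; ring|].
  field; apply Cpow_nz, imag_neq_0.
  assert (IZR n <> 0) by now apply eq_IZR_contrapositive.
  assert (P := PI_RGT_0); apply Rmult_integral_contrapositive; split; lra.
Qed.

Lemma scaled_icoef (c : Z -> C) (p : nat) :
  c 0%Z = RtoC 0 -> scaled c (icoef p c) (- INR p).
Proof.
  intros H; split; [unfold icoef; rewrite H; unfold Cdiv; ring|]; intros s Hs.
  set (w := ((0, 2 * PI * IZR s)%R ^ p)%C).
  assert (w0 : w <> RtoC 0) by now apply Cpow_nz, sign_freq_neq_0.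
  exists (/ w)%C; intros n Hn; assert (A := INR_ge_1 n Hn).
  assert (E := side_dcoef s p (icoef p c) n); rewrite dcoef_icoef in E by assumption.
  fold w in E; unfold weighted; rewrite E, INR_pow_Rcpower by assumption.
  set (u := side s (icoef p c) n).
  transitivity (u * (Rcpower (INR n) (RtoC (INR p)) * Rcpower (INR n) (RtoC (- INR p))))%C.
  - rewrite <- Rcpower_plus, <- RtoC_plus, Rplus_opp_r, Rcpower_real, Rpower_O by lra; ring.
  - field; exact w0.
Qed.

(** The exponent is normalised so that a change of the weight [r] leaves [alpha] unchanged: [alpha]
    measures the order of smoothness of the unweighted series. *)
Definition growth (s : Z) (a : nat -> C) (alpha : R) (r : C) : Prop :=
  obound s (weighted a r) (Re r - alpha).

Lemma two_sided_growth (c d : Z -> C) (b r : R) (k : nat) : scaled c d r -> b < r ->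
  (forall s, is_sign s -> growth s (side s c) b (RtoC (INR k))) ->
  exists K, 0 <= K /\ forall N x, (1 <= N)%nat ->
    Cmod (two_sided_sum d N x) <= K * npow (r - b) N.
Proof.
  intros [d0 Hd] Hb HB.
  assert (Q : forall s, is_sign s -> obound s (side s d) (r - b)).
  { intros s Hs; destruct (Hd s Hs) as [z Hz].
    apply (obound_scal s z _ _ _ Hz).
    assert (A0 : 0 < Re (RtoC (INR k)) - b + Re (RtoC (r - INR k))) by (simpl; lra).
    assert (A := obound_weighted s _ _ _ A0 (HB s Hs)).
    replace (r - b) with (Re (RtoC (INR k)) - b + Re (RtoC (r - INR k))) by (simpl; ring).
    apply (obound_scal s (RtoC 1)) with (2 := A); intros n _.
    rewrite weighted_weighted, <- RtoC_plus, Cmult_1_l; do 2 f_equal; ring. }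
  destruct (Q 1%Z (or_introl eq_refl)) as [K1 H1].
  destruct (Q (-1)%Z (or_intror eq_refl)) as [K2 H2].
  assert (P : forall N x, (1 <= N)%nat ->
    Cmod (two_sided_sum d N x) <= (K1 + K2) * npow (r - b) N).
  { intros N x HN; rewrite two_sided_osum, d0, Cplus_0_l.
    eapply Rle_trans; [apply Cmod_triangle|]; rewrite Rmult_plus_distr_r.
    apply Rplus_le_compat; auto. }
  exists (K1 + K2); split; [|exact P].
  assert (A := P 1%nat 0 (le_n _)); rewrite npow_1 in A.
  generalize (Cmod_ge_0 (two_sided_sum d 1 0)); lra.
Qed.

(** A weight [r] below the order [b] puts Abel summation in its decaying regime, so the partial sums
    are uniformly Cauchy with an explicit rate. The rate, not mere convergence, is what Hölder
    continuity is read from. *)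
Lemma two_sided_limit (c d : Z -> C) (b r : R) (k : nat) : scaled c d r -> r < b ->
  (forall s, is_sign s -> growth s (side s c) b (RtoC (INR k))) ->
  exists f K, 0 <= K /\ forall M x, (1 <= M)%nat ->
    Cmod (f x - two_sided_sum d M x)%C <= K * npow (r - b) M.
Proof.
  intros [d0 Hd] Hb HB.
  assert (Q : forall s, is_sign s -> exists K, forall M N x, (1 <= M <= N)%nat ->
    Cmod (osum s (side s d) N x - osum s (side s d) M x)%C <= K * npow (r - b) M).
  { intros s Hs; destruct (Hd s Hs) as [z Hz]; destruct (HB s Hs) as [K HK].
    assert (A0 : Re (RtoC (INR k)) - b + Re (RtoC (r - INR k)) < 0) by (simpl; lra).
    destruct (abel_tail s _ _ K _ A0 HK) as [K' HK'].
    exists (Cmod z * K'); intros M N x MN.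
    assert (E : forall N, osum s (side s d) N x =
      (z * osum s (weighted (weighted (side s c) (RtoC (INR k))) (RtoC (r - INR k))) N x)%C).
    { intros n; rewrite <- osum_scal; apply osum_ext; intros m Hm.
      rewrite (Hz m Hm), weighted_weighted, <- RtoC_plus; do 3 f_equal; ring. }
    rewrite !E.
    match goal with |- Cmod (z * ?u - z * ?v)%C <= _ =>
      replace (z * u - z * v)%C with (z * (u - v))%C by ring end.
    rewrite Cmod_mult, Rmult_assoc; apply Rmult_le_compat_l; [apply Cmod_ge_0|].
    replace (r - b) with (Re (RtoC (INR k)) - b + Re (RtoC (r - INR k))) by (simpl; ring).
    now apply HK'. }
  destruct (Q 1%Z (or_introl eq_refl)) as [K1 H1].
  destruct (Q (-1)%Z (or_intror eq_refl)) as [K2 H2].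
  destruct (cauchy_limit (two_sided_sum d) (K1 + K2) (r - b)) as [f Hf]; [lra| |].
  - intros M N x MN; rewrite !two_sided_osum, d0, !Cplus_0_l.
    match goal with |- Cmod (?u + ?v - (?u' + ?v'))%C <= _ =>
      replace (u + v - (u' + v'))%C with ((u - u') + (v - v'))%C by ring end.
    eapply Rle_trans; [apply Cmod_triangle|]; rewrite Rmult_plus_distr_r.
    apply Rplus_le_compat; auto.
  - exists f, (2 * (K1 + K2)); split; [|exact Hf].
    assert (A := Hf 1%nat 0 (le_n _)); rewrite npow_1 in A.
    generalize (Cmod_ge_0 (f 0 - two_sided_sum d 1 0)%C); lra.
Qed.

Lemma cder_two_sided_1 (d : Z -> C) (N : nat) :
  cder (two_sided_sum d N) (two_sided_sum (dcoef 1 d) N).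
Proof. rewrite <- (dcoef_0 d) at 1; apply cder_two_sided. Qed.

(** The condition [0 < b - r < 1] places the series in the convergent regime, with error
    [N ^ (r - b)], and its term-by-term derivative in the growing one, with size [N ^ (r + 1 - b)].
    Balancing the two gives the exponent [b - r]. *)
Lemma limit_holder (c d : Z -> C) (a b r : R) (k : nat) : scaled c d r ->
  0 <= a < b - r -> b - r < 1 ->
  (forall s, is_sign s -> growth s (side s c) b (RtoC (INR k))) ->
  exists f, uniform_cvg (two_sided_sum d) f /\ holder a f.
Proof.
  intros Hd Ha Hb HB.
  destruct (two_sided_limit c d b r k Hd ltac:(lra) HB) as [f [K1 [K10 H1]]].
  assert (Hd' := scaled_dcoef c d r 1 Hd); simpl (INR 1) in Hd'.
  destruct (two_sided_growth c _ b (r + 1) k Hd' ltac:(lra) HB) as [K2 [K20 H2]].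
  assert (U : uniform_cvg (two_sided_sum d) f)
    by (apply (uniform_cvg_rate _ f K1 (r - b)); [lra | exact H1]).
  exists f; split; [exact U|].
  apply (holder_of_exponent a (b - r) (4 * K1 + 2 * K2)); [lra | assumption | |].
  - exact (uniform_cvg_ccont _ _ (ccont_two_sided d) U).
  - apply (holder_limit (two_sided_sum d) (two_sided_sum (dcoef 1 d)) f);
      try assumption; [lra | apply cder_two_sided_1 | apply ccont_two_sided | |].
    + intros M x HM; replace (- (b - r)) with (r - b) by ring; now apply H1.
    + intros M x HM; replace (1 - (b - r)) with (r + 1 - b) by ring; now apply H2.
Qed.

Lemma uniform_cvg_unique (F : nat -> R -> C) (f g : R -> C) :
  uniform_cvg F f -> uniform_cvg F g -> f = g.
Proof.
  intros Hf Hg; apply functional_extensionality; intros x.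
  destruct (Req_dec (Cmod (f x - g x)%C) 0) as [E|E].
  - apply Cmod_eq_0 in E; transitivity (f x - g x + g x)%C; [ring | rewrite E; ring].
  - exfalso; assert (P : 0 < Cmod (f x - g x)%C / 2)
      by (generalize (Cmod_ge_0 (f x - g x)%C); lra).
    destruct (Hf _ P) as [N1 H1], (Hg _ P) as [N2 H2].
    assert (A1 := H1 (N1 + N2)%nat x ltac:(lia)).
    assert (A2 := H2 (N1 + N2)%nat x ltac:(lia)).
    assert (T := Cmod_minus_le (F (N1 + N2)%nat x - g x)%C (F (N1 + N2)%nat x - f x)%C).
    replace (F (N1 + N2)%nat x - g x - (F (N1 + N2)%nat x - f x))%C with (f x - g x)%C
      in T by ring.
    lra.
Qed.

Lemma cder_Cderive_n_eq (f g : R -> C) (n : nat) : cder (Cderive_n f n) g ->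
  (forall x, ex_Cderive_n f (S n) x) /\ Cderive_n f (S n) = g.
Proof.
  intros H; split.
  - intros x; destruct (H x); split; simpl; eexists; eassumption.
  - apply functional_extensionality; intros x; destruct (H x) as [H1 H2].
    apply C_ext; simpl; apply is_derive_unique; assumption.
Qed.

Lemma uniform_cvg_derivatives (d : Z -> C) (f : R -> C) (j : nat) :
  (forall i, (i <= j)%nat -> exists g, uniform_cvg (two_sided_sum (dcoef i d)) g) ->
  uniform_cvg (two_sided_sum d) f ->
  (forall i x, (i <= j)%nat -> ex_Cderive_n f i x) /\
  uniform_cvg (two_sided_sum (dcoef j d)) (Cderive_n f j).
Proof.
  intros H Hf; induction j as [|j IH].
  - rewrite Cderive_n_0, dcoef_0; split; [|assumption].
    intros i x Hi; replace i with 0%nat by lia; easy.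
  - destruct (IH (fun i Hi => H i ltac:(lia))) as [E U].
    destruct (H (S j) (le_n _)) as [g Hg].
    destruct (cder_Cderive_n_eq f g j) as [EX ->].
    + exact (uniform_cvg_cder _ _ _ _ (cder_two_sided d j) (ccont_two_sided _) U Hg).
    + split; [|assumption]; intros i x Hi.
      destruct (Nat.eq_dec i (S j)) as [->|ne]; [apply EX | apply E; lia].
Qed.

(** Besides membership in the space, the conclusion exhibits the limit as a derivative of a
    continuous function, because this is the form from which a [distribution] is built. *)
Lemma synthesis_C_space (c : Z -> C) (b beta : R) (k : nat) :
  c 0%Z = RtoC 0 -> beta < b ->
  (forall s, is_sign s -> forall b', b' <= b -> growth s (side s c) b' (RtoC (INR k))) ->
  exists j f, ccont f /\ cvg_distr (two_sided_sum c) (distr_deriv j (distr_of_fun f)) /\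
    C_space beta (distr_deriv j (distr_of_fun f)).
Proof.
  intros c0 Hb HB0.
  destruct (base_fp beta) as [F1 F2]; unfold frac_part in F1, F2.
  set (n := Int_part beta) in *; set (a := beta - IZR n) in *.
  (* The distance from [beta] to the next integer is [1 - a]. Going at most half way keeps [b']
     above [beta] and [b' - n] below [1]; lowering [b] is allowed since the bounds are assumed for
     all smaller orders. *)
  set (b' := Rmin b (beta + (1 - a) / 2)).
  assert (Hb1 : b' <= b) by apply Rmin_l.
  assert (Hb2 : beta < b') by (apply Rmin_glb_lt; lra).
  assert (Hb3 : b' <= beta + (1 - a) / 2) by apply Rmin_r.
  assert (HB := fun s Hs => HB0 s Hs b' Hb1).
  destruct (Z_le_gt_dec 0 n) as [n0|n0].
  - set (j := Z.to_nat n).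
    assert (En : IZR n = INR j) by (unfold j; rewrite INR_IZR_INZ, Z2Nat.id; auto).
    assert (Sc : forall i, scaled c (dcoef i c) (INR i)).
    { intros i; rewrite <- (Rplus_0_l (INR i)); apply scaled_dcoef; now apply scaled_refl. }
    destruct (limit_holder c _ a b' (INR j) k (Sc j)) as [g [Ug Hg]];
      [unfold a in *; lra | unfold a in *; lra | exact HB |].
    assert (L : forall i, (i <= j)%nat -> exists g, uniform_cvg (two_sided_sum (dcoef i c)) g).
    { intros i Hi; assert (ij : INR i <= INR j) by now apply le_INR.
      destruct (two_sided_limit c _ b' (INR i) k (Sc i)) as [f [K [_ H]]];
        [unfold a in *; lra | exact HB |].
      exists f; apply (uniform_cvg_rate _ f K (INR i - b')); [unfold a in *; lra | exact H]. }
    destruct (L 0%nat ltac:(lia)) as [f Uf]; rewrite dcoef_0 in Uf.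
    destruct (uniform_cvg_derivatives c f j L Uf) as [EX U].
    (* The Hölder limit of the [j] times differentiated series is identified with the [j]-th
       derivative of the limit [f]. *)
    rewrite <- (uniform_cvg_unique _ _ _ U Ug) in Hg.
    assert (E0 : distr_eq (distr_deriv 0 (distr_of_fun f)) (distr_of_fun f)).
    { intros phi Ht; unfold distr_deriv; rewrite Cderive_n_0; simpl; ring. }
    exists 0%nat, f; split; [exact (uniform_cvg_ccont _ _ (ccont_two_sided c) Uf)|]; split.
    + intros phi Ht; rewrite (E0 phi Ht).
      now apply (uniform_cvg_cvg_distr _ _ (ccont_two_sided c) Uf).
    + exists a, j, f; split; [unfold a in *; lra|]; left.
      split; [unfold a; lra|]; split; [exact EX|]; split; [exact Hg | exact E0].
  (* For negative order the series is integrated [j] times, which brings it to the order [a] in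
     [[0, 1)], and the distribution is the [j]-th derivative of the function obtained. *)
  - set (j := Z.to_nat (- n)).
    assert (En : IZR n = - INR j).
    { unfold j; rewrite INR_IZR_INZ, Z2Nat.id, opp_IZR by lia; ring. }
    destruct (limit_holder c _ a b' (- INR j) k (scaled_icoef c j c0)) as [f [Uf Hf]];
      [unfold a in *; lra | unfold a in *; lra | exact HB |].
    exists j, f; split; [exact (uniform_cvg_ccont _ _ (ccont_two_sided _) Uf)|]; split.
    + rewrite <- (dcoef_icoef j c c0) at 1; apply cvg_deriv.
      exact (uniform_cvg_cvg_distr _ _ (ccont_two_sided _) Uf).
    + exists a, j, f; split; [unfold a in *; lra|]; right.
      split; [unfold a; lra|]; split; [exact Hf | now intros phi _].
Qed.

(** On a bounded interval the functional is controlled by the supremum of the [j]-th derivative of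
    the test function, so it has order at most [j] there, with a constant given by a bound of
    [f]. *)
Lemma distribution_deriv (f : R -> C) (j : nat) : ccont f ->
  exists T : distribution, distr T = distr_deriv j (distr_of_fun f).
Proof.
  intros Cf; set (D := distr_deriv j (distr_of_fun f)).
  assert (EQ : forall phi A, 0 <= A -> test_function phi -> supported_in A phi ->
    D phi = (RtoC ((-1) ^ j) * cint (fun x => f x * Cderive_n phi j x) (- A) A)%C).
  { intros phi A A0 Ht HA; unfold D, distr_deriv; f_equal.
    apply distr_of_fun_cint; try assumption;
      [now apply test_ccont | now apply test_supported]. }
  assert (P1 : forall phi psi, test_function phi -> test_function psi ->
    D (fun x => phi x + psi x)%C = (D phi + D psi)%C).
  { intros phi psi H1 H2; assert (H3 := test_plus _ _ H1 H2).
    destruct (test_radius _ H1) as [A [A0 HA]], (test_radius _ H2) as [B [B0 HB]].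
    assert (HA' := supported_in_le A (A + B) _ ltac:(lra) HA).
    assert (HB' := supported_in_le B (A + B) _ ltac:(lra) HB).
    rewrite !(EQ _ (A + B)); try assumption; try lra.
    2: { intros x Hx; rewrite HA', HB' by assumption; ring. }
    rewrite (Cderive_n_plus j) by (apply Csmooth_all; first [apply H1 | apply H2]).
    rewrite <- Cmult_plus_distr_l; f_equal.
    rewrite <- cint_plus by (apply ccont_mult; [assumption | now apply test_ccont]).
    apply cint_conv, functional_extensionality; intros x; ring. }
  assert (P2 : forall (a : C) phi, test_function phi ->
    D (fun x => a * phi x)%C = (a * D phi)%C).
  { intros a phi H1; assert (H2 := test_scal a _ H1).
    destruct (test_radius _ H1) as [A [A0 HA]].
    rewrite !(EQ _ A); try assumption.
    2: { intros x Hx; rewrite HA by assumption; ring. }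
    rewrite (Cderive_n_scal j) by (apply Csmooth_all, H1).
    rewrite Cmult_assoc, (Cmult_comm a), <- Cmult_assoc; f_equal.
    rewrite <- cint_scal by (apply ccont_mult; [assumption | now apply test_ccont]).
    apply cint_conv, functional_extensionality; intros x; ring. }
  assert (P3 : forall A : R, exists (m : nat) (K : R),
    forall (phi : R -> C) (b : R), test_function phi -> supported_in A phi ->
      (forall j x, (j <= m)%nat -> Cmod (Cderive_n phi j x) <= b) ->
      Cmod (D phi) <= K * b).
  (* The radius [A] in the definition may be negative, whereas the integral is taken over
     [[-B, B]]. *)
  { intros A; set (B := Rmax A 0).
    assert (B0 : 0 <= B) by apply Rmax_r.
    destruct (ccont_bounded f (- B) B ltac:(lra) Cf) as [M [M0 HM]].
    exists j, (2 * ((B - - B) * M)); intros phi b Ht HA Hb.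
    rewrite (EQ phi B B0 Ht (supported_in_le A B _ (Rmax_l _ _) HA)).
    rewrite Cmod_mult, Cmod_R, pow_1_abs, Rmult_1_l.
    replace (2 * ((B - - B) * M) * b) with (2 * ((B - - B) * (M * b))) by ring.
    apply cint_le_const; [lra | apply ccont_mult; [assumption | now apply test_ccont]|].
    intros x Hx; rewrite Cmod_mult; apply Rmult_le_compat; try apply Cmod_ge_0; auto. }
  now exists (Build_distribution D P1 P2 P3).
Qed.

Lemma cvg_distr_unique (F : nat -> R -> C) (T U : functional) :
  cvg_distr F T -> cvg_distr F U -> distr_eq T U.
Proof.
  intros HT HU phi Ht.
  exact (filterlim_locally_unique (K := C_AbsRing) (V := C_NormedModule)
           (F := eventually) _ _ _ (HT phi Ht) (HU phi Ht)).
Qed.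

Lemma C_space_distr_eq (beta : R) (T U : functional) : distr_eq T U ->
  C_space beta T -> C_space beta U.
Proof.
  intros E [a [k [f [Ha H]]]]; exists a, k, f; split; [assumption|].
  assert (S : forall V, distr_eq T V -> distr_eq U V)
    by (intros V HV phi Ht; rewrite <- (E phi Ht); now apply HV).
  destruct H as [[H1 [H2 [H3 H4]]]|[H1 [H2 H3]]]; [left | right]; auto.
Qed.

(** Each [beta] comes with its own representation of the limit. The distribution is built from one
    of them, at [beta = alpha - 1], and uniqueness of distributional limits transfers membership
    from all the others. *)
Lemma synthesis (c : Z -> C) (alpha : R) (k : nat) : c 0%Z = RtoC 0 ->
  (forall s, is_sign s -> forall b, b < alpha -> growth s (side s c) b (RtoC (INR k))) ->
  exists T : distribution, cvg_distr (two_sided_sum c) T /\ C_lt_space alpha T.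
Proof.
  intros c0 H.
  assert (W : forall beta, beta < alpha -> exists j f, ccont f /\
    cvg_distr (two_sided_sum c) (distr_deriv j (distr_of_fun f)) /\
    C_space beta (distr_deriv j (distr_of_fun f))).
  { intros beta Hb; apply (synthesis_C_space c ((beta + alpha) / 2) beta k c0); [lra|].
    intros s Hs b' Hb'; apply H; [assumption|lra]. }
  destruct (W (alpha - 1) ltac:(lra)) as [j [f [Cf [Hc _]]]].
  destruct (distribution_deriv f j Cf) as [T ET]; exists T; rewrite ET.
  split; [assumption|]; intros beta Hb.
  destruct (W beta Hb) as [j' [f' [_ [Hc' Hs]]]].
  exact (C_space_distr_eq _ _ _ (cvg_distr_unique _ _ _ Hc' Hc) Hs).
Qed.

(** * The equivalences *)

(** Only the exponent at the new weight [t] has to be positive; the old weight is arbitrary. The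
    step is therefore reversible between any two weights whose real parts exceed [b]. *)
Lemma growth_change (s : Z) (a : nat -> C) (b : R) (r t : C) : b < Re t ->
  growth s a b r -> growth s a b t.
Proof.
  intros Hb H; assert (A0 : 0 < Re r - b + Re (t - r)%C) by (simpl; unfold Re in *; lra).
  assert (A := obound_weighted s _ _ _ A0 H).
  unfold growth; replace (Re t - b) with (Re r - b + Re (t - r)%C)
    by (simpl; unfold Re; ring).
  apply (obound_scal s (RtoC 1)) with (2 := A); intros n _.
  rewrite weighted_weighted, Cmult_1_l; f_equal; ring.
Qed.

Lemma growth_of_C_lt_space (s : Z) (c : Z -> C) (T : functional) (alpha : R) (k : nat) :
  is_sign s -> c 0%Z = RtoC 0 -> alpha <= INR k ->
  cvg_distr (two_sided_sum c) T -> C_lt_space alpha T ->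
  forall b, b < alpha -> growth s (side s c) b (RtoC (INR k)).
Proof.
  intros Hs c0 Hk HT HC b Hb.
  assert (A := analysis s c T alpha (alpha - b) k Hs c0 ltac:(lra) Hk HT HC).
  unfold growth; replace (Re (RtoC (INR k)) - b) with (alpha - b + INR k - alpha)
    by (simpl; ring).
  apply (obound_scal s (RtoC 1)) with (2 := A); intros n Hn.
  unfold weighted; rewrite INR_pow_Rcpower by assumption; ring.
Qed.

Lemma osum_bounded (s : Z) (a : nat -> C) (N0 : nat) :
  exists B, 0 <= B /\ forall N x, (N <= N0)%nat -> Cmod (osum s a N x) <= B.
Proof.
  induction N0 as [|N0 [B [B0 HB]]].
  - exists 0; split; [lra|]; intros N x HN; replace N with 0%nat by lia.
    unfold osum; simpl; rewrite Cmod_0; lra.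
  - exists (B + Cmod (a (S N0))); assert (P := Cmod_ge_0 (a (S N0))).
    split; [lra|]; intros N x HN; destruct (Nat.eq_dec N (S N0)) as [->|ne].
    + rewrite osum_S; eapply Rle_trans; [apply Cmod_triangle|].
      rewrite Cmod_mult, Cmod_e, Rmult_1_r; assert (A := HB N0 x (le_n _)); lra.
    + assert (A := HB N x ltac:(lia)); lra.
Qed.

(** Since [0 <= g], [npow g N] is at least [1], and the sums with [N < N0], which are uniformly
    bounded, are absorbed into the constant. *)
Lemma obound_eventually (s : Z) (a : nat -> C) (g K : R) (N0 : nat) : 0 <= g ->
  (forall N x, (1 <= N)%nat -> (N0 <= N)%nat -> 0 <= x <= 1 ->
     Cmod (osum s a N x) <= K * npow g N) ->
  obound s a g.
Proof.
  intros Hg H; destruct (osum_bounded s a N0) as [B [B0 HB]].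
  apply (obound_unit_interval s a g (Rabs K + B)); intros N x HN Hx.
  assert (P : 1 <= npow g N).
  { replace 1 with (npow 0 N); [now apply npow_le|].
    apply Rpower_O; assert (A := INR_ge_1 N HN); lra. }
  assert (A := Rle_abs K); assert (A' := Rabs_pos K).
  destruct (Nat.le_gt_cases N0 N) as [HN0|HN0].
  - eapply Rle_trans; [now apply H|]; nra.
  - eapply Rle_trans; [apply HB; lia|]; nra.
Qed.

(** The one-sided sum of order [N] is the pairing of the two-sided sum of the same order with the
    undifferentiated probe, so the only loss is the [L^1] norm of the latter, at most a multiple of
    [N ^ eps]. *)
Lemma obound_two_sided (s : Z) (d : Z -> C) (g eps : R) : is_sign s -> d 0%Z = RtoC 0 ->
  0 <= g -> 0 < eps ->
  (exists K, eventually (fun N => forall x, Cmod (two_sided_sum d N x) <= K * npow g N)) ->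
  obound s (side s d) (g + eps).
Proof.
  intros Hs d0 Hg He [K [N0 HK]].
  destruct (probe_bound s 0 Hs) as [B1 [B10 HB1]].
  destruct (kernel_majorant_integral_bound eps He) as [B2 [B20 HB2]].
  apply (obound_eventually s _ _ (2 * (K * B1 * B2)) N0); [lra|].
  intros N x HN HN0 Hx; destruct (HB2 N x HN Hx) as [I [HI IB]].
  assert (Hp : ccont (probe s N x)) by (apply ccont_Csmooth; intros n; apply Csmooth_probe).
  rewrite <- (cint_two_sided_probe s d N N x Hs d0 (le_n _) Hx).
  assert (K0 : 0 <= K * npow g N).
  { eapply Rle_trans; [apply Cmod_ge_0 | apply (HK N HN0 0)]. }
  eapply Rle_trans.
  - apply (cint_le _ (fun y => (K * npow g N * B1) * kernel_majorant N (y - x)) _ _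
               ((K * npow g N * B1) * I));
      [lra | apply ccont_mult; [apply ccont_two_sided | exact Hp] | |].
    + intros y _; rewrite Cmod_mult, Rmult_assoc.
      apply Rmult_le_compat; try apply Cmod_ge_0; [now apply HK|].
      assert (A := HB1 N x y HN); rewrite Cderive_n_0 in A; simpl in A; lra.
    + now apply (is_RInt_scal (V := R_NormedModule)).
  - assert (P : 0 <= K * npow g N * B1) by now apply Rmult_le_pos.
    assert (Q := Rmult_le_compat_l _ _ _ P IB).
    rewrite npow_plus; lra.
Qed.

(** Extension by zero to the other half-line, by which the results on two-sided series apply to the
    positive and negative parts separately. *)
Definition one_sided (s : Z) (a : nat -> C) (n : Z) : C :=
  if Z.ltb 0 (s * n) then a (Z.to_nat (s * n)) else RtoC 0.

Lemma side_one_sided (s : Z) (a : nat -> C) (n : nat) : is_sign s -> (1 <= n)%nat ->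
  side s (one_sided s a) n = a n /\ side (- s) (one_sided s a) n = RtoC 0.
Proof.
  intros Hs Hn; unfold side, one_sided.
  replace (s * (s * Z.of_nat n))%Z with (Z.of_nat n) by (destruct Hs; subst s; lia).
  replace (s * (- s * Z.of_nat n))%Z with (- Z.of_nat n)%Z by (destruct Hs; subst s; lia).
  rewrite (proj2 (Z.ltb_lt 0 (Z.of_nat n))), (proj2 (Z.ltb_ge 0 (- Z.of_nat n))), Nat2Z.id
    by lia; easy.
Qed.

Lemma one_sided_0 (s : Z) (a : nat -> C) : one_sided s a 0%Z = RtoC 0.
Proof. unfold one_sided; now rewrite Z.mul_0_r. Qed.

Lemma two_sided_one_sided (s : Z) (a : nat -> C) : is_sign s ->
  two_sided_sum (one_sided s a) = osum s a.
Proof.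
  intros Hs; apply functional_extensionality; intros N.
  apply functional_extensionality; intros x.
  assert (A : osum s (side s (one_sided s a)) N x = osum s a N x)
    by (apply osum_ext; intros n Hn; now apply side_one_sided).
  assert (B : osum (- s) (side (- s) (one_sided s a)) N x = RtoC 0).
  { apply csum_zero; intros n Hn.
    rewrite (proj2 (side_one_sided s a n Hs ltac:(lia))); ring. }
  rewrite two_sided_osum, one_sided_0, <- A.
  destruct Hs; subst s; simpl (- _)%Z in B; rewrite B; ring.
Qed.

Lemma growth_ext (s : Z) (a a' : nat -> C) (b : R) (r : C) :
  (forall n, (1 <= n)%nat -> a' n = a n) -> growth s a b r -> growth s a' b r.
Proof.
  intros E; apply (obound_scal s (RtoC 1)); intros n Hn; unfold weighted.
  rewrite E by assumption; ring.
Qed.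

Lemma series_in_C_lt_growth (s : Z) (a : nat -> C) (alpha : R) (k : nat) :
  is_sign s -> alpha <= INR k ->
  series_in_C_lt alpha (osum s a) <->
  (forall b, b < alpha -> growth s a b (RtoC (INR k))).
Proof.
  intros Hs Hk; rewrite <- (two_sided_one_sided s a Hs); split.
  - intros [T [HT HC]] b Hb.
    apply (growth_ext s (side s (one_sided s a))).
    + intros n Hn; symmetry; now apply side_one_sided.
    + now apply (growth_of_C_lt_space s _ T alpha k Hs (one_sided_0 s a)).
  - intros H; apply (synthesis _ alpha k (one_sided_0 s a)); intros t Ht b Hb.
    assert (E : t = s \/ t = (- s)%Z) by (unfold is_sign in *; lia).
    destruct E as [-> | ->].
    + apply (growth_ext s a); [|now apply H].
      intros n Hn; now apply side_one_sided.
    (* On the opposite half-line all coefficients vanish, so the constant [0] is enough. *)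
    + exists 0; intros N x HN; rewrite Rmult_0_l; apply Req_le; unfold osum.
      rewrite (csum_zero _ N); [apply Cmod_0|].
      intros n Hn; unfold weighted.
      rewrite (proj2 (side_one_sided s a n Hs ltac:(lia))); ring.
Qed.

(** The two families correspond under [b = alpha - eps]. Passing from large [N] to all [N] uses that
    the exponent is nonnegative, which is where [alpha <= k] enters. *)
Lemma growth_iff_partial_sums (s : Z) (a : nat -> C) (alpha : R) (k : nat) :
  alpha <= INR k ->
  (forall b, b < alpha -> growth s a b (RtoC (INR k))) <->
  (forall eps, 0 < eps -> exists K, eventually (fun N => forall x,
     Cmod (osum s (fun n => a n * RtoC (INR n ^ k))%C N x)
       <= K * Rpower (INR N) (eps + INR k - alpha))).
Proof.
  intros Hk.
  assert (E : forall N x, osum s (fun n => a n * RtoC (INR n ^ k))%C N x =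
    osum s (weighted a (RtoC (INR k))) N x).
  { intros N x; apply osum_ext; intros n Hn; unfold weighted.
    now rewrite INR_pow_Rcpower. }
  split.
  - intros H eps He; destruct (H (alpha - eps) ltac:(lra)) as [K HK]; exists K, 1%nat.
    intros N HN x; rewrite E.
    replace (eps + INR k - alpha) with (Re (RtoC (INR k)) - (alpha - eps)) by (simpl; ring).
    now apply HK.
  - intros H b Hb; destruct (H (alpha - b) ltac:(lra)) as [K [N0 HK]].
    apply (obound_eventually s _ _ K N0); [simpl; lra|].
    intros N x HN HN0 _; rewrite <- E.
    replace (Re (RtoC (INR k)) - b) with (alpha - b + INR k - alpha) by (simpl; ring).
    now apply HK.
Qed.

Lemma pos_sum_osum (a : nat -> C) : pos_sum a = osum 1 a.
Proof.
  apply functional_extensionality; intros N; apply functional_extensionality; intros x.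
  unfold pos_sum; rewrite sum_n_m_csum; apply csum_ext; intros n _.
  now rewrite Rmult_1_l.
Qed.

Lemma neg_sum_osum (a : nat -> C) : neg_sum a = osum (-1) a.
Proof.
  apply functional_extensionality; intros N; apply functional_extensionality; intros x.
  unfold neg_sum; rewrite sum_n_m_csum; apply csum_ext; intros n _.
  do 2 f_equal; ring.
Qed.

Lemma side_power (s : Z) (c : Z -> C) (k n : nat) :
  side s (fun m => c m * RtoC (IZR m ^ k))%C n =
  (RtoC (IZR s ^ k) * (side s c n * RtoC (INR n ^ k)))%C.
Proof.
  unfold side; rewrite mult_IZR, <- INR_IZR_INZ, Rpow_mult_distr, RtoC_mult; ring.
Qed.

Lemma growth_iff_two_sided (c : Z -> C) (alpha : R) (k : nat) :
  c 0%Z = RtoC 0 -> alpha <= INR k ->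
  (forall s, is_sign s -> forall b, b < alpha -> growth s (side s c) b (RtoC (INR k))) <->
  (forall eps, 0 < eps -> exists K, eventually (fun N => forall x,
     Cmod (two_sided_sum (fun n => c n * RtoC (IZR n ^ k))%C N x)
       <= K * Rpower (INR N) (eps + INR k - alpha))).
Proof.
  intros c0 Hk; set (d := fun n => (c n * RtoC (IZR n ^ k))%C).
  assert (d0 : d 0%Z = RtoC 0) by (unfold d; rewrite c0; ring).
  (* The weight [n ^ k] keeps the sign of [n]; on the half-line of sign [s] this is the constant
     [s ^ k], its own inverse. *)
  assert (sq : forall s, is_sign s -> IZR s ^ k * IZR s ^ k = 1).
  { intros s Hs; rewrite <- Rpow_mult_distr, <- (pow1 k); f_equal.
    destruct Hs; subst s; ring. }
  split.
  - intros H eps He.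
    assert (Q : forall s, is_sign s -> obound s (side s d) (eps + INR k - alpha)).
    { intros s Hs; assert (A := H s Hs (alpha - eps) ltac:(lra)); unfold growth in A.
      replace (Re (RtoC (INR k)) - (alpha - eps)) with (eps + INR k - alpha) in A
        by (simpl; ring).
      apply (obound_scal s (RtoC (IZR s ^ k))) with (2 := A); intros n Hn.
      unfold d; rewrite side_power; unfold weighted; now rewrite INR_pow_Rcpower. }
    destruct (Q 1%Z (or_introl eq_refl)) as [K1 H1].
    destruct (Q (-1)%Z (or_intror eq_refl)) as [K2 H2].
    exists (K1 + K2), 1%nat; intros N HN x.
    rewrite two_sided_osum, d0, Cplus_0_l.
    eapply Rle_trans; [apply Cmod_triangle|]; rewrite Rmult_plus_distr_r.
    apply Rplus_le_compat; [now apply H1 | now apply H2].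
  - intros H s Hs b Hb.
    (* The gap [alpha - b] is split in two: one half for the [eps] of the hypothesis, one for the
       loss in the pairing. *)
    assert (A := obound_two_sided s d ((alpha - b) / 2 + INR k - alpha) ((alpha - b) / 2)
                   Hs d0 ltac:(lra) ltac:(lra) (H ((alpha - b) / 2) ltac:(lra))).
    unfold growth; replace (Re (RtoC (INR k)) - b) with
      ((alpha - b) / 2 + INR k - alpha + (alpha - b) / 2) by (simpl; field).
    apply (obound_scal s (RtoC (IZR s ^ k))) with (2 := A); intros n Hn.
    unfold d; rewrite side_power; unfold weighted; rewrite INR_pow_Rcpower by assumption.
    rewrite Cmult_assoc, <- RtoC_mult, sq by assumption; ring.
Qed.

Lemma both_signs (P : Z -> Prop) : (P 1%Z /\ P (-1)%Z) <-> (forall s, is_sign s -> P s).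
Proof.
  unfold is_sign; split; [intros [H1 H2] s [-> | ->]; assumption|].
  intros H; split; apply H; auto.
Qed.

Lemma eventually_both (P Q : nat -> R -> Prop) :
  eventually (fun N => forall x, P N x) -> eventually (fun N => forall x, Q N x) ->
  eventually (fun N => forall x, P N x /\ Q N x).
Proof.
  intros HP HQ; generalize (filter_and _ _ HP HQ); apply filter_imp.
  intros N [A B] x; split; [apply A | apply B].
Qed.

Lemma exists_INR_ge (x y : R) : exists k, x <= INR k /\ y <= INR k.
Proof.
  destruct (INR_unbounded (Rmax x y)) as [k Hk]; exists k.
  assert (A := Rmax_l x y); assert (B := Rmax_r x y); lra.
Qed.

(** Dividing by [n ^ r] and then weighting by [n ^ k] is weighting by [n ^ (k - r)]. For [k] above
    both [alpha] and [alpha + Re r], the weights [k] and [k - r] both exceed every [b < alpha], so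
    they can be exchanged in either direction. *)
Lemma series_in_C_lt_shift (s : Z) (a : nat -> C) (alpha : R) (r : C) : is_sign s ->
  series_in_C_lt alpha (osum s a) <->
  series_in_C_lt (alpha + Re r) (osum s (fun n => a n / Rcpower (INR n) r)%C).
Proof.
  intros Hs; destruct (exists_INR_ge alpha (alpha + Re r)) as [k [Hk1 Hk2]].
  rewrite (series_in_C_lt_growth s a alpha k Hs Hk1).
  rewrite (series_in_C_lt_growth s _ (alpha + Re r) k Hs Hk2).
  assert (E : forall b, growth s (fun n => a n / Rcpower (INR n) r)%C (b + Re r) (RtoC (INR k))
                        <-> growth s a b (RtoC (INR k) - r)%C).
  { intros b; unfold growth.
    replace (Re (RtoC (INR k)) - (b + Re r)) with (Re (RtoC (INR k) - r)%C - b)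
      by (simpl; unfold Re; ring).
    assert (W : forall n, weighted (fun n => a n / Rcpower (INR n) r)%C (RtoC (INR k)) n
                          = weighted a (RtoC (INR k) - r)%C n).
    { intros n; unfold weighted.
      assert (nz : Rcpower (INR n) r <> RtoC 0).
      { intros Z; apply (f_equal Cmod) in Z; rewrite Cmod_Rcpower, Cmod_0 in Z.
        generalize (exp_pos (Re r * ln (INR n))); unfold Rpower in Z; lra. }
      transitivity (a n * (Rcpower (INR n) (RtoC (INR k) - r) * Rcpower (INR n) r)
                    / Rcpower (INR n) r)%C.
      - rewrite <- Rcpower_plus.
        replace (RtoC (INR k) - r + r)%C with (RtoC (INR k)) by ring; field; exact nz.
      - field; exact nz. }
    split; apply (obound_scal s (RtoC 1)); intros n _; rewrite W; ring. }
  assert (L : forall b, b < alpha -> b < Re (RtoC (INR k) - r)%C)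
    by (intros b Hb; simpl; unfold Re in *; lra).
  split; intros H b Hb.
  - replace b with (b - Re r + Re r) by ring; apply E.
    apply (growth_change s a _ (RtoC (INR k))); [apply L; lra | apply H; lra].
  - apply (growth_change s a b (RtoC (INR k) - r)%C); [simpl; lra|].
    apply E, H; lra.
Qed.

Theorem theorem3p7 (tau : distribution) (c : Z -> C)
  (tau_periodic : periodic 1 tau)
  (c_0 : c 0%Z = RtoC 0)
  (tau_series : cvg_distr (two_sided_sum c) tau) :
  let c_pos (n : nat) : C := c (Z.of_nat n) in
  let c_neg (n : nat) : C := c (- Z.of_nat n)%Z in
  let cond_a alpha := C_lt_space alpha tau in
  let cond_b alpha :=
    series_in_C_lt alpha (pos_sum c_pos) /\
    series_in_C_lt alpha (neg_sum c_neg) in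
  let cond_c (k : nat) alpha :=
    forall eps : R, 0 < eps -> exists K : R,
      eventually (fun N : nat => forall x : R,
        Cmod (two_sided_sum (fun n => c n * RtoC (IZR n ^ k))%C N x)
          <= K * Rpower (INR N) (eps + INR k - alpha)) in
  let cond_d (k : nat) alpha :=
    forall eps : R, 0 < eps -> exists K : R,
      eventually (fun N : nat => forall x : R,
        Cmod (pos_sum (fun n => c_pos n * RtoC (INR n ^ k))%C N x)
          <= K * Rpower (INR N) (eps + INR k - alpha) /\
        Cmod (neg_sum (fun n => c_neg n * RtoC (INR n ^ k))%C N x)
          <= K * Rpower (INR N) (eps + INR k - alpha)) in
  let cond_e alpha (s : C) :=
    series_in_C_lt (alpha + Re s)
      (pos_sum (fun n => c_pos n / Rcpower (INR n) s)%C) /\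
    series_in_C_lt (alpha + Re s)
      (neg_sum (fun n => c_neg n / Rcpower (INR n) s)%C) in
  (forall (k : nat) (alpha : R), alpha <= INR k ->
     (cond_a alpha <-> cond_b alpha) /\
     (cond_b alpha <-> cond_c k alpha) /\
     (cond_c k alpha <-> cond_d k alpha)) /\
  (forall (alpha : R) (s : C), cond_b alpha <-> cond_e alpha s).
Proof.
  intros c_pos c_neg cond_a cond_b cond_c cond_d cond_e.
  assert (Ep : side 1 c = c_pos).
  { apply functional_extensionality; intros n; unfold side, c_pos.
    now rewrite Z.mul_1_l. }
  assert (En : side (-1) c = c_neg).
  { apply functional_extensionality; intros n; unfold side, c_neg.
    f_equal; lia. }
  split.
  - intros k alpha Hk.
    (* The growth bounds on both half-lines at weight [k] are the condition with which each of the
       four is compared. *)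
    set (G := forall s, is_sign s -> forall b, b < alpha ->
                growth s (side s c) b (RtoC (INR k))).
    assert (Ga : cond_a alpha <-> G).
    { split.
      - intros H s Hs; exact (growth_of_C_lt_space s c tau alpha k Hs c_0 Hk tau_series H).
      (* The synthesised distribution is a limit of the same partial sums, so it agrees with [tau]
         on test functions. *)
      - intros H; destruct (synthesis c alpha k c_0 H) as [T [HT HC]]; intros beta Hb.
        exact (C_space_distr_eq _ _ _ (cvg_distr_unique _ _ _ HT tau_series) (HC beta Hb)). }
    assert (Gb : cond_b alpha <-> G).
    { unfold cond_b, G; rewrite pos_sum_osum, neg_sum_osum, <- both_signs, Ep, En.
      rewrite !(series_in_C_lt_growth _ _ alpha k) by (assumption || (unfold is_sign; lia)).
      easy. }
    assert (Gc : G <-> cond_c k alpha) by now apply growth_iff_two_sided.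
    assert (Gd : G <-> cond_d k alpha).
    { unfold G, cond_d; rewrite pos_sum_osum, neg_sum_osum, <- both_signs, Ep, En.
      rewrite !growth_iff_partial_sums by assumption; split.
      - intros [H1 H2] eps He; destruct (H1 eps He) as [K1 A1], (H2 eps He) as [K2 A2].
        exists (Rmax K1 K2); apply eventually_both.
        + revert A1; apply filter_imp; intros N A x; eapply Rle_trans; [apply A|].
          apply Rmult_le_compat_r; [apply Rlt_le, exp_pos | apply Rmax_l].
        + revert A2; apply filter_imp; intros N A x; eapply Rle_trans; [apply A|].
          apply Rmult_le_compat_r; [apply Rlt_le, exp_pos | apply Rmax_r].
      - intros H; split; intros eps He; destruct (H eps He) as [K A]; exists K;
          revert A; apply filter_imp; intros N A x; apply (A x). }
    tauto.
  - intros alpha s; unfold cond_b, cond_e; rewrite !pos_sum_osum, !neg_sum_osum.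
    rewrite (series_in_C_lt_shift 1 c_pos alpha s) by (unfold is_sign; lia).
    rewrite (series_in_C_lt_shift (-1) c_neg alpha s) by (unfold is_sign; lia).
    easy.
Qed.
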